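(* Let $F\subset\mathbb{N}\times\mathbb{N}$ be a set that contains a sequence $(\tilde p_n,\tilde q_n)$, $n=1,2,\ldots$, such that $\tilde p_n\to+\infty$ and $\tilde q_n\to+\infty$, and let $\Omega\subseteq\mathbb{C}$ be an open set. Let $L,\Delta\subset\mathbb{C}$ be compact sets contained in $\overline{\Omega}$ and let $K\subset\mathbb{C}$ be a compact set such that $K\cap\overline{\Omega}=\emptyset$. Then there exists $f\in X^\infty(\Omega)$ such that for every rational function $h$ there exists a sequence $(p_n,q_n)\in F$ $(n=1,2,\ldots)$ with the following properties: (i) $f\in\mathcal{D}_{p_n,q_n}(\zeta)\cap E_{p_n,q_n,\zeta}(K\cup\Delta)$ for every $\zeta\in L$ (and every $n$); (ii) for every $\ell\in\{0,1,2,\ldots\}$, $\displaystyle\sup_{\zeta\in L}\sup_{z\in\Delta}\big|[f;p_n/q_n]_\zeta^{(\ell)}(z)-f^{(\ell)}(z)\big|\to0$ as $n\to+\infty$; (iii) $\displaystyle\sup_{\zeta\in L}\sup_{z\in K}\chi\big([f;p_n/q_n]_\zeta(z),h(z)\big)\to0$ as $n\to+\infty$. Moreover, the set of all such functions $f\in X^\infty(\Omega)$ is dense and $G_\delta$ in $X^\infty(\Omega)$.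
   Context: $\mathbb{N}=\{0,1,2,\ldots\}$. Closures $\overline{\Omega}$ are taken in $\mathbb{C}$. Function spaces. For an open set $\Omega\subseteq\mathbb{C}$, $A^\infty(\Omega)$ is the set of holomorphic functions $f$ on $\Omega$ such that for every $\ell\in\{0,1,2,\ldots\}$ the derivative $f^{(\ell)}$ extends continuously to $\overline{\Omega}$ (the extension is still denoted $f^{(\ell)}$). It is a Fréchet space with the topology defined by the seminorms $\sup_{z\in \overline{\Omega},|z|\le n}|f^{(\ell)}(z)|$, $\ell\in\{0,1,2,\ldots\}$, $n\in\mathbb{N}$. $X^\infty(\Omega)$ is the closure in $A^\infty(\Omega)$ of the set of all rational functions with poles off $\overline{\Omega}$, with the subspace topology. Chordal metric. On $\mathbb{C}\cup\{\infty\}$, $\chi(a,b)=\frac{|a-b|}{\sqrt{1+|a|^2}\sqrt{1+|b|^2}}$ for $a,b\in\mathbb{C}$, $\chi(a,\infty)=\frac{1}{\sqrt{1+|a|^2}}$ for $a\in\mathbb{C}$, $\chi(\infty,\infty)=0$. Rational functions are regarded as taking values in $\mathbb{C}\cup\{\infty\}$. Padé approximants. For $f\in X^\infty(\Omega)$ and $\zeta\in\overline{\Omega}$ put $a_n=a_n(f,\zeta)=f^{(n)}(\zeta)/n!$ for $n\ge0$ and $a_n=0$ for $n<0$. Let $p,q$ be nonnegative integers. Write $f\in\mathcal{D}_{p,q}(\zeta)$ if $q=0$, or if $q\ge1$ and the $q\times q$ Hankel determinant $\det(a_{p-q+i+j-1})_{1\le i,j\le q}$ is nonzero. Let $S_k(f,\zeta)(z)=\sum_{\nu=0}^k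 a_\nu(z-\zeta)^\nu$ if $k\ge0$ and $S_k=0$ if $k<0$. Define (Jacobi formula) $A(f,\zeta)(z)$ and $B(f,\zeta)(z)$ as the determinants of the $(q+1)\times(q+1)$ matrices with first rows, respectively, $$\big((z-\zeta)^qS_{p-q}(f,\zeta)(z),\ (z-\zeta)^{q-1}S_{p-q+1}(f,\zeta)(z),\ \ldots,\ S_p(f,\zeta)(z)\big)\quad\text{and}\quad\big((z-\zeta)^q,\ (z-\zeta)^{q-1},\ \ldots,\ 1\big),$$ and, in both cases, with $(i+1)$-th row $(a_{p-q+i},a_{p-q+i+1},\ldots,a_{p+i})$ for $i=1,\ldots,q$. For $f\in\mathcal{D}_{p,q}(\zeta)$ the Padé approximant is $[f;p/q]_\zeta(z)=A(f,\zeta)(z)/B(f,\zeta)(z)$; it is the unique rational function $\phi=A/B$ with $\deg A\le p$, $\deg B\le q$, $B(\zeta)\ne0$, whose Taylor coefficients at $\zeta$ of orders $0,\ldots,p+q$ are $a_0,\ldots,a_{p+q}$. $[f;p/q]_\zeta^{(\ell)}$ is its $\ell$-th derivative in $z$. Write $f\in E_{p,q,\zeta}(K)$ if the polynomials $A(f,\zeta)$ and $B(f,\zeta)$ given by the Jacobi formula have no common zero in $K$. *)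

(* Defs.v *)
From HB Require Import structures.
From mathcomp Require Import all_boot all_order all_algebra.
From mathcomp Require Import generic_quotient fraction complex.
From mathcomp Require Import all_classical all_reals all_analysis.

Set Implicit Arguments.
Unset Strict Implicit.
Unset Printing Implicit Defensive.

Import Order.TTheory GRing.Theory Num.Theory.
Import numFieldNormedType.Exports.
Import ComplexField.Normc.

Local Open Scope classical_set_scope.
Local Open Scope ring_scope.
Local Open Scope quotient_scope.

(* R[i], seen as an abstract field so that it carries the topology and the
   normed-module structure induced by its modulus; derivatives of functions
   C R -> C R are then complex derivatives. *)
Definition C (R : realType) : numClosedFieldType := R[i].

(* Supremum in [0, +oo] of a nonnegative function; it is 0 on the empty set. *)
Definition supremum (R : realType) (T : Type) (A : set T) (g : T -> \bar R) :
    \bar R :=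
  ereal_sup (0%E |` [set g z | z in A]).

Section FunctionSpaces.
Variables (R : realType) (Omega : set (C R)).

Definition is_extension (g G : C R -> C R) : Prop :=
  {within closure Omega, continuous G} /\ (forall z, Omega z -> G z = g z).

(* Uniquely determined on [closure Omega] if an extension exists;
   meaningless elsewhere. *)
Definition extension (g : C R -> C R) : C R -> C R :=
  xget (fun=> 0) (is_extension g).

(* f^(l) on [closure Omega] *)
Definition extD (f : C R -> C R) (l : nat) : C R -> C R :=
  extension (derive1n l f).

(* A function on Omega is represented by the total function that extends it
   by 0, so that equality in [Ainf] is equality on Omega. *)
Record Ainf := MkAinf {
  Afun :> C R -> C R;
  Afun_holomorphic : forall z, Omega z -> derivable Afun z 1;
  Afun_extends : forall l : nat, exists G, is_extension (derive1n l Afun) G;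
  Afun_out : forall z, ~ Omega z -> Afun z = 0 }.

HB.instance Definition _ := gen_eqMixin Ainf.
HB.instance Definition _ := gen_choiceMixin Ainf.

Definition Aseminorm (l n : nat) (f : C R -> C R) : \bar R :=
  supremum [set z | closure Omega z /\ normc z <= n%:R]
    (fun z => (normc (extD f l z))%:E).

(* The topology defined by the seminorms: finitely many of them (all those with
   both indices at most m) cut out a basic neighbourhood of f. *)
Definition Aopen : set_system Ainf := [set U | forall f : Ainf, U f ->
  exists m : nat, exists2 e : R, 0 < e & forall g : Ainf,
    (forall l n : nat, (l <= m)%N -> (n <= m)%N ->
       (Aseminorm l n (g \- f)%R < e%:E)%E) -> U g].

Let AopenT : Aopen setT.
Proof. by move=> f _; exists 0%N, 1. Qed.

Let AopenI : setI_closed Aopen.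
Proof.
move=> U V oU oV f [/oU[m [e e0 eU]] /oV[k [d d0 dV]]].
exists (maxn m k), (Num.min e d) => [|g gf]; first by rewrite lt_min e0.
split; [apply: eU|apply: dV] => l n lm nm.
- apply: (lt_le_trans (gf l n _ _)); rewrite ?lee_fin ?ge_min ?lexx //.
  + by rewrite (leq_trans lm) ?leq_maxl.
  + by rewrite (leq_trans nm) ?leq_maxl.
- apply: (lt_le_trans (gf l n _ _)); rewrite ?lee_fin ?ge_min ?lexx ?orbT //.
  + by rewrite (leq_trans lm) ?leq_maxr.
  + by rewrite (leq_trans nm) ?leq_maxr.
Qed.

Let Aopen_bigU (I : Type) (U : I -> set Ainf) :
  (forall i, Aopen (U i)) -> Aopen (\bigcup_i U i).
Proof.
move=> oU f [i _ /oU[m [e e0 eU]]].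
by exists m, e => // g gf; exists i => //; exact: eU.
Qed.

HB.instance Definition _ := isOpenTopological.Build Ainf AopenT AopenI Aopen_bigU.

End FunctionSpaces.

Section RationalFunctions.
Variable R : realType.

Definition sphere : Type := one_point_compactification (C R).

(* The value is read off the reduced form of the fraction; None is oo. *)
Definition rat_value (r : {fraction {poly C R}}) (z : C R) : sphere :=
  let P := (frac (repr r)).1 in let Q := (frac (repr r)).2 in
  let A := P %/ gcdp P Q in let B := Q %/ gcdp P Q in
  if root B z then None else Some (A.[z] / B.[z]).

(* r^(l)(z), for z not a pole of r *)
Definition rat_derive (r : {fraction {poly C R}}) (l : nat) (z : C R) : C R :=
  derive1n l (fun w => odflt 0 (rat_value r w)) z.

Definition chordal (a b : sphere) : R :=
  match a, b with
  | Some x, Some y =>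
      normc (x - y) / (Num.sqrt (1 + normc x ^+ 2) * Num.sqrt (1 + normc y ^+ 2))
  | Some x, None | None, Some x => 1 / Num.sqrt (1 + normc x ^+ 2)
  | None, None => 0
  end.

Definition rationals_off (Omega : set (C R)) : set (Ainf Omega) :=
  [set f | exists r : {fraction {poly C R}},
     (forall z, closure Omega z -> rat_value r z <> None) /\
     (forall z, Omega z -> rat_value r z = Some (f z))].

Definition Xinf (Omega : set (C R)) : set (Ainf Omega) :=
  closure (@rationals_off Omega).

End RationalFunctions.

Arguments Xinf {R} Omega _.

Section Pade.
Variables (R : realType) (Omega : set (C R)) (f : C R -> C R).
Variables (p q : nat) (zeta : C R).

(* Indices are integers because p - q may be negative. *)
Definition taylor_coef (n : int) : C R :=
  if n is Posz k then extD Omega f k zeta / k`!%:R else 0.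

Definition taylor_poly (k : int) : {poly C R} :=
  if k is Posz m
  then \sum_(v < m.+1) taylor_coef v%:Z *: ('X - zeta%:P) ^+ v
  else 0.

Definition hankel : 'M[C R]_q :=
  \matrix_(i < q, j < q)
    taylor_coef (p%:Z - q%:Z + i.+1%:Z + j.+1%:Z - 1).

Definition in_D : Prop := q = 0%N \/ ((1 <= q)%N /\ \det hankel != 0).

Definition jacobi_det (first_row : 'I_q.+1 -> {poly C R}) : {poly C R} :=
  \det (\matrix_(i < q.+1, j < q.+1)
    if i == ord0 then first_row j
    else (taylor_coef (p%:Z - q%:Z + i%:Z + j%:Z))%:P).

Definition padeA : {poly C R} :=
  jacobi_det (fun j => ('X - zeta%:P) ^+ (q - j) *
                       taylor_poly (p%:Z - q%:Z + j%:Z)).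

Definition padeB : {poly C R} :=
  jacobi_det (fun j => ('X - zeta%:P) ^+ (q - j)).

Definition pade : {fraction {poly C R}} := tofrac padeA / tofrac padeB.

Definition in_E (S : set (C R)) : Prop :=
  forall z, S z -> ~ (root padeA z /\ root padeB z).

(* |[f;p/q]^(l)(z) - f^(l)(z)|, which is +oo at a pole *)
Definition pade_error (l : nat) (z : C R) : \bar R :=
  if rat_value pade z is Some _
  then (normc (rat_derive pade l z - extD Omega f l z))%:E
  else +oo%E.

End Pade.

Definition pade_universal (R : realType) (F : set (nat * nat))
    (Omega L Delta K : set (C R)) (f : C R -> C R) : Prop :=
  forall h : {fraction {poly C R}},
    exists p q : nat -> nat,
      [/\ forall n, F (p n, q n),
          forall n zeta, L zeta ->
            in_D Omega f (p n) (q n) zeta /\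
            in_E Omega f (p n) (q n) zeta (K `|` Delta),
          forall l : nat,
            supremum L (fun zeta => supremum Delta
              (pade_error Omega f (p n) (q n) zeta l))
              @[n --> \oo] --> 0%E
        & supremum L (fun zeta => supremum K (fun z =>
              (chordal (rat_value (pade Omega f (p n) (q n) zeta) z)
                       (rat_value h z))%:E))
              @[n --> \oo] --> 0%E].

Definition universal (R : realType) (F : set (nat * nat))
    (Omega L Delta K : set (C R)) : set (Xinf Omega) :=
  [set f | pade_universal F Omega L Delta K (set_val f : Ainf Omega)].

Arguments universal {R} F Omega L Delta K _.

(* Main.v *)
(* Approximate a given rational P/Q near closure Omega and H/G on K by one rational
   N/D in lowest terms with deg N = p, deg D <= q and (p, q) in F: with U/V close to
   0 near closure Omega and to 1 on K, take ((V - U) P + U H : (V - U) Q + U G) and add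
   to the numerator a small multiple of a suitable X^k D.  Such a quotient is its own
   [p/q] Pade approximant at every zeta in L, so the functions whose [p/q] approximant
   is 1/s-close to them on Delta and to H/G on K, for some (p, q) in F, form a dense
   open set.  Countably many pairs (H, G) suffice, and the Baire category argument
   applies, A^oo being complete. *)

From HB Require Import structures.
Require Import Defs.
From mathcomp Require Import all_boot all_order all_algebra.
From mathcomp Require Import generic_quotient fraction complex.
From mathcomp Require Import all_classical all_reals all_analysis.
From mathcomp Require Import borel_hierarchy.
From mathcomp Require Import ring lra zify.

Set Implicit Arguments.
Unset Strict Implicit.
Unset Printing Implicit Defensive.
Import Order.TTheory GRing.Theory Num.Theory.
Import numFieldNormedType.Exports.
Import ComplexField.Normc.
Local Open Scope classical_set_scope.
Local Open Scope ring_scope.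

(** * Elementary complex analysis *)

(** Three obstacles shape the construction. [Omega] may be unbounded, so smallness of U/V does not
    keep the interpolant close to P/Q: products of U/V with fixed polynomials must be small too,
    hence [separation] provides decay of any prescribed order in 1 + |z|. The topology of A^oo sees
    all derivatives up to the boundary, where no disc fits into [Omega]; the approximation is
    therefore made on a thickening of the closure, where Q is still bounded away from 0, and Cauchy
    estimates carry it over to derivatives. Finally, approximants and h may have poles on [K], so
    chordal distances are expressed by determinants of homogeneous coordinates. This turns (iii),
    and (ii) after clearing powers of B, into strict inequalities without denominators, stable under
    small changes of f, zeta and z. The numerator is perturbed because a reduced N/D with D nonzero
    at zeta has nonzero Hankel determinant there once deg N is exactly p and deg D <= q, and adding
    a multiple of D keeps the pair coprime. *)

Lemma is_derive1P (K : numFieldType) (f : K -> K) (z d : K) :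
  is_derive z 1 f d <-> forall e : K, 0 < e -> exists2 r : K, 0 < r &
    forall w, `|w - z| < r -> `|f w - f z - d * (w - z)| <= e * `|w - z|.
Proof.
pose q h := h^-1 *: ((f \o shift z) (h *: 1) - f z) : K.
have lim0 : q h @[h --> 0^'] --> d <-> forall e : K, 0 < e -> exists2 r : K, 0 < r &
    forall w, `|w - z| < r -> `|f w - f z - d * (w - z)| <= e * `|w - z|.
  split.
  - move=> /cvgrPdistC_lt h e /h; rewrite near_withinE => /nbhs_normP[r /= r0 rq].
    exists r => // w wr; have [->|wz] := eqVneq w z.
      by rewrite !subrr mulr0 subrr normr0 mulr0.
    have wz0 : w - z != 0 by rewrite subr_eq0.
    have := rq (w - z); rewrite /ball_ /= sub0r normrN => /(_ wr wz0).
    rewrite /q /= [_ *: 1]mulr1 subrK => /ltW.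
    rewrite [_ *: _]mulrC -(ler_pM2r (_ : 0 < `|w - z|)) ?normr_gt0//.
    by rewrite -normrM mulrBl divfK.
  - move=> h; apply/cvgrPdistC_le => e e0.
    have [r r0 hr] := h _ e0; rewrite near_withinE; apply/nbhs_normP; exists r => //.
    move=> k; rewrite /ball_ /= sub0r normrN => kr k0.
    have := hr (k + z); rewrite addrK => /(_ kr).
    rewrite /q /= [k *: 1]mulr1 => hk.
    have : `|k^-1 * (f (k + z) - f z) - d| * `|k| <= e * `|k|.
      by rewrite -normrM mulrBl mulrAC mulVf// mul1r.
    by rewrite ler_pM2r ?normr_gt0.
rewrite -lim0; split.
- by case=> df <-; move: df; rewrite /derivable /derive -/q => /cvg_ex[l ql]; apply: cvgP ql.
- move=> qd; have df : derivable f z 1 by apply/cvg_ex; exists d.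
  by apply: DeriveDef => //; exact: cvg_lim.
Qed.

(** * The real-valued modulus on the complex field *)

Section Norm.
Variable R : realType.
Implicit Types z w : C R.

Lemma ge0_normc z : 0 <= normc z.
Proof. by case: z => a b; exact: sqrtr_ge0. Qed.

Lemma normc_le_add z w : normc (z + w) <= normc z + normc w.
Proof. exact: (@le_normcD R z w). Qed.

Lemma normc_opp z : normc (- z) = normc z.
Proof. exact: (@normcN R z). Qed.

Lemma normc_sub z w : normc (z - w) = normc (w - z).
Proof. by rewrite -normc_opp opprB. Qed.

Lemma normc_mul z w : normc (z * w) = normc z * normc w.
Proof. exact: normcM. Qed.

Lemma normc_eq0 z : (normc z == 0) = (z == 0).
Proof.
by apply/eqP/eqP => [/(@eq0_normc R)//|->]; exact: normc0.
Qed.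

Lemma normc_gt0 z : (0 < normc z) = (z != 0).
Proof. by rewrite lt_def ge0_normc andbT normc_eq0. Qed.

Lemma normc_exp z n : normc (z ^+ n) = normc z ^+ n.
Proof.
elim: n => [|n IH]; first by rewrite !expr0 (@normc1 R).
by rewrite !exprS normc_mul IH.
Qed.

Lemma normc_div z w : normc (z / w) = normc z / normc w.
Proof. by rewrite normc_mul (@normcV R w). Qed.

Lemma normc_nat n : normc (n%:R : C R) = n%:R.
Proof.
have -> : (n%:R : C R) = (1 : C R) *+ n by [].
by rewrite (@normcMn R (1 : R[i]) n) (@normc1 R).
Qed.

Lemma normc_sum (I : Type) (s : seq I) (P : pred I) (F : I -> C R) :
  normc (\sum_(i <- s | P i) F i) <= \sum_(i <- s | P i) normc (F i).
Proof.
elim/big_rec2: _ => [|i y x _ IH]; first by rewrite (@normc0 R).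
by apply: le_trans (normc_le_add _ _) _; rewrite lerD2l.
Qed.

Lemma normc_lb z w : normc z - normc w <= normc (z - w).
Proof. by have := normc_le_add (z - w) w; rewrite subrK; lra. Qed.

Lemma normc_triangle y z w : normc (z - w) <= normc (z - y) + normc (y - w).
Proof. by apply: le_trans (normc_le_add _ _); rewrite addrA subrK. Qed.

(** The norm of [C R] as a normed module takes values in [C R] itself; [rc] links it to the
    real-valued [normc], so that radii and bounds stay real. *)
Definition rc (x : R) : C R := real_complex R x.

Lemma normE z : `|z| = rc (normc z). Proof. by case: z. Qed.

Lemma ltrc (x y : R) : (rc x < rc y) = (x < y). Proof. exact: ltcR. Qed.
Lemma lerc (x y : R) : (rc x <= rc y) = (x <= y). Proof. exact: lecR. Qed.

Lemma normc_rc (x : R) : normc (rc x) = `|x|.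
Proof. by rewrite /= expr0n addr0 sqrtr_sqr. Qed.

Lemma rcD x y : rc (x + y) = rc x + rc y. Proof. exact: (rmorphD (real_complex R)). Qed.
Lemma rcB x y : rc (x - y) = rc x - rc y. Proof. exact: (rmorphB (real_complex R)). Qed.
Lemma rcM x y : rc (x * y) = rc x * rc y. Proof. exact: (rmorphM (real_complex R)). Qed.
Lemma rc0 : rc 0 = 0. Proof. by []. Qed.
Lemma rc1 : rc 1 = 1. Proof. by []. Qed.

Lemma pos_rc (e : C R) : 0 < e -> exists2 d : R, 0 < d & e = rc d.
Proof.
case: e => a b; rewrite ltcE /= => /andP[/eqP -> a0].
by exists a.
Qed.

Lemma nbhsCP (z : C R) (A : set (C R)) :
  nbhs z A <-> exists2 e : R, 0 < e & forall w, normc (w - z) < e -> A w.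
Proof.
split.
- move=> /nbhs_normP[e e0 eA]; have [d d0 ed] := pos_rc e0.
  exists d => // w wd; apply: eA; rewrite /ball_ /= distrC normE ed.
  by rewrite ltrc.
- move=> [e e0 eA]; apply/nbhs_normP; exists (rc e); first by rewrite /= -rc0 ltrc.
  by move=> w; rewrite /ball_ /= distrC normE ltrc; exact: eA.
Qed.

Lemma cvgCP (T : Type) (F : set_system T) (f : T -> C R) (a : C R) :
  Filter F ->
  f t @[t --> F] --> a <-> forall e : R, 0 < e -> \forall t \near F, normc (f t - a) < e.
Proof.
move=> FF; split.
- move=> /cvgrPdistC_lt h e e0; have := h (rc e).
  rewrite -{1}rc0 ltrc => /(_ e0); apply: filterS => t.
  by rewrite normE ltrc.
- move=> h; apply/cvgrPdistC_lt => e /pos_rc[d d0 ->].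
  by apply: filterS (h _ d0) => t; rewrite normE ltrc.
Qed.

Lemma cvg_atP (f : C R -> C R) (z a : C R) :
  f w @[w --> z] --> a <-> forall e : R, 0 < e -> exists2 d : R, 0 < d &
    forall w, normc (w - z) < d -> normc (f w - a) < e.
Proof.
split=> [/cvgCP h e /h /nbhsCP//|h].
by apply/(@cvgCP _ (nbhs z) f a _) => e /h he; apply/nbhsCP.
Qed.

Lemma open_ballC (z : C R) (r : R) : open [set w : C R | normc (w - z) < r].
Proof.
rewrite openE => w /= wr; apply/nbhsCP; exists (r - normc (w - z)).
  by rewrite subr_gt0.
by move=> v vw /=; have := normc_triangle w v z; lra.
Qed.

Lemma openCP (A : set (C R)) (z : C R) : open A -> A z ->
  exists2 e : R, 0 < e & forall w, normc (w - z) < e -> A w.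
Proof. by move=> oA Az; apply/nbhsCP; exact: open_nbhs_nbhs. Qed.

Lemma closureCP (A : set (C R)) (z : C R) :
  closure A z <-> forall e : R, 0 < e -> exists2 w, A w & normc (w - z) < e.
Proof.
split => [h e e0|h B /nbhsCP[e e0 eB]].
  have /h[w [Aw wz]] : nbhs z [set w : C R | normc (w - z) < e].
    by apply/nbhsCP; exists e.
  by exists w.
by have [w Aw wz] := h e e0; exists w; split => //; exact: eB.
Qed.

Lemma deriveCP (f : C R -> C R) (z d : C R) :
  is_derive z 1 f d <-> forall e : R, 0 < e -> exists2 r : R, 0 < r &
    forall w, normc (w - z) < r ->
      normc (f w - f z - d * (w - z)) <= e * normc (w - z).
Proof.
rewrite is_derive1P; split=> h.
- move=> e e0; have [|r /pos_rc[s s0 ->] hr] := h (rc e); first by rewrite -rc0 ltrc.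
  by exists s => // w; rewrite -ltrc -lerc rcM -!normE; exact: hr.
- move=> _ /pos_rc[e e0 ->]; have [r r0 hr] := h e e0.
  exists (rc r); first by rewrite -rc0 ltrc.
  by move=> w; rewrite !normE -rcM ltrc lerc; exact: hr.
Qed.

End Norm.

Section Basics.
Variable R : realType.
Implicit Types z w : C R.

Lemma cvgCP_seq (u : nat -> C R) (a : C R) :
  u n @[n --> \oo] --> a <->
  forall e : R, 0 < e -> exists N : nat, forall n, (N <= n)%N -> normc (u n - a) < e.
Proof.
rewrite cvgCP; split=> h e /h.
- by move=> [N _ hN]; exists N => n Nn; exact: hN.
- by move=> [N hN]; exists N.
Qed.

Lemma normc_lim (u : nat -> C R) (a b : C R) (B : R) :
  u n @[n --> \oo] --> a -> (forall n, normc (u n - b) <= B) -> normc (a - b) <= B.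
Proof.
move=> /cvgCP_seq ua uB; apply/ler_addgt0Pr => e /ua[N] /(_ N (leqnn N)) h.
have := normc_triangle (u N) a b; rewrite (normc_sub a (u N)); have := uB N.
lra.
Qed.

Lemma normReIm z : normc z <= `|complex.Re z| + `|complex.Im z|.
Proof.
case: z => a b /=; rewrite -[leRHS]ger0_norm ?addr_ge0//.
rewrite -sqrtr_sqr ler_sqrt ?sqr_ge0// sqrrD !real_normK ?num_real//.
by rewrite lerD2r lerDl mulrn_wge0// mulr_ge0.
Qed.

Lemma Re_le_normc z : `|complex.Re z| <= normc z.
Proof.
case: z => a b /=; rewrite -sqrtr_sqr ler_sqrt ?addr_ge0 ?sqr_ge0//.
by rewrite lerDl sqr_ge0.
Qed.

Lemma Im_le_normc z : `|complex.Im z| <= normc z.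
Proof.
case: z => a b /=; rewrite -sqrtr_sqr ler_sqrt ?addr_ge0 ?sqr_ge0//.
by rewrite lerDr sqr_ge0.
Qed.

Lemma ReB z w : complex.Re (z - w) = complex.Re z - complex.Re w. Proof. by case: z; case: w. Qed.
Lemma ImB z w : complex.Im (z - w) = complex.Im z - complex.Im w. Proof. by case: z; case: w. Qed.

Lemma cauchyR (u : nat -> R) :
  (forall e : R, 0 < e -> exists N, forall n, (N <= n)%N -> `|u n - u N| < e) ->
  exists a : R, u n @[n --> \oo] --> a.
Proof.
move=> h; suff cu : cauchy (u @ \oo) by exists (lim (u @ \oo)); exact: (@cauchy_cvg R).
apply: cauchy_exP => e /h[N hN]; exists (u N); exists N => // n Nn.
by rewrite /ball /= distrC; exact: hN.
Qed.

Lemma cauchyC (u : nat -> C R) :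
  (forall e : R, 0 < e -> exists N, forall n, (N <= n)%N -> normc (u n - u N) < e) ->
  exists a : C R, u n @[n --> \oo] --> a.
Proof.
move=> h.
have [a ua] : exists a : R, complex.Re (u n) @[n --> \oo] --> a.
  apply: cauchyR => e /h[N hN]; exists N => n /hN; apply: le_lt_trans.
  by rewrite -ReB Re_le_normc.
have [b ub] : exists a : R, complex.Im (u n) @[n --> \oo] --> a.
  apply: cauchyR => e /h[N hN]; exists N => n /hN; apply: le_lt_trans.
  by rewrite -ImB Im_le_normc.
exists (Complex a b : C R); apply/cvgCP => e e0.
have e2 : 0 < e / 2 by lra.
move/cvgrPdistC_lt : ua => /(_ _ e2) ua; move/cvgrPdistC_lt : ub => /(_ _ e2) ub.
near=> n; apply: le_lt_trans (normReIm _) _; rewrite ReB ImB /=.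
have h1 : `|complex.Re (u n) - a| < e / 2 by near: n.
have h2 : `|complex.Im (u n) - b| < e / 2 by near: n.
by lra.
Unshelve. all: by end_near. Qed.

Lemma closed_disc (a : C R) (r : R) : closed [set w : C R | normc (w - a) <= r].
Proof.
move=> w wA /=; rewrite leNgt; apply/negP => wr.
have d0 : 0 < normc (w - a) - r by rewrite subr_gt0.
have [v /= va vw] := (closureCP _ _).1 wA _ d0.
by have := normc_triangle v w a; rewrite (normc_sub w v); lra.
Qed.

Lemma compact_disc (a : C R) (r : R) : compact [set w : C R | normc (w - a) <= r].
Proof.
pose f (x : R * R) : C R := Complex x.1 x.2.
have fc : continuous f.
  move=> x; apply/cvgCP => e e0.
  have e2 : 0 < e / 2 by lra.
  near=> y; apply: le_lt_trans (normReIm _) _; rewrite ReB ImB /=.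
  have h1 : `|y.1 - x.1| < e / 2.
    near: y; have /cvgrPdistC_lt : y.1 @[y --> x] --> x.1 by exact: cvg_fst.
    exact.
  have h2 : `|y.2 - x.2| < e / 2.
    near: y; have /cvgrPdistC_lt : y.2 @[y --> x] --> x.2 by exact: cvg_snd.
    exact.
  by lra.
pose P := `[complex.Re a - r, complex.Re a + r] `*` `[complex.Im a - r, complex.Im a + r].
have cP : compact (f @` P).
  apply: continuous_compact; first exact: continuous_subspaceT.
  by apply: compact_setX; exact: segment_compact.
apply: subclosed_compact cP _.
  exact: closed_disc.
move=> w /= wr; exists (complex.Re w, complex.Im w); last by case: w {wr}.
have := le_trans (Re_le_normc (w - a)) wr; have := le_trans (Im_le_normc (w - a)) wr.
rewrite ReB ImB !ler_norml => /andP[h1 h2] /andP[h3 h4].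
by split; rewrite /= in_itv /=; apply/andP; split; lra.
Unshelve. all: by end_near. Qed.

(** Continuity at the points of [K] is meant in full neighbourhoods, so [w] may leave [K]; halving
    the local radii gives the common [d]. *)
Lemma compact_unif_continuous (K : set (C R)) (f : C R -> C R) : compact K ->
  (forall z, K z -> f w @[w --> z] --> f z) ->
  forall e : R, 0 < e -> exists2 d : R, 0 < d &
  forall z w, K z -> normc (w - z) < d -> normc (f w - f z) < e.
Proof.
move=> /compact_near_coveringP cK fc e e0.
pose P (d : R) z := forall w, normc (w - z) < d -> normc (f w - f z) < e.
have : \forall d \near 0^'+, K `<=` P d.
  apply: cK => z Kz; have /cvgCP/(_ (e / 2))/(_ _)/nbhsCP[|d d0 hd] := fc z Kz; first by lra.
  have d2 : 0 < d / 2 by lra.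
  exists ([set w : C R | normc (w - z) < d / 2], [set x | 0 < x < d / 2]).
    split; first by apply/nbhsCP; exists (d / 2).
    near=> x; apply/andP; split; first by near: x; exact: nbhs_right_gt.
    by near: x; exact: nbhs_right_lt.
  move=> [v x] /= [vz /andP[x0 xd]] w wv.
  have h1 := hd v; have h2 := hd w; have h3 := normc_triangle v w z.
  have h4 := normc_triangle (f z) (f w) (f v).
  have := normc_sub (f z) (f v).
  have := h1 _; have := h2 _. 
  move=> /(_ ltac:(lra)) ? /(_ ltac:(lra)) ?; lra.
move=> hK; have [d [d0 hd]] : exists d : R, 0 < d /\ K `<=` P d.
  near (0 : R)^'+ => d; exists d; split; last by near: d.
  by near: d; exact: nbhs_right_gt.
by exists d => // z w Kz; exact: hd.
Unshelve. all: by end_near. Qed.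

(* Through the real mean value theorem on both coordinates, whence the factor 2. *)
Lemma mean_value01 (g g' : C R -> C R) (B : R) :
  (forall t : R, 0 <= t <= 1 -> is_derive (rc t) 1 g (g' (rc t))) ->
  (forall t : R, 0 < t < 1 -> normc (g' (rc t)) <= B) ->
  normc (g 1 - g 0) <= 2 * B.
Proof.
move=> dg gB.
have part (p : C R -> R) : (forall x y, p (x - y) = p x - p y) ->
    (forall x, `|p x| <= normc x) -> (forall x t, p (x * rc t) = p x * t) ->
    `|p (g 1) - p (g 0)| <= B.
  move=> pB pn pM.
  have dp (t : R) : 0 <= t <= 1 -> is_derive t 1 (fun t : R => p (g (rc t))) (p (g' (rc t))).
    move=> t01; apply/is_derive1P => e e0.
    have [r r0 hr] := (deriveCP _ _ _).1 (dg t t01) e e0; exists r => // w wt.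
    have := hr (rc w); rewrite -rcB normc_rc => /(_ wt); apply: le_trans.
    by apply: le_trans (pn _); rewrite !pB pM.
  have [x||c] := @MVT R (fun t : R => p (g (rc t)))
      (fun t : R => p (g' (rc t))) 0 1 ltr01.
  - by rewrite in_itv /= => /andP[x0 x1]; apply: dp; rewrite !ltW.
  - apply: derivable_within_continuous => x; rewrite in_itv /= => x01.
    by have [] := dp x x01.
  - rewrite in_itv /= => c01; rewrite subr0 mulr1 rc1 rc0 => ->.
    by apply: le_trans (gB _ _).
apply: le_trans (normReIm _) _; rewrite mulr_natl mulr2n ReB ImB.
apply: lerD; apply: part => [x y|x|x t].
- exact: ReB.
- exact: Re_le_normc.
- by case: x => a b /=; rewrite mulr0 subr0.
- exact: ImB.
- exact: Im_le_normc.
- by case: x => a b /=; rewrite mulr0 add0r.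
Qed.

(** Composition with the segment from [z] to [w] reduces to [0, 1]. The bound on [f'] is asked only
    at distance at most |w - z| from [z], so that a modulus of continuity of [f'] can supply it. *)
Lemma mean_value (f f' : C R -> C R) (a : C R) (r B : R) z w :
  (forall v, normc (v - a) < r -> is_derive v 1 f (f' v)) ->
  normc (z - a) < r -> normc (w - a) < r ->
  (forall v, normc (v - z) <= normc (w - z) -> normc (v - a) < r -> normc (f' v) <= B) ->
  normc (f w - f z) <= 2 * (B * normc (w - z)).
Proof.
move=> df za wa fB.
pose g s := f (z + s * (w - z)).
have inball (t : R) : 0 <= t <= 1 -> normc (z + rc t * (w - z) - a) < r.
  move=> /andP[t0 t1].
  have -> : z + rc t * (w - z) - a = rc (1 - t) * (z - a) + rc t * (w - a).
    by rewrite rcB rc1; ring.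
  apply: le_lt_trans (normc_le_add _ _) _; rewrite !normc_mul !normc_rc.
  rewrite !ger0_norm ?subr_ge0//; have [->|t0'] := eqVneq t 0.
    by rewrite subr0 mul1r mul0r addr0.
  have : t * normc (w - a) < t * r by rewrite ltr_pM2l// lt_def t0'.
  have : (1 - t) * normc (z - a) <= (1 - t) * r by rewrite ler_wpM2l ?subr_ge0// ltW.
  by lra.
have -> : f w - f z = g 1 - g 0 by rewrite /g mul1r mul0r addr0 subrKC.
apply: (@mean_value01 g (fun s => f' (z + s * (w - z)) * (w - z))) => t t01;
  last have {}t01 : 0 <= t <= 1 by case/andP: t01 => *; rewrite !ltW.
- have [wz|wz] := eqVneq w z.
    have -> : g = cst (f z) by apply/funext => s; rewrite /g wz subrr mulr0 addr0.
    by rewrite /= wz subrr mulr0; exact: is_derive_cst.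
  apply/deriveCP => e e0; have n0 : 0 < normc (w - z) by rewrite normc_gt0 subr_eq0.
  have [d d0 hd] := (deriveCP _ _ _).1 (df _ (inball _ t01)) (e / normc (w - z))
    (divr_gt0 e0 n0).
  exists (d / normc (w - z)); first exact: divr_gt0.
  move=> s; rewrite ltr_pdivlMr// => hs; have := hd (z + s * (w - z)).
  have -> : z + s * (w - z) - (z + rc t * (w - z)) = (s - rc t) * (w - z) by ring.
  rewrite normc_mul => /(_ hs).
  have -> : e / normc (w - z) * (normc (s - rc t) * normc (w - z)) = e * normc (s - rc t).
    by field; rewrite gt_eqF.
  by congr (normc _ <= _); rewrite /g; ring.
- rewrite normc_mul ler_wpM2r ?ge0_normc//; apply: fB; last exact: inball.
  have -> : z + rc t * (w - z) - z = rc t * (w - z) by ring.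
  rewrite normc_mul normc_rc ger0_norm; last by case/andP: t01.
  by rewrite ler_piMl ?ge0_normc//; case/andP: t01.
Qed.

(** [mean_value] is used twice, on [f] minus its linear part at [z] and on [f']; each use costs a
    factor 2. *)
Lemma taylor2 (f f' f'' : C R -> C R) (a : C R) (r B : R) z w :
  (forall v, normc (v - a) < r -> is_derive v 1 f (f' v)) ->
  (forall v, normc (v - a) < r -> is_derive v 1 f' (f'' v)) ->
  (forall v, normc (v - a) < r -> normc (f'' v) <= B) ->
  normc (z - a) < r -> normc (w - a) < r ->
  normc (f w - f z - f' z * (w - z)) <= 4 * B * normc (w - z) ^+ 2.
Proof.
move=> df df' fB za wa.
pose g v := f v - f' z * v.
have -> : f w - f z - f' z * (w - z) = g w - g z by rewrite /g; ring.
have dg v : normc (v - a) < r -> is_derive v 1 g (f' v - f' z).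
  move=> va; apply: is_deriveB; first exact: df.
  by have := is_deriveZ (f' z) (is_derive_id v (1 : C R)); rewrite [_ *: _]mulr1.
have := @mean_value g (fun v => f' v - f' z) a r (2 * (B * normc (w - z))) z w dg za wa.
have B0 : 0 <= B by apply: le_trans (fB z za); exact: ge0_normc.
move=> h; apply: le_trans (h _) _; last by lra.
move=> v vz va; apply: le_trans (mean_value df' za va _) _.
  by move=> u _ ua; exact: fB.
by rewrite ler_pM2l// ler_wpM2l.
Qed.

(** Up to an error of at most 4 M h, uniform in n, the derivative of order l + 1 at w is the
    difference quotient of order l between w and w + h; convergence of order l at these two points
    thus makes order l + 1 a Cauchy sequence. *)
Lemma smooth_limit (g : nat -> nat -> C R -> C R) (f : C R -> C R) (a : C R) (r : R)
    (M : nat -> R) :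
  (forall n l w, normc (w - a) < r -> is_derive w 1 (g n l) (g n l.+1 w)) ->
  (forall n l w, normc (w - a) < r -> normc (g n l w) <= M l) ->
  (forall w, normc (w - a) < r -> g n 0%N w @[n --> \oo] --> f w) ->
  exists G : nat -> C R -> C R,
    [/\ forall w, normc (w - a) < r -> G 0%N w = f w,
        forall l w, normc (w - a) < r -> is_derive w 1 (G l) (G l.+1 w)
      & forall l w, normc (w - a) < r -> g n l w @[n --> \oo] --> G l w].
Proof.
move=> dg gM g0.
have T2 n l z w : normc (z - a) < r -> normc (w - a) < r ->
    normc (g n l w - g n l z - g n l.+1 z * (w - z)) <= 4 * M l.+2 * normc (w - z) ^+ 2.
  by move=> za wa; apply: (taylor2 (dg n l) (dg n l.+1) _ za wa) => v va; exact: gM.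
have cv l w : normc (w - a) < r -> exists b : C R, g n l w @[n --> \oo] --> b.
  elim: l w => [|l IH] w wa; first by exists (f w); exact: g0.
  apply: cauchyC => e e0.
  have M0 : 0 <= M l.+2 by apply: le_trans (gM 0%N _ _ wa); exact: ge0_normc.
  (* The two Taylor errors are at most e h / 8 each and the four distances to the limits below e h /
     8 each, which sums to less than e h; the first entry keeps w + h in the disc. *)
  pose h := Num.min ((r - normc (w - a)) / 2) (e / (32 * M l.+2 + 1)).
  have h0 : 0 < h by rewrite /h lt_min !divr_gt0//; lra.
  have hr : h < r - normc (w - a) by rewrite gt_min; apply/orP; left; lra.
  have hM : h * (32 * M l.+2 + 1) <= e.
    by rewrite -ler_pdivlMr ?ge_min ?lexx ?orbT//; lra.
  pose v : C R := w + rc h.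
  have vw : v - w = rc h by rewrite /v addrAC subrr add0r.
  have va : normc (v - a) < r.
    by have := normc_triangle w v a; rewrite vw normc_rc gtr0_norm//; lra.
  have [b1 /cvgCP_seq/(_ (h * (e / 8)))[|N1 hN1]] := IH w wa.
    by rewrite mulr_gt0//; lra.
  have [b2 /cvgCP_seq/(_ (h * (e / 8)))[|N2 hN2]] := IH v va.
    by rewrite mulr_gt0//; lra.
  exists (maxn N1 N2) => n; set N := maxn N1 N2 => Nn.
  have T k := T2 k l w v wa va.
  pose E k := g k l v - g k l w - g k l.+1 w * (v - w).
  have -> : g n l.+1 w - g N l.+1 w =
     ((g n l v - b2) - (g N l v - b2) - ((g n l w - b1) - (g N l w - b1)) - (E n - E N)) / rc h.
    have rh0 : rc h != 0 by rewrite -normc_gt0 normc_rc normr_gt0 gt_eqF.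
    by rewrite /E vw; field.
  rewrite normc_div normc_rc (gtr0_norm h0) ltr_pdivrMr//.
  have TN k : normc (E k) <= 4 * M l.+2 * h ^+ 2.
    by have := T k; rewrite -/(E k) vw normc_rc gtr0_norm.
  have a1 := hN1 n (leq_trans (leq_maxl _ _) Nn).
  have a2 := hN2 n (leq_trans (leq_maxr _ _) Nn).
  have a3 := hN1 N (leq_maxl _ _).
  have a4 := hN2 N (leq_maxr _ _).
  have tri (x y : C R) : normc (x - y) <= normc x + normc y.
    by rewrite -[normc y]normc_opp; exact: normc_le_add.
  apply: le_lt_trans (tri _ _) _.
  have := tri (E n) (E N); have := tri (g n l v - b2 - (g N l v - b2)) (g n l w - b1 - (g N l w - b1)).
  have := tri (g n l v - b2) (g N l v - b2); have := tri (g n l w - b1) (g N l w - b1).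
  have := TN n; have := TN N.
  have : 4 * M l.+2 * h ^+ 2 <= e * h / 8.
    rewrite expr2 mulrA; have -> : e * h / 8 = (e / 8) * h by ring.
    by rewrite ler_pM2r//; nra.
  nra.
pose G l w := lim (g n l w @[n --> \oo]).
have gG l w : normc (w - a) < r -> g n l w @[n --> \oo] --> G l w.
  by move=> /(cv l)[b hb]; apply: cvgP hb.
exists G; split => // [w wa|l w wa].
  by apply: (cvg_unique _ (gG 0%N w wa) (g0 w wa)) => //; exact: norm_hausdorff.
have M0 : 0 <= M l.+2 by apply: le_trans (gM 0%N _ _ wa); exact: ge0_normc.
apply/deriveCP => e e0.
pose h := Num.min (r - normc (w - a)) (e / (4 * M l.+2 + 1)).
have h0 : 0 < h by rewrite /h lt_min subr_gt0 wa divr_gt0//; lra.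
exists h => // v vw; rewrite lt_min in vw; have /andP[v1 v2] := vw.
have va : normc (v - a) < r by have := normc_triangle w v a; lra.
rewrite ltr_pdivlMr in v2; last by lra.
have : normc (G l v - G l w - G l.+1 w * (v - w) - 0) <= 4 * M l.+2 * normc (v - w) ^+ 2.
  apply: (@normc_lim (fun n => g n l v - g n l w - g n l.+1 w * (v - w))) => [|n].
    apply: cvgB; first by apply: cvgB; exact: gG.
    by apply: cvgMl; exact: gG.
  by rewrite subr0; exact: T2.
rewrite subr0 => /le_trans; apply.
rewrite expr2 mulrA ler_wpM2r ?ge0_normc//; have := ge0_normc (v - w); lra.
Qed.

Lemma derive1n_local (G : nat -> C R -> C R) (f : C R -> C R) (U : set (C R)) :
  open U -> (forall w, U w -> G 0%N w = f w) ->
  (forall l w, U w -> is_derive w 1 (G l) (G l.+1 w)) ->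
  forall l w, U w -> derive1n l f w = G l w /\ derivable (derive1n l f) w 1.
Proof.
move=> oU G0 dG.
have step l (h : forall w, U w -> derive1n l f w = G l w) w : U w ->
    is_derive w 1 (derive1n l f) (G l.+1 w).
  move=> Uw; apply/deriveCP => e e0; have [r r0 hr] := (deriveCP _ _ _).1 (dG l w Uw) e e0.
  have [d d0 hd] := openCP oU Uw.
  exists (Num.min r d); first by rewrite lt_min r0.
  move=> v; rewrite lt_min => /andP[vr vd].
  by rewrite !h//; [exact: hr|exact: hd].
have E l : forall w, U w -> derive1n l f w = G l w.
  elim: l => [|l IH] w Uw; first by rewrite G0.
  by rewrite derive1nS derive1E; have [_ ->] := step l IH w Uw.
by move=> l w Uw; split; [exact: E|have [] := step l (E l) w Uw].
Qed.

End Basics.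

(** * Cauchy's theorem by Riemann sums over roots of unity *)

Section Cauchy.
Variable R : realType.
Implicit Types z w : C R.

Lemma sqrt_half_plane z : exists2 w, w ^+ 2 = z & 0 <= complex.Re w.
Proof.
have [u hu] := @solve_monicpoly (C R) 2 (fun i => if i == 0%N then z else 0) isT.
have {}hu : u ^+ 2 = z by rewrite hu !big_ord_recl big_ord0 /= expr0 mulr1 mul0r !addr0.
have [h|h] := leP 0 (complex.Re u); first by exists u.
exists (- u); first by rewrite sqrrN.
by case: u h {hu} => a b /=; rewrite oppr_ge0 => /ltW.
Qed.

(* Consecutive square roots of -1 in the right half-plane; pairing j with
   j + n turns the sum for 2 n into the one for n at x^2. *)
Lemma roots_of_unity_dyadic k : exists2 w : C R, w ^+ (2 ^ k) = -1 &
  [/\ normc w = 1, normc (w - 1) ^+ 2 * (2 ^ k)%:R <= 4 &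
    forall x, x ^+ (2 ^ k.+1) != 1 ->
      \sum_(j < 2 ^ k.+1) (1 - x * w ^+ j)^-1 = (2 ^ k.+1)%:R / (1 - x ^+ (2 ^ k.+1))].
Proof.
elim: k => [|k [w wk [w1 wn ws]]].
  exists (-1); first by rewrite expr1.
  split; [by rewrite normc_opp normc1| |].
    have -> : (-1 - 1 : C R) = - 2%:R by ring.
    by rewrite normc_opp normc_nat mulr1 -natrX.
  move=> x; rewrite !expn1 !big_ord_recl big_ord0 /= expr0 expr1 mulr1 addr0 mulrN1 opprK.
  move=> x1; have : (1 - x) * (1 + x) != 0.
    by rewrite -subr_sqr expr1n subr_eq0 eq_sym.
  rewrite mulf_eq0 negb_or => /andP[h1 h2].
  have -> : 1 - x ^+ 2 = (1 - x) * (1 + x) by ring.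
  by field; rewrite h1 h2.
have [u uw Reu] := sqrt_half_plane w.
have uk : u ^+ (2 ^ k.+1) = -1 by rewrite expnS exprM uw.
have u1 : normc u = 1.
  have : normc u ^+ 2 = 1 by rewrite -normc_exp uw.
  by move/eqP; rewrite sqrf_eq1 => /orP[/eqP//|/eqP h]; have := ge0_normc u; lra.
exists u => //; split=> //.
  have : normc (w - 1) ^+ 2 = normc (u - 1) ^+ 2 * normc (u + 1) ^+ 2.
    by rewrite -exprMn -normc_mul -subr_sqr expr1n uw.
  (* |u + 1|^2 = 2 + 2 Re u for |u| = 1, hence the root in the right half-plane: passing from [w] to
     [u] at least halves the squared distance to 1 while the order doubles. *)
  have : 2 <= normc (u + 1) ^+ 2.
    case: u u1 Reu {uw uk} => a b /=.
    rewrite sqr_sqrtr ?addr_ge0 ?sqr_ge0// => h a0.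
    have : a ^+ 2 + b ^+ 2 = 1.
      by rewrite -[LHS]sqr_sqrtr ?addr_ge0 ?sqr_ge0// h expr1n.
    by rewrite addr0; nra.
  rewrite expnS natrM; move: wn; set n := (2 ^ k)%:R; have n0 : 0 <= n :> R by exact: ler0n.
  move: (normc (u - 1) ^+ 2) (sqr_ge0 (normc (u - 1))) (normc (u + 1) ^+ 2) => A A0 B h1 B2 h2.
  rewrite h2 in h1; have : A * n * 2 <= A * n * B by rewrite ler_wpM2l// mulr_ge0.
  by lra.
move=> x x1; rewrite expnS mul2n -addnn big_split_ord /=.
rewrite -big_split /=; set n := (2 ^ k.+1)%N.
have xn : x ^+ (n + n) = (x ^+ 2) ^+ n by rewrite -exprM mul2n addnn.
have hj (j : 'I_n) : (1 - x * u ^+ j)^-1 + (1 - x * u ^+ (n + j))^-1 =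
    2 * (1 - x ^+ 2 * w ^+ j)^-1.
  have e1 : x ^+ 2 * w ^+ j = (x * u ^+ j) ^+ 2.
    by rewrite [RHS]exprMn -uw exprAC.
  have : (x ^+ 2 * w ^+ j) ^+ n != 1.
    have wn1 : w ^+ n = 1 by rewrite /n expnSr exprM wk sqrrN expr1n.
    by rewrite exprMn (exprAC w) wn1 expr1n mulr1 -exprM /n -expnS.
  rewrite e1 exprD uk mulN1r mulrN opprK; move: (x * u ^+ j) => y yn.
  have : (1 - y) * (1 + y) != 0.
    rewrite -subr_sqr expr1n subr_eq0 eq_sym; apply: contraNneq yn => ->.
    by rewrite expr1n.
  rewrite mulf_eq0 negb_or => /andP[h1 h2].
  have -> : 1 - y ^+ 2 = (1 - y) * (1 + y) by ring.
  by field; rewrite h1 h2.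
rewrite (eq_bigr _ (fun j _ => hj j)) -mulr_sumr ws.
  by rewrite xn addnn -mul2n natrM mulrA.
by rewrite -exprM mulnC -expnSr.
Qed.

Lemma roots_of_unity (N : nat) (e : R) : 0 < e -> exists n (w : C R),
  [/\ (N <= n)%N, normc w = 1, w ^+ n = 1, w != 1 & normc (w - 1) < e /\
    forall x, x ^+ n != 1 -> \sum_(j < n) (1 - x * w ^+ j)^-1 = n%:R / (1 - x ^+ n)].
Proof.
move=> e0; pose k := maxn N (Num.truncn (4 / e ^+ 2)).+1.
have [w wk [w1 wn ws]] := roots_of_unity_dyadic k.
have k2 : (k < 2 ^ k)%N by exact: ltn_expl.
exists (2 ^ k.+1)%N, w; split => //.
- rewrite (leq_trans (leq_maxl N (Num.truncn (4 / e ^+ 2)).+1))// -/k ltnW//.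
  by apply: ltn_trans (ltnSn k) _; exact: ltn_expl.
- by rewrite expnSr exprM wk sqrrN expr1n.
- apply: contra_eq_neq wk => ->.
  by rewrite expr1n -subr_eq0 opprK -(natrD _ 1 1) pnatr_eq0.
split=> //.
have h : 4 < e ^+ 2 * (2 ^ k)%:R.
  rewrite mulrC -ltr_pdivrMr ?exprn_gt0//.
  have /le_lt_trans : 4 / e ^+ 2 <= k%:R; last by apply; rewrite ltr_nat.
  apply: ltW; apply: lt_le_trans (truncnS_gt _) _.
  by rewrite ler_nat leq_maxr.
have n0 : 0 < (2 ^ k)%:R :> R by rewrite ltr0n expn_gt0.
have : normc (w - 1) ^+ 2 < e ^+ 2.
  by rewrite -(ltr_pM2r n0); exact: le_lt_trans wn h.
by rewrite ltr_pXn2r// ?nnegrE ?ge0_normc// ltW.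
Qed.

End Cauchy.

Section Cauchy.
Variable R : realType.
Implicit Types z w : C R.

Lemma is_derive_invC (f : C R -> C R) z (d : C R) : is_derive z 1 f d -> f z != 0 ->
  is_derive z 1 (fun w => (f w)^-1) (- (d / f z ^+ 2)).
Proof.
move=> [df fd] fz; apply: DeriveDef; first exact: derivableV.
by rewrite deriveV// fd [_ *: _]mulNr mulrC.
Qed.

Lemma is_derive_mulC (f g : C R -> C R) z (df dg : C R) :
  is_derive z 1 f df -> is_derive z 1 g dg ->
  is_derive z 1 (fun w => f w * g w) (df * g z + f z * dg).
Proof.
move=> h1 h2; apply: is_derive_eq (is_deriveM h1 h2) _.
by rewrite addrC mulrC.
Qed.

Lemma is_derive_kernel (c x : C R) l z : x != z ->
  is_derive z 1 (fun w => c / (x - w) ^+ l.+1) (c * l.+1%:R / (x - z) ^+ l.+2).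
Proof.
move=> xz; have xz0 : x - z != 0 by rewrite subr_eq0.
have d1 : is_derive z 1 (fun w => x - w) (- 1).
  by have := is_deriveB (is_derive_cst x z 1) (is_derive_id z (1 : C R)); rewrite sub0r.
have d2 : is_derive z 1 (fun w => (x - w) ^+ l.+1) (- (l.+1%:R * (x - z) ^+ l)).
  have := is_deriveX l.+1 d1; rewrite [_ *: _]mulrN1 => h.
  apply: is_derive_eq.
    rewrite (_ : (fun w => (x - w) ^+ l.+1) = ((fun w => x - w) ^+ l.+1)); first exact: h.
    by apply/funext => w; rewrite fctE.
  by rewrite mulr_natl.
have d3 := is_derive_invC d2 _.
have := is_derive_mulC (is_derive_cst c z 1) (d3 _); rewrite expf_neq0// => /(_ isT) h.
apply: is_derive_eq h _; rewrite /cst !exprS.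
have t0 : (x - z) ^+ l != 0 by rewrite expf_neq0.
move: ((x - z) ^+ l) t0 xz0 => t t0; move: (x - z) => y y0.
by field; rewrite t0 y0.
Qed.

Lemma is_derive_sumC (n : nat) (f : 'I_n -> C R -> C R) (d : 'I_n -> C R) z :
  (forall i, is_derive z 1 (f i) (d i)) ->
  is_derive z 1 (fun w => \sum_(i < n) f i w) (\sum_(i < n) d i).
Proof.
move=> h; have := @is_derive_sum _ _ _ n f z 1 d h.
by rewrite (_ : \sum_(i < n) f i = (fun w => \sum_(i < n) f i w))//;
  apply/funext => w; rewrite fct_sumE.
Qed.

Lemma is_derive_affine (f : C R -> C R) (d b c : C R) z :
  is_derive (b + z * c) 1 f d -> is_derive z 1 (fun s => f (b + s * c)) (d * c).
Proof.
have [->|c0] := eqVneq c 0.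
  move=> _; rewrite mulr0 (_ : (fun s => _) = cst (f b)); first exact: is_derive_cst.
  by apply/funext => s; rewrite mulr0 addr0.
have n0 : 0 < normc c by rewrite normc_gt0.
move=> /deriveCP h; apply/deriveCP => e e0.
have [r r0 hr] := h _ (divr_gt0 e0 n0).
exists (r / normc c); first exact: divr_gt0.
move=> s; rewrite ltr_pdivlMr// -normc_mul => hs; have := hr (b + s * c).
have -> : b + s * c - (b + z * c) = (s - z) * c by ring.
move=> /(_ hs); rewrite normc_mul.
have -> : e / normc c * (normc (s - z) * normc c) = e * normc (s - z).
  by field; rewrite gt_eqF.
by congr (normc _ <= _); ring.
Qed.

Lemma sum_shift_cyclic (n : nat) (g : nat -> C R) : g n = g 0%N ->
  \sum_(j < n) (g j.+1 - g j) = 0.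
Proof.
move=> gn; rewrite -(big_mkord xpredT (fun j => g j.+1 - g j)) telescope_sumr//.
by rewrite gn subrr.
Qed.

(* Homotopy of the contour to the point w: the s-derivative of the Riemann sum
   at w + s (a + gamma_j - w) telescopes around the circle up to the modulus of
   continuity of f'. *)
Lemma cauchy_riemann_sum (f f' : C R -> C R) (a : C R) (r r1 : R) : 0 < r -> r < r1 ->
  (forall v, normc (v - a) < r1 -> is_derive v 1 f (f' v)) ->
  (forall v, normc (v - a) <= r -> f' w @[w --> v] --> f' v) ->
  forall e, 0 < e -> exists n (u : C R), [/\ normc u = 1, (0 < n)%N & 
    forall w, normc (w - a) <= r / 2 ->
    normc (\sum_(j < n) f (a + rc r * u ^+ j) * (rc r * u ^+ j) /
             (rc r * u ^+ j - (w - a)) / n%:R - f w) <= e * (1 + normc (f w))].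
Proof.
move=> r0 rr1 df cf e e0.
have e1 : 0 < e / (4 * r) by rewrite divr_gt0// mulr_gt0.
have [d d0 hd] := compact_unif_continuous (@compact_disc R a r) cf e1.
have [N hN] : exists N, forall n, (N <= n)%N -> (2^-1) ^+ n <= Num.min (e / 2) 2^-1 :> R.
  have h : (2^-1 : R) ^+ n @[n --> \oo] --> 0.
    by apply: cvg_expr; rewrite ger0_norm; lra.
  have m0 : 0 < Num.min (e / 2) 2^-1 :> R by rewrite lt_min; apply/andP; split; lra.
  have /cvgrPdistC_lt/(_ _ m0)[N _ hN] := h; exists N => n /hN.
  by rewrite subr0 ger0_norm ?exprn_ge0 ?invr_ge0// => /ltW.
have [n [v [Nn v1 vn v1' [vd vs]]]] := roots_of_unity N.+1 (divr_gt0 d0 r0).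
have v0 : v != 0 by rewrite -normc_gt0 v1.
(* With x = (w - a) / r, the kernel gamma / (gamma - (w - a)) at gamma = r u^j is 1 / (1 - x v^j),
   the summand of the closed formula for the powers of [v]. *)
pose u := v^-1.
have u1 : normc u = 1 by rewrite /u -[v^-1]mul1r normc_div v1 normc1 divr1.
have un : u ^+ n = 1 by rewrite exprVn vn invr1.
have uB1 : u - 1 = (1 - v) / v by rewrite /u; field.
have u1' : u != 1 by rewrite -subr_eq0 uB1 mulf_neq0 ?invr_eq0// subr_eq0 eq_sym.
have ud : normc (u - 1) < d / r by rewrite uB1 normc_div v1 divr1 normc_sub.
have n0 : (0 < n)%N by apply: leq_trans Nn.
have n0R : n%:R != 0 :> C R by rewrite pnatr_eq0 -lt0n.
exists n, u; split => // w wa.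
pose gam j : C R := rc r * u ^+ j.
have gn j : normc (gam j) = r.
  by rewrite normc_mul normc_exp u1 expr1n mulr1 normc_rc gtr0_norm.
have gamw j : gam j - (w - a) != 0.
  rewrite -normc_gt0; have := normc_lb (gam j) (w - a); rewrite gn; lra.
pose p j s : C R := w + s * (a + gam j - w).
pose G s := \sum_(j < n) f (p j s) * (gam j / (gam j - (w - a)) / n%:R).
have pin j (t : R) : 0 <= t <= 1 -> normc (p j (rc t) - a) <= r.
  move=> /andP[t0 t1].
  have -> : p j (rc t) - a = rc (1 - t) * (w - a) + rc t * gam j.
    by rewrite /p rcB rc1; ring.
  apply: le_trans (normc_le_add _ _) _.
  rewrite normc_mul (normc_mul (rc t)) gn !normc_rc !ger0_norm ?subr_ge0//.
  by nra.
have -> : \sum_(j < n) f (a + rc r * u ^+ j) * (rc r * u ^+ j) /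
             (rc r * u ^+ j - (w - a)) / n%:R = G 1.
  apply: eq_bigr => j _; have -> : p j 1 = a + gam j by rewrite /p; ring.
  by rewrite !mulrA.
(* At s = 0 all nodes lie at w and the sum is exactly f(w) / (1 - x^n); |x| <= 1/2 makes the error
   geometric. *)
have G0 : normc (G 0 - f w) <= e * normc (f w).
  pose x := (w - a) / rc r.
  have rr0 : rc r != 0 by rewrite -normc_gt0 normc_rc gtr0_norm.
  have nx : normc x <= 2^-1.
    by rewrite normc_div normc_rc gtr0_norm// ler_pdivrMr//; lra.
  have nxn : normc (x ^+ n) <= Num.min (e / 2) 2^-1.
    apply: le_trans (hN n (ltnW Nn)); rewrite normc_exp lerXn2r// nnegrE ?ge0_normc ?invr_ge0//.
  have nx1 : 2^-1 <= normc (1 - x ^+ n).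
    have := normc_lb 1 (x ^+ n); rewrite normc1; move: nxn; rewrite le_min => /andP[_]. 
    by lra.
  have xn1 : x ^+ n != 1.
    by rewrite eq_sym -subr_eq0 -normc_gt0; apply: lt_le_trans nx1; rewrite invr_gt0.
  have -> : G 0 = f w / (1 - x ^+ n).
    rewrite /G; under eq_bigr do rewrite /p mul0r addr0.
    rewrite -mulr_sumr -mulr_suml; congr (_ * _).
    have -> : \sum_(j < n) gam j / (gam j - (w - a)) = \sum_(j < n) (1 - x * v ^+ j)^-1.
      apply: eq_bigr => j _.
      have vj : v ^+ j != 0 by rewrite expf_neq0.
      have gj : gam j != 0 by rewrite -normc_gt0 gn.
      have -> : gam j - (w - a) = gam j * (1 - x * v ^+ j).
        by rewrite /gam /x /u exprVn; field; rewrite rr0 vj.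
      by rewrite invfM mulrA divff// mul1r.
    by rewrite vs// mulrAC divff// mul1r.
  have -> : f w / (1 - x ^+ n) - f w = f w * (x ^+ n / (1 - x ^+ n)).
    by field; rewrite subr_eq0 eq_sym.
  rewrite normc_mul mulrC ler_wpM2r ?ge0_normc// normc_div ler_pdivrMr; last by lra.
  apply: (@le_trans _ _ (e / 2)); first by move: nxn; rewrite le_min => /andP[].
  by nra.
have nu1 : 0 < normc (u - 1) by rewrite normc_gt0 subr_eq0.
(* The chain rule produces the factor a + gamma - w, which cancels the kernel. After multiplication
   by t (u - 1) the rest is the sum of the increments of f between consecutive nodes, up to the
   errors [E j]. *)
have G1 : normc (G 1 - G 0) <= 2 * (e / 2).
  apply: (@mean_value01 R G (fun s => \sum_(j < n) f' (p j s) * gam j / n%:R)) => t t01.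
    have dterm (j : 'I_n) : is_derive (rc t) 1
       (fun s => f (p j s) * (gam j / (gam j - (w - a)) / n%:R)) (f' (p j (rc t)) * gam j / n%:R).
      have h1 : is_derive (rc t) 1 (fun s => f (p j s)) (f' (p j (rc t)) * (a + gam j - w)).
        by apply: is_derive_affine; apply: df; apply: le_lt_trans rr1; exact: pin.
      have h := is_derive_mulC h1 (is_derive_cst (gam j / (gam j - (w - a)) / n%:R) (rc t) 1).
      apply: is_derive_eq h _.
      by rewrite /cst mulr0 addr0; field; rewrite n0R gamw.
    exact: is_derive_sumC.
  have {}t01' : 0 <= t <= 1 by case/andP: t01 => *; rewrite !ltW.
  have t0 : 0 < t by case/andP: t01.
  have pd j : p j.+1 (rc t) - p j (rc t) = rc t * (u - 1) * gam j.
    by rewrite /p /gam exprS; ring.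
  pose E j := f (p j.+1 (rc t)) - f (p j (rc t)) - f' (p j (rc t)) * (p j.+1 (rc t) - p j (rc t)).
  have nE j : normc (E j) <= 2 * (e / (4 * r) * (t * normc (u - 1) * r)).
    pose g v := f v - f' (p j (rc t)) * v.
    have -> : E j = g (p j.+1 (rc t)) - g (p j (rc t)) by rewrite /E /g; ring.
    have npd : normc (p j.+1 (rc t) - p j (rc t)) = t * normc (u - 1) * r.
      by rewrite pd normc_mul gn normc_mul normc_rc gtr0_norm.
    rewrite -npd.
    apply: (@mean_value R g (fun v => f' v - f' (p j (rc t))) a r1).
    - move=> v2 va; apply: is_deriveB; first exact: df.
      by have := is_deriveZ (f' (p j (rc t))) (is_derive_id v2 (1 : C R)); rewrite [_ *: _]mulr1.
    - exact: le_lt_trans (pin _ _ t01') rr1.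
    - exact: le_lt_trans (pin _ _ t01') rr1.
    - move=> v2 vp va; apply: ltW; apply: hd; first exact: pin.
      apply: le_lt_trans vp _; rewrite npd; move: ud; rewrite ltr_pdivlMr// => ud.
      have : t * (normc (u - 1) * r) <= 1 * (normc (u - 1) * r).
        by rewrite ler_wpM2r ?mulr_ge0 ?ge0_normc ?ltW//; case/andP: t01.
      by rewrite mulrA; lra.
  have S0 : rc t * (u - 1) * (\sum_(j < n) f' (p j (rc t)) * gam j / n%:R) =
      - (\sum_(j < n) E j) / n%:R.
    have h : \sum_(j < n) (f (p j.+1 (rc t)) - f (p j (rc t))) = 0.
      by apply: (@sum_shift_cyclic n (fun j => f (p j (rc t)))); rewrite /p /gam un expr0.
    transitivity ((\sum_(j < n) (f (p j.+1 (rc t)) - f (p j (rc t))) - \sum_(j < n) E j) / n%:R).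
      rewrite -sumrB mulr_sumr mulr_suml; apply: eq_bigr => j _.
      by rewrite /E pd; ring.
    by rewrite h sub0r.
  have nS : normc (\sum_(j < n) E j) <= n%:R * (2 * (e / (4 * r) * (t * normc (u - 1) * r))).
    apply: le_trans (normc_sum _ _ _) _.
    rewrite mulr_natl -[X in _ *+ X]card_ord -sumr_const.
    by apply: ler_sum => j _; exact: nE.
  have tu : 0 < t * normc (u - 1) by rewrite mulr_gt0.
  rewrite -(ler_pM2l tu); have nn : 0 < n%:R :> R by rewrite ltr0n.
  have := congr1 (@normc R) S0; rewrite !normc_mul normc_opp normc_rc gtr0_norm// => ->.
  have -> : normc ((n%:R : C R)^-1) = n%:R^-1 by rewrite -[_^-1]mul1r normc_div normc_nat normc1 mul1r.
  rewrite ler_pdivrMr//; apply: le_trans nS _.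
  rewrite le_eqVlt; apply/orP; left; apply/eqP; field; rewrite gt_eqF//.
have := normc_triangle (G 0) (G 1) (f w); lra.
Qed.

(** The Riemann sums of Cauchy's formula are finite sums of kernels c / (x - w), so all their
    derivatives are explicit and bounded uniformly in the number of nodes; [smooth_limit] passes to
    the limit. For w in the half disc the nodes stay at distance at least r / 2, whence the powers
    of r / 2. *)
Lemma cauchy_disc (f f' : C R -> C R) (a : C R) (r r1 S : R) : 0 < r -> r < r1 ->
  (forall v, normc (v - a) < r1 -> is_derive v 1 f (f' v)) ->
  (forall v, normc (v - a) <= r -> f' w @[w --> v] --> f' v) ->
  (forall v, normc (v - a) <= r -> normc (f v) <= S) ->
  exists G : nat -> C R -> C R,
    [/\ forall w, normc (w - a) < r / 2 -> G 0%N w = f w,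
        forall l w, normc (w - a) < r / 2 -> is_derive w 1 (G l) (G l.+1 w)
      & forall l w, normc (w - a) < r / 2 ->
          normc (G l w) <= S * r * l`!%:R / (r / 2) ^+ l.+1].
Proof.
move=> r0 rr1 df cf fS.
have S0 : 0 <= S by apply: le_trans (fS a _); rewrite ?ge0_normc// subrr normc0 ltW.
have r20 : 0 < r / 2 by lra.
have H m : exists n (u : C R), [/\ normc u = 1, (0 < n)%N &
    forall w, normc (w - a) <= r / 2 ->
    normc (\sum_(j < n) f (a + rc r * u ^+ j) * (rc r * u ^+ j) /
             (rc r * u ^+ j - (w - a)) / n%:R - f w) <= m.+1%:R^-1 * (1 + normc (f w))].
  by apply: cauchy_riemann_sum rr1 df cf _ _ => //; rewrite invr_gt0.
have [n /choice[u nu]] := choice H.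
pose gam m j : C R := rc r * u m ^+ j.
have gn m j : normc (gam m j) = r.
  have [u1 _ _] := nu m.
  by rewrite normc_mul normc_exp u1 expr1n mulr1 normc_rc gtr0_norm.
pose c m j := f (a + gam m j) * gam m j / (n m)%:R.
pose g m l w := \sum_(j < n m) c m j * l`!%:R / (a + gam m j - w) ^+ l.+1.
have gamw m j w : normc (w - a) < r / 2 -> r / 2 <= normc (a + gam m j - w).
  move=> wa; have := normc_lb (gam m j) (w - a); rewrite gn.
  have -> : gam m j - (w - a) = a + gam m j - w by ring.
  by lra.
have dg m l w : normc (w - a) < r / 2 -> is_derive w 1 (g m l) (g m l.+1 w).
  move=> wa; apply: is_derive_sumC => j.
  apply: is_derive_eq.
    by apply: is_derive_kernel; rewrite -subr_eq0 -normc_gt0; apply: lt_le_trans (gamw _ _ _ wa).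
  by rewrite factS natrM; congr (_ / _); ring.
have gS m l w : normc (w - a) < r / 2 -> normc (g m l w) <= S * r * l`!%:R / (r / 2) ^+ l.+1.
  move=> wa; apply: le_trans (normc_sum _ _ _) _.
  have [_ n0 _] := nu m.
  have -> : S * r * l`!%:R / (r / 2) ^+ l.+1 =
     \sum_(j < n m) S * r / (n m)%:R * l`!%:R / (r / 2) ^+ l.+1.
    rewrite sumr_const card_ord -mulr_natl.
    by field; rewrite ?pnatr_eq0 -?lt0n n0 ?expf_neq0// gt_eqF.
  apply: ler_sum => j _; rewrite normc_div normc_mul normc_nat normc_exp.
  apply: ler_pM; rewrite ?mulr_ge0 ?invr_ge0 ?exprn_ge0 ?ge0_normc//.
    rewrite ler_wpM2r// /c normc_div normc_mul normc_nat gn.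
    rewrite ler_wpM2r ?invr_ge0// (ler_wpM2r (ltW r0))//; apply: fS.
    by rewrite addrC addKr gn.
  rewrite lef_pV2 ?posrE ?exprn_gt0//; last first.
    exact: lt_le_trans r20 (gamw _ _ _ wa).
  by rewrite lerXn2r ?nnegrE ?ge0_normc ?gamw// ltW.
have g0 w : normc (w - a) < r / 2 -> g m 0%N w @[m --> \oo] --> f w.
  move=> wa; apply/cvgCP_seq => e e0.
  pose B := 1 + normc (f w); have B0 : 0 < B by rewrite /B; have := ge0_normc (f w); lra.
  exists (Num.truncn (B / e)) => m Nm.
  have [_ n0 h] := nu m.
  have -> : g m 0%N w = \sum_(j < n m) f (a + rc r * u m ^+ j) * (rc r * u m ^+ j) /
             (rc r * u m ^+ j - (w - a)) / (n m)%:R.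
    apply: eq_bigr => j _; rewrite /c /gam fact0 mulr1 expr1.
    have -> : rc r * u m ^+ j - (w - a) = a + rc r * u m ^+ j - w by ring.
    by rewrite mulrAC.
  apply: le_lt_trans (h w (ltW wa)) _; rewrite -/B mulrC ltr_pdivrMr// mulrC -ltr_pdivrMr//.
  apply: lt_le_trans (truncnS_gt _) _; rewrite ler_nat ltnS//.
have [G [G0 dG cG]] := smooth_limit dg gS g0.
exists G; split => // l w wa; rewrite -[G l w]subr0; apply: normc_lim (cG l w wa) _ => m.
by rewrite subr0; exact: gS.
Qed.

End Cauchy.

(** * Topology of A^oo *)

Section Holomorphic.
Variable R : realType.
Implicit Types (z w : C R) (U : set (C R)) (f g : C R -> C R).

Definition smooth_on U f : Prop :=
  forall l z, U z -> derivable (derive1n l f) z 1.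

Lemma smooth_is_derive U f l z : smooth_on U f -> U z ->
  is_derive z 1 (derive1n l f) (derive1n l.+1 f z).
Proof. by move=> sf Uz; apply: DeriveDef; [exact: sf|rewrite derive1nS derive1E]. Qed.

Lemma is_derive_continuous f (d : C R) z : is_derive z 1 f d -> f w @[w --> z] --> f z.
Proof. by case=> /derivable1_diffP/differentiable_continuous. Qed.

Lemma smooth_continuous U f l z : smooth_on U f -> U z ->
  derive1n l f w @[w --> z] --> derive1n l f z.
Proof. by move=> sf Uz; apply: is_derive_continuous (smooth_is_derive l sf Uz). Qed.

Lemma smoothB U f g : open U -> smooth_on U f -> smooth_on U g ->
  smooth_on U (f \- g) /\
  forall l z, U z -> derive1n l (f \- g) z = derive1n l f z - derive1n l g z.
Proof.
move=> oU sf sg.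
have H := @derive1n_local R (fun l z => derive1n l f z - derive1n l g z) (f \- g) U oU.
have {}H l z : U z -> derive1n l (f \- g) z = derive1n l f z - derive1n l g z /\
    derivable (derive1n l (f \- g)) z 1.
  move=> Uz; apply: (H _ _ l z Uz) => [//|k w Uw].
  by apply: is_deriveB; exact: smooth_is_derive sf _ || exact: smooth_is_derive sg _.
by split=> l z Uz; have [] := H l z Uz.
Qed.

Lemma smooth_eq U f g : open U -> smooth_on U g -> (forall z, U z -> f z = g z) ->
  smooth_on U f /\ forall l z, U z -> derive1n l f z = derive1n l g z.
Proof.
move=> oU sg fg; have H := @derive1n_local R (fun l z => derive1n l g z) f U oU.
have {}H l z : U z -> derive1n l f z = derive1n l g z /\ derivable (derive1n l f) z 1.
  move=> Uz; apply: (H _ _ l z Uz) => [w Uw|k w Uw]; first by rewrite fg.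
  exact: smooth_is_derive sg _.
by split=> l z Uz; have [] := H l z Uz.
Qed.

Lemma continuous_disc_bound f (a : C R) (r : R) :
  (forall v, normc (v - a) <= r -> f w @[w --> v] --> f v) ->
  exists S, forall v, normc (v - a) <= r -> normc (f v) <= S.
Proof.
move=> cf.
have /compact_near_coveringP cK := @compact_disc R a r.
pose P (n : nat) v := normc (f v) <= n%:R.
have [N _ /(_ N (leqnn N)) hN] : \forall n \near \oo, [set w : C R | normc (w - a) <= r] `<=` P n.
  apply: cK => v va; have /cvgCP/(_ _ ltr01)/nbhsCP[d d0 hd] := cf v va.
  exists ([set w : C R | normc (w - v) < d], [set n | (Num.truncn (normc (f v) + 1) < n)%N]).
    by split; [apply/nbhsCP; exists d|exists (Num.truncn (normc (f v) + 1)).+1].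
  move=> [w n] /= [/hd fw nn]; rewrite /P.
  have := normc_triangle (f v) (f w) 0; rewrite !subr0 => h.
  have : normc (f v) + 1 <= n%:R.
    by apply: ltW; apply: lt_le_trans (truncnS_gt _) _; rewrite ler_nat.
  lra.
by exists N%:R.
Qed.

(** The derivative is assumed continuous; for members of [Ainf] this is what the extension of the
    first derivative provides. *)
Lemma goursat U f : open U -> (forall z, U z -> derivable f z 1) ->
  (forall z, U z -> derive1n 1 f w @[w --> z] --> derive1n 1 f z) -> smooth_on U f.
Proof.
move=> oU df cf l z Uz.
have [r r0 hr] := openCP oU Uz.
have dfb v : normc (v - z) < r -> is_derive v 1 f (derive1n 1 f v).
  by move=> /hr Uv; apply: DeriveDef; [exact: df|rewrite derive1n1 derive1E].
have rr : r / 2 < r by lra.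
have r20 : 0 < r / 2 by lra.
have cfb v : normc (v - z) <= r / 2 -> derive1n 1 f w @[w --> v] --> derive1n 1 f v.
  by move=> vz; apply: cf; apply: hr; exact: le_lt_trans rr.
have [S hS] : exists S, forall v, normc (v - z) <= r / 2 -> normc (f v) <= S.
  apply: continuous_disc_bound => v vz; apply: (is_derive_continuous (dfb v _)).
  exact: le_lt_trans rr.
have [G [G0 dG _]] := cauchy_disc r20 rr dfb cfb hS.
have [|_ //] := @derive1n_local R G f [set w : C R | normc (w - z) < r / 2 / 2] (@open_ballC R _ _) G0 dG l z.
by rewrite /= subrr normc0; lra.
Qed.

(** [cauchy_disc] is applied with radius r / 2, so that f is differentiable on a larger disc, and it
    halves the radius once more: this is the origin of 4 / r. *)
Lemma cauchy_estimate U f (a : C R) (r S : R) l : open U -> smooth_on U f -> 0 < r ->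
  (forall v, normc (v - a) <= r -> U v) ->
  (forall v, normc (v - a) <= r -> normc (f v) <= S) ->
  normc (derive1n l f a) <= S * l`!%:R * (4 / r) ^+ l.+1 * r.
Proof.
move=> oU sf r0 rU fS.
have r20 : 0 < r / 2 by lra.
have rr : r / 2 < r by lra.
have [G [G0 dG GS]] := cauchy_disc (f := f) (f' := derive1n 1 f) (a := a) (S := S) r20 rr
  (fun v va => smooth_is_derive 0 sf (rU v (ltW va)))
  (fun v va => @smooth_continuous U f 1 v sf (rU v (le_trans va (ltW rr))))
  (fun v va => fS v (le_trans va (ltW rr))).
have a0 : normc (a - a) < r / 2 / 2 by rewrite subrr normc0; lra.
have [-> _] := @derive1n_local R G f [set w : C R | normc (w - a) < r / 2 / 2] (@open_ballC R _ _) G0 dG l a a0.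
apply: le_trans (GS l a a0) _.
have S0 : 0 <= S by apply: le_trans (fS a _); rewrite ?ge0_normc// subrr normc0 ltW.
have -> : 4 / r = (r / 2 / 2)^-1 by field; rewrite gt_eqF.
rewrite exprVn.
have h : 0 <= S * l`!%:R / (r / 2 / 2) ^+ l.+1 * r.
  by rewrite !mulr_ge0 ?invr_ge0 ?exprn_ge0//; lra.
apply: le_trans (_ : S * l`!%:R / (r / 2 / 2) ^+ l.+1 * r / 2 <= _); last by lra.
by rewrite le_eqVlt; apply/orP; left; apply/eqP; ring.
Qed.

End Holomorphic.

Section Extensions.
Variables (R : realType) (Omega : set (C R)).
Hypothesis oO : open Omega.
Implicit Types (z w : C R) (f g G : C R -> C R).

Lemma withinP G : {within closure Omega, continuous G} <->
  forall z, closure Omega z -> forall e : R, 0 < e -> exists2 d : R, 0 < d &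
    forall w, closure Omega w -> normc (w - z) < d -> normc (G w - G z) < e.
Proof.
rewrite continuous_subspace_in; split => h z.
- move=> cz e e0; have := h z; rewrite inE => /(_ cz).
  move=> /cvgCP/(_ e e0); rewrite /nbhs /= -nbhs_subspace_in// => /nbhsCP[d d0 hd].
  by exists d => // w cw wz; exact: hd.
- rewrite inE => cz; apply/cvgCP => e e0; have [d d0 hd] := h z cz e e0.
  rewrite /nbhs /= -nbhs_subspace_in//; apply/nbhsCP; exists d => // w wz cw.
  exact: hd.
Qed.

Lemma ext_unique g G1 G2 : is_extension Omega g G1 -> is_extension Omega g G2 ->
  forall z, closure Omega z -> G1 z = G2 z.
Proof.
move=> [/withinP c1 e1] [/withinP c2 e2] z cz; apply/eqP; rewrite -subr_eq0 -normc_eq0.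
rewrite eq_le ge0_normc andbT; apply/ler_addgt0Pr => e e0; rewrite add0r.
have e20 : 0 < e / 2 by lra.
have [d1 d10 h1] := c1 z cz _ e20; have [d2 d20 h2] := c2 z cz _ e20.
have [|w Ow wz] := (closureCP _ _).1 cz (Num.min d1 d2); first by rewrite lt_min d10.
move: wz; rewrite lt_min => /andP[w1 w2].
have cw := subset_closure Ow.
have := h1 w cw w1; have := h2 w cw w2; rewrite e1// e2// => a1 a2.
have := normc_triangle (g w) (G1 z) (G2 z); rewrite (normc_sub (G1 z) (g w)); lra.
Qed.

Lemma extD_ext f l G : is_extension Omega (derive1n l f) G ->
  is_extension Omega (derive1n l f) (extD Omega f l).
Proof. by move=> h; apply: (@xgetPex _ (fun=> 0) (is_extension Omega (derive1n l f))); exists G. Qed.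

Lemma extD_eq f l G : is_extension Omega (derive1n l f) G ->
  forall z, closure Omega z -> extD Omega f l z = G z.
Proof. by move=> h; apply: (ext_unique (extD_ext h) h). Qed.

Lemma extD_spec (f : Ainf Omega) l : is_extension Omega (derive1n l f) (extD Omega f l).
Proof. by have [G] := Afun_extends f l; exact: extD_ext. Qed.

Lemma extD_in (f : Ainf Omega) l z : Omega z -> extD Omega f l z = derive1n l f z.
Proof. by have [_] := extD_spec f l; exact. Qed.

Lemma extD_within (f : Ainf Omega) l z (e : R) : closure Omega z -> 0 < e ->
  exists2 d : R, 0 < d & forall w, closure Omega w -> normc (w - z) < d ->
    normc (extD Omega f l w - extD Omega f l z) < e.
Proof. by move=> cz; have [/withinP h _] := extD_spec f l; exact: h. Qed.

Lemma within_smooth (f : Ainf Omega) : smooth_on Omega f.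
Proof.
apply: goursat => // z Oz; first exact: Afun_holomorphic.
apply/cvg_atP => e e0; have [d d0 hd] := extD_within f 1 (subset_closure Oz) e0.
have [r r0 hr] := openCP oO Oz; exists (Num.min d r).
  by rewrite lt_min d0.
move=> w; rewrite lt_min => /andP[wd wr]; rewrite -!extD_in//; last exact: hr.
by apply: hd => //; apply: subset_closure; exact: hr.
Qed.

Lemma within_sub G1 G2 : {within closure Omega, continuous G1} ->
  {within closure Omega, continuous G2} -> {within closure Omega, continuous (G1 \- G2)}.
Proof.
move=> /withinP c1 /withinP c2; apply/withinP => z cz e e0; have e20 : 0 < e / 2 by lra.
have [d1 d10 h1] := c1 z cz _ e20; have [d2 d20 h2] := c2 z cz _ e20.
exists (Num.min d1 d2) => [|w cw]; rewrite lt_min ?d10// => /andP[w1 w2].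
have := h1 w cw w1; have := h2 w cw w2.
have -> : (G1 \- G2) w - (G1 \- G2) z = (G1 w - G1 z) + - (G2 w - G2 z) :> C R by rewrite /=; ring.
have := normc_le_add (G1 w - G1 z) (- (G2 w - G2 z)); rewrite normc_opp; lra.
Qed.

Lemma extD_sub (f g : Ainf Omega) l z : closure Omega z ->
  extD Omega (f \- g) l z = extD Omega f l z - extD Omega g l z.
Proof.
apply: (extD_eq (G := extD Omega f l \- extD Omega g l)); split.
  by apply: within_sub; [have [] := extD_spec f l|have [] := extD_spec g l].
move=> w Ow /=; have [_ ->] := smoothB oO (@within_smooth f) (@within_smooth g) => //.
by rewrite !extD_in.
Qed.

Lemma extD_smooth W f phi l : open W -> closure Omega `<=` W -> smooth_on W phi ->
  (forall z, Omega z -> f z = phi z) ->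
  is_extension Omega (derive1n l f) (derive1n l phi).
Proof.
move=> oW OW sp fp; split.
  apply/withinP => z cz e e0.
  have /cvgCP/(_ e e0)/nbhsCP[d d0 hd] := @smooth_continuous R W phi l z sp (OW z cz).
  by exists d => // w _; exact: hd.
move=> z Oz; have sO : smooth_on Omega phi.
  by move=> k w Ow; apply: sp; apply: OW; exact: subset_closure.
by have [_ ->] := smooth_eq oO sO fp.
Qed.

Lemma seminorm_lt l n f (e : R) : (Aseminorm Omega l n f < e%:E)%E ->
  forall z, closure Omega z -> normc z <= n%:R -> normc (extD Omega f l z) < e.
Proof.
move=> h z cz zn; rewrite -lte_fin; apply: le_lt_trans h.
by apply: ereal_sup_ubound; right; exists z.
Qed.

Lemma lt_seminorm l n f (d e : R) : 0 <= d -> d < e ->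
  (forall z, closure Omega z -> normc z <= n%:R -> normc (extD Omega f l z) <= d) ->
  (Aseminorm Omega l n f < e%:E)%E.
Proof.
move=> d0 de h; apply: (@le_lt_trans _ _ d%:E); last by rewrite lte_fin.
apply: ge_ereal_sup => x [->|[z [cz zn] <-]]; rewrite lee_fin//.
exact: h.
Qed.

(** The inequality is weak, so that it survives the limit in the completeness argument; orders and
    radii share the index [m]. *)
Definition within_ball (m : nat) (e : R) (f g : C R -> C R) : Prop :=
  forall l z, (l <= m)%N -> closure Omega z -> normc z <= m%:R ->
    normc (extD Omega g l z - extD Omega f l z) <= e.

Lemma Aopen_ball (U : set (Ainf Omega)) (f : Ainf Omega) : open U -> U f ->
  exists m : nat, exists2 e : R, 0 < e & forall g : Ainf Omega, within_ball m e f g -> U g.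
Proof.
move=> oU Uf; have [m [e e0 h]] : exists m : nat, exists2 e : R, 0 < e & forall g : Ainf Omega,
    (forall l n : nat, (l <= m)%N -> (n <= m)%N ->
       (Aseminorm Omega l n (g \- f)%R < e%:E)%E) -> U g by exact: oU.
exists m, (e / 2) => [|g gf]; first by lra.
apply: h => l n lm nm; apply: (@lt_seminorm _ _ _ (e / 2)); [lra|lra|].
move=> z cz zn; rewrite extD_sub//; apply: gf => //.
by apply: le_trans zn _; rewrite ler_nat.
Qed.

Lemma ball_Aopen (U : set (Ainf Omega)) :
  (forall f : Ainf Omega, U f -> exists m : nat, exists2 e : R, 0 < e &
    forall g : Ainf Omega, within_ball m e f g -> U g) -> open U.
Proof.
move=> h; suff : Aopen U by [].
move=> f /h[m [e e0 hU]]; exists m, e => // g gf; apply: hU => l z lm cz zm.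
by rewrite -extD_sub//; apply: ltW; apply: (seminorm_lt (gf l m lm (leqnn m))).
Qed.

End Extensions.

(** * Separating K from closure Omega by a rational function *)

Section Rational.
Variable R : realType.
Implicit Types (S : set (C R)) (u v : C R -> C R).

Definition rational_on S u : Prop := exists U V : {poly C R},
  forall z, S z -> V.[z] != 0 /\ u z = U.[z] / V.[z].

Lemma rational_on_cst S (c : C R) : rational_on S (fun=> c).
Proof. by exists c%:P, 1 => z _; rewrite !hornerE oner_eq0 divr1. Qed.

Lemma rational_on_add S u v : rational_on S u -> rational_on S v ->
  rational_on S (fun z => u z + v z).
Proof.
move=> [U [V h]] [U' [V' h']]; exists (U * V' + U' * V), (V * V') => z Sz.
have [V0 ->] := h z Sz; have [V0' ->] := h' z Sz; rewrite !hornerE; split.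
  by rewrite mulf_neq0.
by field; rewrite V0 V0'.
Qed.

Lemma rational_on_mul S u v : rational_on S u -> rational_on S v ->
  rational_on S (fun z => u z * v z).
Proof.
move=> [U [V h]] [U' [V' h']]; exists (U * U'), (V * V') => z Sz.
have [V0 ->] := h z Sz; have [V0' ->] := h' z Sz; rewrite !hornerM; split.
  by rewrite mulf_neq0.
by rewrite mulf_div.
Qed.

Lemma rational_on_exp S u n : rational_on S u -> rational_on S (fun z => u z ^+ n).
Proof.
by move=> ru; elim: n => [|n IH];
  [exact: rational_on_cst | under eq_fun do rewrite exprS; exact: rational_on_mul].
Qed.

Lemma rational_on_sum S (I : Type) (s : seq I) (u : I -> C R -> C R) :
  (forall i, rational_on S (u i)) -> rational_on S (fun z => \sum_(i <- s) u i z).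
Proof.
move=> h; elim: s => [|i s IH].
  by under eq_fun do rewrite big_nil; exact: rational_on_cst.
by under eq_fun do rewrite big_cons; exact: rational_on_add.
Qed.

(** A pole with coefficient 0 may lie in [S]; this is how the poles cancelled between neighbouring
    cells are discarded. *)
Lemma rational_on_pole S (a x : C R) : (a != 0 -> ~ S x) ->
  rational_on S (fun z => a / (x - z)).
Proof.
have [-> _|a0 /(_ isT) Sx] := eqVneq a 0.
  by under eq_fun do rewrite mul0r; exact: rational_on_cst.
exists a%:P, (x%:P - 'X) => z Sz; rewrite !hornerE; split=> //.
by rewrite subr_eq0; apply: contra_not_neq Sx => ->.
Qed.

End Rational.

Section Separation.
Variable R : realType.
Implicit Types z w : C R.

Variable i : C R.
Hypothesis i2 : i * i = -1.

Let normc_i : normc i = 1.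
Proof.
have : normc i ^+ 2 = 1 by rewrite expr2 -normc_mul i2 normc_opp normc1.
by move/eqP; rewrite sqrf_eq1 => /orP[/eqP//|/eqP h]; have := ge0_normc i; lra.
Qed.

(* The midpoint rule for the contour integral of 1/(x - z) around a square
   of side 2 t centred at z - v. *)
Definition cell (t v : C R) : C R :=
  (t - v)^-1 - (- t - v)^-1 + i * ((i * t - v)^-1 - (- (i * t) - v)^-1).

(** The quarter-turn symmetry of the four points leaves only a fourth power of [v], hence decay of
    order 4. This outweighs the number of cells, which grows only as the square of the
    refinement. *)
Lemma cellE t v : t != v -> t != - v -> i * t != v -> i * t != - v ->
  cell t v = 4 * t ^+ 3 / (t ^+ 4 - v ^+ 4).
Proof.
move=> h1 h2 h3 h4.
have inv2 x : x != v -> x != - v ->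
    (x - v)^-1 - (- x - v)^-1 = 2 * x / (x ^+ 2 - v ^+ 2).
  rewrite -[_ == v]subr_eq0 -[_ == - v]subr_eq0 opprK => a1 a2.
  have a3 : - x - v != 0 by rewrite -opprD oppr_eq0.
  have a4 : x ^+ 2 - v ^+ 2 != 0 by rewrite subr_sqr mulf_neq0.
  by field; rewrite a1 a3 a4.
have e2 : (i * t) ^+ 2 = - t ^+ 2 by rewrite exprMn expr2 i2 mulN1r.
rewrite /cell (inv2 _ h1 h2) (inv2 _ h3 h4) e2.
move: h1 h2 h3 h4; rewrite -![_ == v]subr_eq0 -![_ == - v]subr_eq0 !opprK => h1 h2 h3 h4.
have b1 : t ^+ 2 - v ^+ 2 != 0 by rewrite subr_sqr mulf_neq0.
have b2 : t ^+ 2 + v ^+ 2 != 0.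
  have -> : t ^+ 2 + v ^+ 2 = - ((i * t - v) * (i * t + v)) by rewrite -subr_sqr e2; ring.
  by rewrite oppr_eq0 mulf_neq0.
have -> : i * (2 * (i * t) / (- t ^+ 2 - v ^+ 2)) = 2 * t / (t ^+ 2 + v ^+ 2).
  rewrite -opprD invrN mulrN mulrN !mulrA -[i * 2 * i]mulrA [2 * i]mulrC mulrA i2.
  by rewrite !mulN1r !mulNr opprK.
have -> : t ^+ 4 - v ^+ 4 = (t ^+ 2 - v ^+ 2) * (t ^+ 2 + v ^+ 2) by ring.
by field; rewrite b1 b2.
Qed.

Lemma abel_sum (L : nat) (X F : nat -> C R) : X 0%N = 0 -> X L = 0 ->
  \sum_(a < L) X a * (F a.+1 - F a) = \sum_(a < L) (X a - X a.+1) * F a.+1.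
Proof.
move=> X0 XL; apply/eqP; rewrite -subr_eq0 -sumrB.
rewrite (eq_bigr (fun a : 'I_L => X a.+1 * F a.+1 - X a * F a)); last by move=> a _; ring.
rewrite -(big_mkord xpredT (fun a => X a.+1 * F a.+1 - X a * F a)).
by rewrite (telescope_sumr (fun a => X a * F a))// X0 XL !mul0r subrr.
Qed.

Lemma normc_sum_le n (F : 'I_n -> C R) (B : R) : (forall j, normc (F j) <= B) ->
  normc (\sum_(j < n) F j) <= n%:R * B.
Proof.
move=> h; apply: le_trans (normc_sum _ _ _) _.
by rewrite mulr_natl -[X in _ *+ X]card_ord -sumr_const ler_sum.
Qed.

Lemma normc_cell (t : R) v : 0 < t -> 2 * t <= normc v ->
  normc (rc t * cell (rc t) v) <= 8 * t ^+ 4 / normc v ^+ 4.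
Proof.
move=> t0 tv.
have ne (x : C R) : normc x = t -> x != v.
  by move=> xt; apply/eqP => xv; move: tv; rewrite -xv xt; lra.
have nt : normc (rc t) = t by rewrite normc_rc gtr0_norm.
have nit : normc (i * rc t) = t by rewrite normc_mul normc_i mul1r.
have v4 : 2 * t ^+ 4 <= normc v ^+ 4.
  apply: (@le_trans _ _ ((2 * t) ^+ 4)); last by rewrite lerXn2r// ?nnegrE ?ge0_normc//; lra.
  rewrite exprMn; have := exprn_gt0 4 t0; lra.
rewrite cellE; [|exact: ne| |exact: ne|]; last 2 first.
- by rewrite eq_sym eqr_oppLR eq_sym; apply: ne; rewrite normc_opp.
- by rewrite eq_sym eqr_oppLR eq_sym; apply: ne; rewrite normc_opp.
rewrite !(normc_div, normc_mul, normc_exp) nt normc_nat.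
have t4 : 0 < t ^+ 4 by rewrite exprn_gt0.
have d : normc v ^+ 4 / 2 <= normc (rc t ^+ 4 - v ^+ 4).
  have := normc_lb (v ^+ 4) (rc t ^+ 4); rewrite normc_sub !normc_exp nt; lra.
rewrite mulrA ler_pdivrMr; last by apply: lt_le_trans d; lra.
have nv : 0 < normc v ^+ 4 by lra.
apply: (@le_trans _ _ (8 * t ^+ 4 / normc v ^+ 4 * (normc v ^+ 4 / 2))).
  rewrite le_eqVlt; apply/orP; left; apply/eqP; field.
  by rewrite gt_eqF//; lra.
by apply: ler_wpM2l d; rewrite divr_ge0//; lra.
Qed.

End Separation.

Lemma rc_sum (R : realType) (I : Type) (s : seq I) (F : I -> R) :
  rc (\sum_(j <- s) F j) = \sum_(j <- s) rc (F j).
Proof. by elim: s => [|j s IH]; rewrite ?big_nil// !big_cons rcD IH. Qed.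

(** * A fine grid of square cells around [K] *)

Section Lattice.
Variables (R : realType) (K M : set (C R)) (R0 rho : R).
Hypothesis rho0 : 0 < rho.
Hypothesis KR0 : forall z, K z -> normc z <= R0.
Hypothesis KM : forall z w, M z -> K w -> 2 * rho <= normc (z - w).
Hypothesis R00 : 0 <= R0.
Variables (N k : nat).
Hypothesis N0 : (0 < N)%N.
Hypothesis kN : 8 * (R0 + 2 * rho) / rho <= k%:R.

Let i : C R := Complex 0 1.
Let i2 : i * i = -1. Proof. by rewrite -expr2; exact: (@sqr_i R). Qed.
Let nr : 0 < N%:R :> R. Proof. by rewrite ltr0n. Qed.
Let nr1 : 1 <= N%:R :> R. Proof. by rewrite ler1n. Qed.
(** Half the side of a cell. With [k] fixed and [N] growing, [L = N * k] cells per side always cover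
    the square of half-side [R1], and a block of 2N + 1 by 2N + 1 cells stays within distance [rho]
    of its centre. *)
Let t : R := rho / (8 * N%:R).
Let t0 : 0 < t. Proof. by rewrite divr_gt0// mulr_gt0. Qed.
Let tN : 8 * N%:R * t = rho. Proof. by rewrite /t; field; rewrite gt_eqF. Qed.
Let t8 : 8 * t <= rho. Proof. by rewrite -tN (ler_wpM2r (ltW t0))//; have := nr1; lra. Qed.
Let L := (N * k)%N.
Let R1 := R0 + 2 * rho.
Let tL : R1 <= t * L%:R.
Proof.
have := kN; rewrite ler_pdivrMr// -/R1 => h.
have -> : t * L%:R = k%:R * rho / 8 by rewrite natrM -tN; field.
by lra.
Qed.

(** Centre of cell (a, b) and, below, midpoints of its left and lower edges; the edge midpoints are
    the poles of the terms. *)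
Let cen (a b : nat) : C R := Complex (t * (2 * a%:R + 1) - R1) (t * (2 * b%:R + 1) - R1).
Let vert (a b : nat) : C R := Complex (2 * t * a%:R - R1) (t * (2 * b%:R + 1) - R1).
Let horiz (a b : nat) : C R := Complex (t * (2 * a%:R + 1) - R1) (2 * t * b%:R - R1).

Let ComplexB (x y x' y' : R) : Complex x y - Complex x' y' = Complex (x - x') (y - y') :> C R.
Proof. by []. Qed.

Let term (a b : nat) z : C R := rc t * cell i (rc t) (z - cen a b).

Let termE a b z : term a b z = rc t * (((vert a.+1 b - z)^-1 - (vert a b - z)^-1) +
   i * ((horiz a b.+1 - z)^-1 - (horiz a b - z)^-1)).
Proof.
have e1 : vert a.+1 b = cen a b + rc t.
  by rewrite /vert /cen /rc; simpc; congr Complex; rewrite -natr1; ring.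
have e2 : vert a b = cen a b - rc t.
  by rewrite /vert /cen /rc; simpc; congr Complex; ring.
have e3 : horiz a b.+1 = cen a b + i * rc t.
  by rewrite /horiz /cen /rc; simpc; congr Complex; rewrite -natr1; ring.
have e4 : horiz a b = cen a b - i * rc t.
  by rewrite /horiz /cen /rc; simpc; congr Complex; ring.
rewrite /term /cell e1 e2 e3 e4; congr (_ * ((_ ^-1 - _ ^-1) + _ * (_ ^-1 - _^-1))); ring.
Qed.

Let near_K a b := `[< exists2 w, K w & normc (cen a b - w) < rho >].
Let chi a b : C R := if near_K a b then 1 else 0.

Let Re_le (x y : R) : `|x| <= normc (Complex x y : C R).
Proof. exact: (Re_le_normc (Complex x y)). Qed.
Let Im_le (x y : R) : `|y| <= normc (Complex x y : C R).
Proof. exact: (Im_le_normc (Complex x y)). Qed.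

Let KRe w : K w -> - R0 <= complex.Re w <= R0.
Proof. by move=> /KR0 h; rewrite -ler_norml; exact: le_trans (Re_le_normc _) h. Qed.
Let KIm w : K w -> - R0 <= complex.Im w <= R0.
Proof. by move=> /KR0 h; rewrite -ler_norml; exact: le_trans (Im_le_normc _) h. Qed.

(** The margin 2 rho in [R1] keeps [K] away from the border cells, so Abel summation leaves no
    boundary terms. *)
Let chi0 a b : [|| a == 0%N, b == 0%N, (L <= a)%N | (L <= b)%N] -> chi a b = 0.
Proof.
move=> h; rewrite /chi; case: ifPn => // /asboolP[w Kw].
rewrite ltNge => /negP[]; have := KRe Kw; have := KIm Kw.
case: w Kw => x y Kw; rewrite -[complex.Re _]/x -[complex.Im _]/y ComplexB => hy hx.
have := tL; have := t0; have := t8; have := rho0; rewrite /R1 => r0 h8 h0 hL.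
have big (c : nat) (s : R) : (c == 0%N) || (L <= c)%N -> - R0 <= s <= R0 ->
    rho <= `|t * (2 * c%:R + 1) - (R0 + 2 * rho) - s|.
  move=> /orP[/eqP ->|Lc] /andP[s1 s2].
    by rewrite mulr0 add0r mulr1 ler_normr; apply/orP; right; lra.
  have : t * L%:R <= t * c%:R by rewrite ler_wpM2l ?ler_nat// ltW.
  by rewrite ler_normr => ?; apply/orP; left; lra.
case/or4P: h => h; [apply: le_trans (Re_le _ _)|apply: le_trans (Im_le _ _)|
  apply: le_trans (Re_le _ _)|apply: le_trans (Im_le _ _)];
  by apply: big => //; rewrite h ?orbT.
Qed.

Let u z : C R := \sum_(a < L) \sum_(b < L) chi a b * term a b z.

(** Summation by parts: the pole at an edge midpoint gets as coefficient the difference of [chi] on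
    the two adjacent cells. *)
Let uE z : u z = rc t * ((\sum_(b < L) \sum_(a < L) (chi a b - chi a.+1 b) / (vert a.+1 b - z)) +
   i * \sum_(a < L) \sum_(b < L) (chi a b - chi a b.+1) / (horiz a b.+1 - z)).
Proof.
have Ev (b : 'I_L) : \sum_(a < L) chi a b * ((vert a.+1 b - z)^-1 - (vert a b - z)^-1) =
    \sum_(a < L) (chi a b - chi a.+1 b) / (vert a.+1 b - z).
  by apply: (@abel_sum R L (fun a => chi a b) (fun a => (vert a b - z)^-1));
    apply: chi0; rewrite ?leqnn ?orbT.
have Eh (a : 'I_L) : \sum_(b < L) chi a b * ((horiz a b.+1 - z)^-1 - (horiz a b - z)^-1) =
    \sum_(b < L) (chi a b - chi a b.+1) / (horiz a b.+1 - z).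
  by apply: (@abel_sum R L (fun b => chi a b) (fun b => (horiz a b - z)^-1));
    apply: chi0; rewrite ?leqnn ?orbT.
under [X in _ = _ * (X + _)]eq_bigr do rewrite -Ev.
under [X in _ = _ * (_ + _ * X)]eq_bigr do rewrite -Eh.
rewrite [X in _ * (X + _)]exchange_big /= [X in _ + X]mulr_sumr -big_split mulr_sumr.
apply: eq_bigr => a _; rewrite mulr_sumr -big_split mulr_sumr; apply: eq_bigr => b _ /=.
by rewrite termE; ring.
Qed.

(** A midpoint [w] with nonzero coefficient is within [t] of a centre closer than rho to [K], and of
    one that is not. The first excludes [w] from [M], whose points are at least 2 rho from [K]; the
    second excludes [w] from [K]. *)
Let closeK a b a' b' w : K w \/ M w -> chi a b != chi a' b' ->
  normc (cen a b - w) <= t -> normc (cen a' b' - w) <= t -> False.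
Proof.
have key c d c' d' : K w \/ M w -> near_K c d -> ~~ near_K c' d' ->
    normc (cen c d - w) <= t -> normc (cen c' d' - w) <= t -> False.
  move=> KMw /asboolP[x Kx cx] /asboolPn h cw cw'.
  case: KMw => [Kw|Mw].
    by apply: h; exists w => //; apply: le_lt_trans cw' _; have := t8; have := t0; lra.
  have := KM Mw Kx; have := normc_triangle (cen c d) w x; rewrite (normc_sub w (cen c d)).
  by have := t8; have := t0; have := rho0; lra.
move=> KMw; rewrite /chi; case: ifPn; case: ifPn => //; rewrite ?eqxx// => h1 h2 _.
  exact: key.
by move=> a1 a2; apply: key KMw h1 h2 a2 a1.
Qed.

Let u_rational : rational_on (fun w => K w \/ M w) u.
Proof.
have rat (x : C R) a b a' b' : normc (cen a b - x) <= t -> normc (cen a' b' - x) <= t ->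
    rational_on (fun w => K w \/ M w) (fun z => (chi a b - chi a' b') / (x - z)).
  move=> h1 h2; apply: rational_on_pole; rewrite subr_eq0 => /eqP/eqP ne KMx.
  exact: closeK KMx ne h1 h2.
rewrite (funext uE).
have nc (x y : R) : normc (Complex x y : C R) <= `|x| + `|y| := normReIm (Complex x y).
apply: rational_on_mul; first exact: rational_on_cst.
apply: rational_on_add; last apply: rational_on_mul; [|exact: rational_on_cst|].
- apply: rational_on_sum => b; apply: rational_on_sum => a; apply: rat.
  + rewrite /cen /vert ComplexB subrr; apply: le_trans (nc _ _) _.
    have -> : t * (2 * a%:R + 1) - R1 - (2 * t * a.+1%:R - R1) = - t by rewrite -natr1; ring.
    by rewrite normrN normr0 addr0 gtr0_norm.
  + rewrite /cen /vert ComplexB subrr; apply: le_trans (nc _ _) _.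
    have -> : t * (2 * a.+1%:R + 1) - R1 - (2 * t * a.+1%:R - R1) = t by rewrite -natr1; ring.
    by rewrite normr0 addr0 gtr0_norm.
- apply: rational_on_sum => a; apply: rational_on_sum => b; apply: rat.
  + rewrite /cen /horiz ComplexB subrr; apply: le_trans (nc _ _) _.
    have -> : t * (2 * b%:R + 1) - R1 - (2 * t * b.+1%:R - R1) = - t by rewrite -natr1; ring.
    by rewrite normrN normr0 add0r gtr0_norm.
  + rewrite /cen /horiz ComplexB subrr; apply: le_trans (nc _ _) _.
    have -> : t * (2 * b.+1%:R + 1) - R1 - (2 * t * b.+1%:R - R1) = t by rewrite -natr1; ring.
    by rewrite normr0 add0r gtr0_norm.
Qed.

Let P := N.*2.+1.
Let PE : P%:R = 2 * N%:R + 1 :> R.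
Proof. by rewrite /P -natr1 -muln2 natrM mulrC. Qed.

(** A block of (2N + 1)^2 cells telescopes to its rim, so it can be evaluated like one large
    cell. *)
Let box a b z := \sum_(j < P) \sum_(q < P) term (a + j) (b + q) z.

Let telescope (F : nat -> C R) n : \sum_(j < n) (F j.+1 - F j) = F n - F 0%N.
Proof. by rewrite -(big_mkord xpredT (fun j => F j.+1 - F j)) telescope_sumr. Qed.

Let boxE a b z : box a b z = rc t *
  ((\sum_(q < P) ((vert (a + P) (b + q) - z)^-1 - (vert a (b + q) - z)^-1)) +
   i * \sum_(j < P) ((horiz (a + j) (b + P) - z)^-1 - (horiz (a + j) b - z)^-1)).
Proof.
have Ev (q : 'I_P) : (vert (a + P) (b + q) - z)^-1 - (vert a (b + q) - z)^-1 =
    \sum_(j < P) ((vert (a + j).+1 (b + q) - z)^-1 - (vert (a + j) (b + q) - z)^-1).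
  have := telescope (fun j => (vert (a + j) (b + q) - z)^-1) P; rewrite addn0 => <-.
  by apply: eq_bigr => j _; rewrite addnS.
have Eh (j : 'I_P) : (horiz (a + j) (b + P) - z)^-1 - (horiz (a + j) b - z)^-1 =
    \sum_(q < P) ((horiz (a + j) (b + q).+1 - z)^-1 - (horiz (a + j) (b + q) - z)^-1).
  have := telescope (fun q => (horiz (a + j) (b + q) - z)^-1) P; rewrite addn0 => <-.
  by apply: eq_bigr => q _; rewrite addnS.
rewrite (eq_bigr _ (fun q _ => Ev q)) [X in i * X](eq_bigr _ (fun j _ => Eh j)).
rewrite exchange_big /= [X in _ + X]mulr_sumr -big_split mulr_sumr.
apply: eq_bigr => j _; rewrite mulr_sumr -big_split mulr_sumr; apply: eq_bigr => q _ /=.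
by rewrite termE.
Qed.

Let inv_diff (x z c : C R) : t * P%:R <= normc (x - c) -> normc (z - c) <= 2 * t ->
  normc ((x - z)^-1 - (x - c)^-1) <= 2 / (t * (2 * N%:R - 1) * P%:R).
Proof.
move=> xc zc; have := normc_triangle z x c => tri.
have n1 : 0 < 2 * N%:R - 1 :> R by have := nr1; lra.
have xz : t * (2 * N%:R - 1) <= normc (x - z) by move: xc; rewrite PE; lra.
have p1 : 0 < t * (2 * N%:R - 1) by rewrite mulr_gt0.
have p2 : 0 < t * P%:R by rewrite mulr_gt0// ltr0n.
have xz0 : 0 < normc (x - z) by apply: lt_le_trans xz.
have xc0 : 0 < normc (x - c) by apply: lt_le_trans xc.
have -> : (x - z)^-1 - (x - c)^-1 = (z - c) / ((x - z) * (x - c)).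
  by field; rewrite -!normc_gt0 xz0 xc0.
rewrite normc_div normc_mul ler_pdivrMr ?mulr_gt0//.
apply: le_trans zc _.
have -> : 2 * t = 2 / (t * (2 * N%:R - 1) * P%:R) * (t * (2 * N%:R - 1) * (t * P%:R)).
  by field; rewrite !gt_eqF// ltr0n.
apply: ler_wpM2l; first by rewrite divr_ge0// mulr_ge0 ?ler0n// ltW.
by apply: ler_pM => //; exact: ltW.
Qed.

Let c_of a b := cen (a + N) (b + N).

Let vR a b (q : 'I_P) : vert (a + P) (b + q) - c_of a b =
  Complex (t * P%:R) (2 * t * (q%:R - N%:R)).
Proof. by rewrite ComplexB; congr Complex; rewrite !natrD ?PE; ring. Qed.
Let vL a b (q : 'I_P) : vert a (b + q) - c_of a b =
  Complex (- (t * P%:R)) (2 * t * (q%:R - N%:R)).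
Proof. by rewrite ComplexB; congr Complex; rewrite !natrD ?PE; ring. Qed.
Let hT a b (j : 'I_P) : horiz (a + j) (b + P) - c_of a b =
  Complex (2 * t * (j%:R - N%:R)) (t * P%:R).
Proof. by rewrite ComplexB; congr Complex; rewrite !natrD ?PE; ring. Qed.
Let hB a b (j : 'I_P) : horiz (a + j) b - c_of a b =
  Complex (2 * t * (j%:R - N%:R)) (- (t * P%:R)).
Proof. by rewrite ComplexB; congr Complex; rewrite !natrD ?PE; ring. Qed.

Let tP0 : 0 < t * P%:R. Proof. by rewrite mulr_gt0// ltr0n. Qed.

(** The rim midpoints are at distance at least t (2N + 1) from the centre, so moving [z] by 2 t
    changes each of the 4 (2N + 1) reciprocals by O(1 / (t N^2)); the factor [t] leaves O(1 / N). *)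
Let box_center a b z : normc (z - c_of a b) <= 2 * t ->
  normc (box a b z - box a b (c_of a b)) <= 8 / N%:R.
Proof.
move=> zc; rewrite !boxE -mulrBr normc_mul normc_rc gtr0_norm//.
set B := 2 / (t * (2 * N%:R - 1) * P%:R).
have n1 : 0 < 2 * N%:R - 1 :> R by have := nr1; lra.
have nx (x : C R) : t * P%:R <= normc (x - c_of a b) ->
  normc ((x - z)^-1 - (x - c_of a b)^-1) <= B by move=> h; exact: inv_diff.
have hx : `|t * P%:R| = t * P%:R by rewrite gtr0_norm.
have d2 (x y : C R) : t * P%:R <= normc (x - c_of a b) -> t * P%:R <= normc (y - c_of a b) ->
    normc (((x - z)^-1 - (y - z)^-1) - ((x - c_of a b)^-1 - (y - c_of a b)^-1)) <= 2 * B.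
  move=> h1 h2; have -> : ((x - z)^-1 - (y - z)^-1) - ((x - c_of a b)^-1 - (y - c_of a b)^-1) =
    ((x - z)^-1 - (x - c_of a b)^-1) + - ((y - z)^-1 - (y - c_of a b)^-1) by ring.
  have := normc_le_add ((x - z)^-1 - (x - c_of a b)^-1) (- ((y - z)^-1 - (y - c_of a b)^-1)).
  by rewrite normc_opp; have := nx _ h1; have := nx _ h2; lra.
rewrite opprD addrACA -mulrBr -!sumrB.
apply: (@le_trans _ _ (t * (P%:R * (2 * B) + P%:R * (2 * B)))).
  apply: (ler_wpM2l (ltW t0)); apply: le_trans (normc_le_add _ _) _; apply: lerD.
    apply: normc_sum_le => q; apply: d2; rewrite ?vR ?vL.
      by apply: le_trans (Re_le _ _); rewrite hx.
    by apply: le_trans (Re_le _ _); rewrite normrN hx.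
  rewrite normc_mul (_ : normc i = 1) ?mul1r; last first.
    by rewrite /i /= expr0n expr1n add0r sqrtr1.
  apply: normc_sum_le => j; apply: d2; rewrite ?hT ?hB.
    by apply: le_trans (Im_le _ _); rewrite hx.
  by apply: le_trans (Im_le _ _); rewrite normrN hx.
have -> : t * (P%:R * (2 * B) + P%:R * (2 * B)) = 8 / (2 * N%:R - 1).
  by rewrite /B; field; rewrite !gt_eqF// ltr0n.
rewrite ler_pM2l// lef_pV2 ?posrE//; have := nr1; lra.
Qed.

(** A midpoint sum that tends to pi as [N] grows; [u] will be normalised by it, and only the lower
    bound 2 enters the estimates. *)
Let T : R := 4 * \sum_(q < P) P%:R / (P%:R ^+ 2 + (2 * (q%:R - N%:R)) ^+ 2).

Let T2 : 2 <= T.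
Proof.
have p0 : 0 < P%:R :> R by rewrite ltr0n.
have : \sum_(q < P) (2 * P%:R)^-1 <= \sum_(q < P) P%:R / (P%:R ^+ 2 + (2 * (q%:R - N%:R)) ^+ 2) :> R.
  apply: ler_sum => q _.
  have h : (2 * (q%:R - N%:R)) ^+ 2 <= P%:R ^+ 2 :> R.
    have q0 : 0 <= q%:R :> R by exact: ler0n.
    have q1 : q%:R <= 2 * N%:R :> R.
      by rewrite -natrM ler_nat mul2n -ltnS.
    rewrite -ler_sqrt ?sqr_ge0// !sqrtr_sqr (gtr0_norm p0) ler_norml PE.
    by apply/andP; split; lra.
  rewrite ler_pdivlMr; last by rewrite ltr_wpDr ?sqr_ge0 ?exprn_gt0.
  rewrite ler_pdivrMl ?mulr_gt0//; move: h; rewrite expr2; lra.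
have eP : P%:R * (2 * P%:R)^-1 = 2^-1 :> R by field; rewrite gt_eqF.
by rewrite sumr_const card_ord -[_ *+ P]mulr_natl eP /T; lra.
Qed.

(** Opposite edges mirror each other: imaginary parts cancel, and the vertical and horizontal sides
    give the same sum. *)
Let box_value a b : box a b (c_of a b) = rc T.
Proof.
have inv_re (x y : R) : x != 0 -> (Complex x y : C R)^-1 - (Complex (- x) y : C R)^-1 =
    rc (2 * x / (x ^+ 2 + y ^+ 2)).
  move=> x0; have d0 : x ^+ 2 + y ^+ 2 != 0.
    by rewrite gt_eqF// ltr_wpDr ?sqr_ge0// exprn_even_gt0//= x0.
  have A0 : (Complex x y : C R) != 0 by rewrite eq_complex /= negb_and x0.
  have B0 : (Complex (- x) y : C R) != 0 by rewrite eq_complex /= negb_and oppr_eq0 x0.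
  have AB : (Complex x y : C R) * Complex (- x) y = - rc (x ^+ 2 + y ^+ 2).
    by rewrite /rc; simpc; congr Complex; ring.
  have BA : (Complex (- x) y : C R) - Complex x y = - rc (2 * x).
    by rewrite /rc; simpc; congr Complex; ring.
  transitivity ((Complex (- x) y - Complex x y) / ((Complex x y : C R) * Complex (- x) y)).
    by field; rewrite A0 B0.
  rewrite AB BA invrN mulrNN (rcM (2 * x) _^-1); congr (_ * _).
  by rewrite /rc; exact: (esym (fmorphV (real_complex R) _)).
have inv_im (x y : R) : x != 0 ->
    i * ((Complex y x : C R)^-1 - (Complex y (- x) : C R)^-1) =
    rc (2 * x / (x ^+ 2 + y ^+ 2)).
  move=> x0; have A0 : i != 0 by rewrite eq_complex /= negb_and oner_eq0 orbT.
  have e1 : (Complex y x : C R) = i * Complex x (- y) by rewrite /i; simpc.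
  have e2 : (Complex y (- x) : C R) = i * Complex (- x) (- y) by rewrite /i; simpc.
  rewrite e1 e2 !invfM -mulrBr mulrA divff// mul1r inv_re// sqrrN//.
have tP : t * P%:R != 0 by rewrite gt_eqF.
have tr q : 2 * (t * P%:R) / ((t * P%:R) ^+ 2 + (2 * t * (q%:R - N%:R)) ^+ 2) =
    2 / t * (P%:R / (P%:R ^+ 2 + (2 * (q%:R - N%:R)) ^+ 2)) :> R.
  have p0 : P%:R != 0 :> R by rewrite pnatr_eq0.
  have d0 : P%:R ^+ 2 + (2 * (q%:R - N%:R)) ^+ 2 != 0 :> R.
    by rewrite gt_eqF// ltr_wpDr ?sqr_ge0// exprn_even_gt0//= p0.
  have -> : (t * P%:R) ^+ 2 + (2 * t * (q%:R - N%:R)) ^+ 2 =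
    t ^+ 2 * (P%:R ^+ 2 + (2 * (q%:R - N%:R)) ^+ 2) by ring.
  by field; rewrite d0 gt_eqF.
rewrite boxE.
under eq_bigr do rewrite vR vL inv_re// tr rcM.
rewrite mulr_sumr; under [X in _ + X]eq_bigr do rewrite hT hB inv_im// tr rcM.
rewrite -!mulr_sumr /T.
have -> : \sum_(q < P) rc (P%:R / (P%:R ^+ 2 + (2 * (q%:R - N%:R)) ^+ 2) : R) =
    rc (\sum_(q < P) (P%:R / (P%:R ^+ 2 + (2 * (q%:R - N%:R)) ^+ 2))).
  by rewrite rc_sum.
rewrite -mulrDl -!rcD -!rcM; congr rc; field; rewrite gt_eqF//.
Qed.

Let sum_shift (F : nat -> C R) a : (a + P <= L)%N ->
  \sum_(j < P) F (a + j)%N = \sum_(x < L) (if (a <= x < a + P)%N then F x else 0).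
Proof.
move=> aPL; rewrite -big_mkcond /= -(big_mkord (fun x => a <= x < a + P)%N F).
transitivity (\sum_(a <= x < a + P) F x).
  rewrite -(big_mkord xpredT (fun j => F (a + j)%N)) -{2}[a]add0n big_addn addKn.
  by apply: eq_bigr => j _; rewrite addnC.
by rewrite [LHS](big_nat_widenl _ 0%N)//= [LHS](big_nat_widen _ _ L)//.
Qed.

(** The index stays at least [N] cells inside the grid, since N cells span rho / 4, less than the
    margin 2 rho. *)
Let index (x : R) : - R0 <= x <= R0 -> exists2 a : nat,
  (N <= a)%N && (a + N < L)%N & `|x - (t * (2 * a%:R + 1) - R1)| <= t.
Proof.
move=> /andP[x1 x2]; have t20 : 0 < 2 * t by have := t0; lra.
pose s := (x + R1) / (2 * t).
have sx : s * (2 * t) = x + R1 by rewrite /s divfK// gt_eqF.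
have s0 : 0 <= s by rewrite divr_ge0 ?(ltW t20)// /R1; have := rho0; lra.
have /andP[a1 a2] := truncn_itv s0; rewrite -natr1 in a2.
set a := Num.truncn s in a1 a2 *; exists a.
  rewrite -!(ltr_nat R) -(ler_nat R) natrD; have := tL; rewrite /R1 in sx * => hL.
  have h1 : N%:R * (2 * t) < s * (2 * t).
    have -> : N%:R * (2 * t) = rho / 4 by rewrite -tN; field.
    by rewrite sx; have := rho0; lra.
  have h2 : (a%:R + N%:R) * (2 * t) < L%:R * (2 * t).
    rewrite mulrDl; have : a%:R * (2 * t) <= s * (2 * t) by rewrite ler_pM2r.
    have -> : N%:R * (2 * t) = rho / 4 by rewrite -tN; field.
    by rewrite sx; have := rho0; lra.
  rewrite ltr_pM2r// in h1; rewrite ltr_pM2r// in h2; rewrite h2 andbT.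
  by rewrite ler_nat -ltnS -(ltr_nat R) -natr1; lra.
have h1 : a%:R * (2 * t) <= s * (2 * t) by rewrite ler_pM2r.
have h2 : s * (2 * t) < (a%:R + 1) * (2 * t) by rewrite ltr_pM2r.
by rewrite ler_norml; apply/andP; split; lra.
Qed.

(** Inside the block around [z] all cells count, since their centres are within 6 N t < rho of [z].
    The at most (N k)^2 others are at distance at least 2 N t and contribute at most 1 / (2 N^4)
    each. *)
Let near_u z : K z -> normc (u z - rc T) <= (8 + k%:R ^+ 2) / N%:R.
Proof.
move=> Kz; have [a0 /andP[a01 a02] ha] := index (KRe Kz).
have [b0 /andP[b01 b02] hb] := index (KIm Kz).
pose a := (a0 - N)%N; pose b := (b0 - N)%N.
have aN : (a + N)%N = a0 by rewrite subnK.
have bN : (b + N)%N = b0 by rewrite subnK.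
have aP : (a + P <= L)%N by rewrite /P addnS -addnn addnA aN.
have bP : (b + P <= L)%N by rewrite /P addnS -addnn addnA bN.
have zc : normc (z - c_of a b) <= 2 * t.
  apply: le_trans (normReIm _) _; rewrite ReB ImB /c_of aN bN /=; lra.
have bc := box_center zc; rewrite box_value in bc.
have term_le x y : (2 * N)%:R * t <= normc (z - cen x y) ->
    normc (term x y z) <= (2 * N%:R ^+ 4)^-1.
  move=> h; have h2 : 2 * t <= normc (z - cen x y).
    by apply: le_trans h; rewrite (ler_wpM2r (ltW t0))// natrM; have := nr1; lra.
  apply: le_trans (normc_cell i2 t0 h2) _.
  have p1 : 0 < ((2 * N)%:R * t) ^+ 4.
    by rewrite exprn_gt0// mulr_gt0// ltr0n muln_gt0.
  apply: (@le_trans _ _ (8 * t ^+ 4 / ((2 * N)%:R * t) ^+ 4)).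
    apply: ler_wpM2l; first by rewrite mulr_ge0// exprn_ge0// ltW.
    rewrite lef_pV2 ?posrE//; first by rewrite lerXn2r ?nnegrE// ?ge0_normc// mulr_ge0// ltW.
    by apply: lt_le_trans p1 _; rewrite lerXn2r ?nnegrE// ?ge0_normc// mulr_ge0// ltW.
  rewrite le_eqVlt; apply/orP; left; apply/eqP; rewrite natrM; field.
  by rewrite !gt_eqF.
have far (x0 x : nat) (s : R) : (x0 + N < x)%N || (x + N < x0)%N ->
    `|s - (t * (2 * x0%:R + 1) - R1)| <= t ->
    (2 * N)%:R * t <= `|s - (t * (2 * x%:R + 1) - R1)|.
  rewrite ler_norml natrM => h /andP[h1 h2]; have tt := t0.
  case/orP: h; rewrite -(ler_nat R) -natr1 natrD => /(ler_wpM2l (ltW t0)) h.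
    by rewrite ler_normr; apply/orP; right; lra.
  by rewrite ler_normr; apply/orP; left; lra.
have ubox : normc (u z - box a b z) <= k%:R ^+ 2 / N%:R.
  have -> : box a b z = \sum_(x < L) \sum_(y < L)
      (if (a <= x < a + P)%N && (b <= y < b + P)%N then 1 else 0) * term x y z.
    rewrite /box (@sum_shift (fun x => \sum_(q < P) term x (b + q) z))//.
    apply: eq_bigr => x _; case: ifPn => _; last by rewrite big1// => y _; rewrite mul0r.
    rewrite (@sum_shift (fun y => term x y z))//; apply: eq_bigr => y _.
    by case: ifPn => _; rewrite ?mul1r ?mul0r.
  have tle (x y : 'I_L) : normc (chi x y * term x y z -
     (if (a <= x < a + P)%N && (b <= y < b + P)%N then 1 else 0) * term x y z) <= (2 * N%:R ^+ 4)^-1.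
    have p0 : 0 <= (2 * N%:R ^+ 4)^-1 :> R by rewrite invr_ge0 mulr_ge0// exprn_ge0.
    have aPN : (a + P)%N = (a0 + N).+1 by rewrite /P addnS -addnn addnA aN.
    have bPN : (b + P)%N = (b0 + N).+1 by rewrite /P addnS -addnn addnA bN.
    case: ifPn => [/andP[/andP[x1 x2] /andP[y1 y2]]|out].
      suff -> : chi x y = 1 by rewrite mul1r subrr normc0.
      rewrite /chi ifT//; apply/asboolP; exists z => //.
      rewrite normc_sub; apply: le_lt_trans (normReIm _) _; rewrite ReB ImB /=.
      have nd (x0 x' : nat) (s : R) : (x' <= x0 + N)%N -> (x0 <= x' + N)%N ->
          `|s - (t * (2 * x0%:R + 1) - R1)| <= t ->
          `|s - (t * (2 * x'%:R + 1) - R1)| <= 3 * N%:R * t.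
        rewrite -!(ler_nat R) !natrD => /(ler_wpM2l (ltW t0)) g1 /(ler_wpM2l (ltW t0)) g2.
        have : t * 1 <= t * N%:R by rewrite ler_pM2l.
        rewrite !ler_norml => g3 /andP[h1 h2]; apply/andP; split; lra.
      have := nd a0 x _ _ _ ha; have := nd b0 y _ _ _ hb.
      have x1' : (a0 <= x + N)%N by rewrite -aN leq_add2r.
      have y1' : (b0 <= y + N)%N by rewrite -bN leq_add2r.
      rewrite aPN ltnS in x2; rewrite bPN ltnS in y2.
      move=> /(_ y2 y1') hy /(_ x2 x1') hx; have := tN; have := t0.
      have : 0 < t * N%:R by rewrite mulr_gt0.
      by lra.
    have {}out : (2 * N)%:R * t <= normc (z - cen x y).
      have [hx|hx] := boolP ((a <= x) && (x < a + P))%N.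
        rewrite hx /= negb_and -!ltnNge bPN ltnS in out.
        apply: le_trans (Im_le_normc _); rewrite ImB /=; apply: far hb.
        by case/orP: out => h; [rewrite -bN ltn_add2r h orbT|rewrite h].
      rewrite negb_and -!ltnNge aPN ltnS in hx.
      apply: le_trans (Re_le_normc _); rewrite ReB /=; apply: far ha.
      by case/orP: hx => h; [rewrite -aN ltn_add2r h orbT|rewrite h].
    rewrite mul0r subr0 /chi; case: ifPn => _; last by rewrite mul0r normc0.
    by rewrite mul1r; exact: term_le.
  rewrite /u -sumrB; under eq_bigr do rewrite -sumrB.
  apply: le_trans (normc_sum_le (fun x => normc_sum_le (fun y => tle x y))) _.
  rewrite /L natrM.
  have -> : N%:R * k%:R * (N%:R * k%:R * (2 * N%:R ^+ 4)^-1) = k%:R ^+ 2 / (2 * N%:R ^+ 2) :> R.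
    by field; rewrite gt_eqF.
  apply: ler_wpM2l; first exact: sqr_ge0.
  rewrite lef_pV2 ?posrE ?mulr_gt0 ?exprn_gt0//.
  have : N%:R * 1 <= N%:R * N%:R :> R by rewrite ler_pM2l.
  by rewrite expr2; have := nr; lra.
have -> : u z - rc T = (u z - box a b z) + (box a b z - rc T) by ring.
apply: le_trans (normc_le_add _ _) _; rewrite mulrDl addrC; exact: lerD.
Qed.

(** Chosen so that a point [z] of [M] is at distance at least kap (1 + |z|) from every centre near
    [K]; the decay in 1 + |z| starts here. *)
Let kap := rho / (1 + R0 + 2 * rho).

Let far_u z : M z -> normc (u z) * (1 + normc z) <= k%:R ^+ 2 * (rho / kap) ^+ 4 / N%:R.
Proof.
move=> Mz; have r0 := rho0; have R00' := R00.
have d0 : 0 < 1 + R0 + 2 * rho by lra.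
have kap0 : 0 < kap by rewrite divr_gt0.
have z1 : 1 <= 1 + normc z by have := ge0_normc z; lra.
have z0 : 0 < kap * (1 + normc z) by rewrite mulr_gt0//; lra.
pose B := 8 * t ^+ 4 / (kap * (1 + normc z)) ^+ 4.
have tle (x y : 'I_L) : normc (chi x y * term x y z) <= B.
  rewrite /chi; case: ifPn => [/asboolP[w Kw xw]|_]; last first.
    rewrite mul0r normc0; apply: divr_ge0; first by rewrite mulr_ge0// exprn_ge0// ltW.
    by rewrite exprn_ge0// ltW.
  have zw := KM Mz Kw; have := normc_triangle (cen x y) z w => tri.
  have zx : rho <= normc (z - cen x y) by lra.
  have zk : kap * (1 + normc z) <= normc (z - cen x y).
    have h1 : normc z <= R0 + rho + normc (z - cen x y).
      have := normc_triangle (cen x y) z 0; have := normc_triangle w (cen x y) 0.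
      by rewrite !subr0; have := KR0 Kw; lra.
    rewrite /kap mulrAC ler_pdivrMr//.
    apply: (@le_trans _ _ (rho * (1 + R0 + rho + normc (z - cen x y)))).
      by rewrite ler_pM2l//; lra.
    have : (1 + R0 + rho) * rho <= (1 + R0 + rho) * normc (z - cen x y) by rewrite ler_wpM2l//; lra.
    lra.
  rewrite mul1r; apply: le_trans (normc_cell i2 t0 _) _.
    by have := t8; have := t0; lra.
  apply: ler_wpM2l; first by rewrite mulr_ge0// exprn_ge0// ltW.
  rewrite lef_pV2 ?posrE ?exprn_gt0//; last lra.
  by rewrite lerXn2r ?nnegrE ?ge0_normc// ltW.
apply: (@le_trans _ _ (L%:R * (L%:R * B) * (1 + normc z))).
  apply: ler_wpM2r; first lra.
  exact: normc_sum_le (fun x => normc_sum_le (fun y => tle x y)).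
have -> : L%:R * (L%:R * B) * (1 + normc z) =
    k%:R ^+ 2 * (rho / kap) ^+ 4 / N%:R * ((8 ^+ 3 * N%:R)^-1 * ((1 + normc z) ^+ 3)^-1).
  rewrite /B /L natrM /t; field; rewrite !gt_eqF//; lra.
apply: ler_piMr.
  apply: divr_ge0 => //; apply: mulr_ge0; first exact: sqr_ge0.
  by apply: exprn_ge0; apply: divr_ge0; exact: ltW.
have z10 : 0 < 1 + normc z by lra.
have e8 : 1 <= 8 ^+ 3 :> R by apply: exprn_ege1; lra.
have D0 : 0 < 8 ^+ 3 * N%:R * (1 + normc z) ^+ 3.
  by apply: mulr_gt0; [apply: mulr_gt0; [exact: lt_le_trans ltr01 e8|exact: nr]|exact: exprn_gt0].
rewrite -invfM (invf_le1 D0).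
have e3 : 1 <= (1 + normc z) ^+ 3 by rewrite exprn_ege1.
have en : 1 <= 8 ^+ 3 * N%:R :> R.
  by apply: (le_trans nr1); rewrite ler_peMl// ltW.
by apply: (le_trans en); rewrite ler_peMr//; exact: le_trans ler01 en.
Qed.

Lemma lattice_separation : exists v : C R -> C R,
  [/\ rational_on (fun w => K w \/ M w) v,
      forall z, K z -> normc (v z - 1) <= (8 + k%:R ^+ 2) / N%:R
    & forall z, M z -> normc (v z) * (1 + normc z) <=
        k%:R ^+ 2 * (1 + R0 + 2 * rho) ^+ 4 / N%:R].
Proof.
have T0 : 0 < T by have := T2; lra.
have T0C : rc T != 0 by rewrite -normc_gt0 normc_rc gtr0_norm.
have Tinv x : 0 <= x -> x / T <= x.
  by move=> x0; rewrite ler_pdivrMr// ler_peMr//; have := T2; lra.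
exists (fun z => u z * (rc T)^-1); split.
- by apply: rational_on_mul; [exact: u_rational|exact: rational_on_cst].
- move=> z Kz; have -> : u z / rc T - 1 = (u z - rc T) / rc T by field.
  rewrite normc_div normc_rc gtr0_norm//.
  by apply: le_trans (Tinv _ (ge0_normc _)) _; exact: near_u.
- move=> z Mz; rewrite normc_div normc_rc gtr0_norm//.
  have -> : 1 + R0 + 2 * rho = rho / kap.
    by rewrite /kap; field; have := rho0; have := R00 => ? ?; rewrite !gt_eqF//; lra.
  apply: le_trans (far_u Mz); rewrite ler_wpM2r//; last exact: Tinv (ge0_normc _).
  by have := ge0_normc z; lra.
Qed.

End Lattice.

Section Separation.
Variable R : realType.
Implicit Types (z : C R).

Lemma normc_expB1 (x : C R) (d : R) n : normc (x - 1) <= d -> d <= 1 ->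
  normc (x ^+ n - 1) <= n%:R * 2 ^+ n * d.
Proof.
move=> xd d1; have d0 : 0 <= d := le_trans (ge0_normc _) xd.
elim: n => [|n IH]; first by rewrite expr0 subrr normc0 mul0r mul0r.
have -> : x ^+ n.+1 - 1 = x * (x ^+ n - 1) + (x - 1) by rewrite exprS; ring.
apply: le_trans (normc_le_add _ _) _; rewrite normc_mul.
have x2 : normc x <= 2.
  by have := normc_le_add (x - 1) 1; rewrite subrK normc1; lra.
have := ler_pM (ge0_normc _) (ge0_normc _) x2 IH.
have p1 : 1 <= 2 ^+ n.+1 :> R by rewrite exprn_ege1//; lra.
have : 1 * d <= 2 ^+ n.+1 * d by rewrite ler_wpM2r.
by rewrite -natr1 exprS; lra.
Qed.

(* U/V is a power of the normalised sum of the [cell]s of a fine grid that are near K: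
   the poles of neighbouring cells cancel, except on the boundary of their union. *)
Lemma separation (K M : set (C R)) (R0 rho : R) : 0 < rho ->
  (forall z, K z -> normc z <= R0) ->
  (forall z w, M z -> K w -> rho <= normc (z - w)) ->
  forall (D : nat) (e : R), 0 < e -> exists U V : {poly C R},
  (forall z, M z -> V.[z] != 0 /\ normc (U.[z] / V.[z]) * (1 + normc z) ^+ D <= e) /\
  (forall z, K z -> V.[z] != 0 /\ normc (U.[z] / V.[z] - 1) <= e).
Proof.
move=> rho0 KR KM D e e0.
pose R1 := Num.max R0 0.
have R10 : 0 <= R1 by rewrite le_max lexx orbT.
have KR1 z : K z -> normc z <= R1 by move=> /KR h; rewrite le_max h.
pose r := rho / 2; have r0 : 0 < r by rewrite divr_gt0.
have KMr z w : M z -> K w -> 2 * r <= normc (z - w).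
  by move=> Mz Kw; have := KM z w Mz Kw; rewrite /r; lra.
pose k := (Num.truncn (8 * (R1 + 2 * r) / r)).+1.
have hk : 8 * (R1 + 2 * r) / r <= k%:R by apply/ltW/truncnS_gt.
pose A := 8 + k%:R ^+ 2 + k%:R ^+ 2 * (1 + R1 + 2 * r) ^+ 4 : R.
have k2 : 0 <= k%:R ^+ 2 :> R by exact: sqr_ge0.
have A1 : 0 <= k%:R ^+ 2 * (1 + R1 + 2 * r) ^+ 4.
  by apply: mulr_ge0 => //; apply: exprn_ge0; lra.
have c0 : 0 < D.+1%:R * 2 ^+ D.+1 :> R by rewrite mulr_gt0 ?exprn_gt0.
(* On [M] one factor |v| (1 + |z|) <= d of the power D + 1 gives the bound and the others are at
   most 1; on [K] the last entry compensates the loss in [normc_expB1]. *)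
pose d := Num.min (Num.min 1 e) (e / (D.+1%:R * 2 ^+ D.+1)).
have d0 : 0 < d by rewrite !lt_min ltr01 e0 divr_gt0.
have d1 : d <= 1 by rewrite !ge_min lexx.
have de : d <= e by rewrite !ge_min lexx orbT.
have dD : D.+1%:R * 2 ^+ D.+1 * d <= e.
  by rewrite mulrC -ler_pdivlMr// ge_min lexx orbT.
pose N := (Num.truncn (A / d)).+1.
have N0 : 0 < N%:R :> R by rewrite ltr0n.
have AN : A / N%:R <= d.
  by rewrite ler_pdivrMr// mulrC -ler_pdivrMr//; apply/ltW/truncnS_gt.
have [v [rv vK vM]] := lattice_separation r0 KR1 KMr R10 (ltn0Sn _ : (0 < N)%N) hk.
have [U [V UV]] := rational_on_exp D.+1 rv.
have AN1 x : 0 <= A - x -> x / N%:R <= d.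
  by move=> xA; apply: le_trans AN; rewrite ler_pM2r ?invr_gt0//; lra.
exists U, V; split=> z Sz; have [V0 <-] := UV z ltac:(by [left|right]); split=> //.
- have z1 : 1 <= 1 + normc z by have := ge0_normc z; lra.
  have h : normc (v z) * (1 + normc z) <= d.
    by apply: le_trans (vM z Sz) _; apply: AN1; rewrite /A; lra.
  have h0 : 0 <= normc (v z) * (1 + normc z).
    by rewrite mulr_ge0 ?ge0_normc//; lra.
  rewrite normc_exp; apply: (@le_trans _ _ ((normc (v z) * (1 + normc z)) ^+ D.+1)).
    rewrite exprMn; apply: ler_wpM2l; first by rewrite exprn_ge0// ge0_normc.
    by rewrite exprS ler_peMl// exprn_ge0//; lra.
  rewrite exprS; apply: (@le_trans _ _ (d * 1)); last by rewrite mulr1.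
  apply: ler_pM => //; first by rewrite exprn_ge0.
  by rewrite exprn_ile1//; lra.
- have h : normc (v z - 1) <= d.
    by apply: le_trans (vK z Sz) _; apply: AN1; rewrite /A; lra.
  exact: le_trans (normc_expB1 D.+1 h d1) dD.
Qed.

End Separation.

(** * Values and derivatives of rational functions *)

Section FractionValue.
Local Open Scope quotient_scope.
Variable R : realType.
Implicit Types (A B : {poly C R}) (z : C R) (r : {fraction {poly C R}}).

Lemma fracE r : r * tofrac (frac (repr r)).2 = tofrac (frac (repr r)).1.
Proof.
rewrite -{1}[r]reprK !piE; apply/eqmodP; rewrite /= FracField.equivfE /FracField.mulf.
rewrite !numden_Ratio ?(oner_eq0, mulf_neq0, denom_ratioP)// !mulr1.
by rewrite mulrC.
Qed.

Lemma frac_denom r : (frac (repr r)).2 != 0.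
Proof. exact: denom_ratioP. Qed.

(* The point (a : b) of the Riemann sphere. *)
Definition hval (a b : C R) : sphere R := if b == 0 then None else Some (a / b).

(** Reduction cancels common zeros of [A] and [B] elsewhere, so only the point [z] matters; this
    matches [in_E], which excludes common zeros on a given set. *)
Lemma rat_value_tofrac A B z : B != 0 -> (A.[z] != 0) || (B.[z] != 0) ->
  rat_value (tofrac A / tofrac B) z = hval A.[z] B.[z].
Proof.
move=> B0 AB0; set r := tofrac A / tofrac B; rewrite /rat_value /hval.
have := fracE r; have := frac_denom r.
move: (frac (repr r)).1 (frac (repr r)).2 => P Q Q0 PQ.
have PB : P * B = A * Q.
  apply/eqP; rewrite -(tofrac_eq (P * B)) !tofracM -PQ /r.
  by rewrite mulrAC divfK// tofrac_eq0.
have g0 : gcdp P Q != 0 by rewrite gcdp_eq0 negb_and Q0 orbT.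
set P1 := P %/ gcdp P Q; set Q1 := Q %/ gcdp P Q.
have P1E : P = P1 * gcdp P Q by rewrite divpK ?dvdp_gcdl.
have Q1E : Q = Q1 * gcdp P Q by rewrite divpK ?dvdp_gcdr.
have cop : coprimep P1 Q1.
  by rewrite /P1 /Q1 coprimep_div_gcd// Q0 orbT.
have E : P1 * B = A * Q1.
  apply: (mulIf g0); rewrite -!mulrA [B * _]mulrC !mulrA -P1E PB {1}Q1E; ring.
have Ez : P1.[z] * B.[z] = A.[z] * Q1.[z] by rewrite -!hornerM E.
have [Bz|Bz] := eqVneq B.[z] 0.
  rewrite Bz eqxx orbF in AB0; rewrite Bz mulr0 in Ez.
  have : Q1.[z] == 0 by move/esym/eqP: Ez; rewrite mulf_eq0 (negPf AB0).
  by rewrite /root => ->.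
have Q1z : Q1.[z] != 0.
  apply/negP => Q1z; have : P1.[z] = 0.
    by move/eqP: Ez; rewrite (eqP Q1z) mulr0 mulf_eq0 (negPf Bz) orbF => /eqP.
  move=> P1z; have := coprimep_root cop (x := z); rewrite /root P1z eqxx => /(_ isT).
  by rewrite Q1z.
rewrite /root (negPf Q1z); congr Some.
by apply/eqP; rewrite eqr_div// Ez mulrC.
Qed.

Lemma rat_value_coprime r : exists A B, [/\ B != 0, coprimep A B &
  forall z, rat_value r z = hval A.[z] B.[z]].
Proof.
rewrite /rat_value; have := frac_denom r.
move: (frac (repr r)).1 (frac (repr r)).2 => P Q Q0.
exists (P %/ gcdp P Q), (Q %/ gcdp P Q); split => //.
- by rewrite divp_eq0 !negb_or Q0 gcdp_eq0 negb_and Q0 orbT -leqNgt leq_gcdpr.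
- by rewrite coprimep_div_gcd// Q0 orbT.
Qed.

End FractionValue.

(** * The chordal metric in homogeneous coordinates *)

Section Chordal.
Variable R : realType.
Implicit Types (a b c d : C R).

(* The chordal distance of (a : b) and (c : d) is |ad - bc| divided by Euclidean
   norms; n1 replaces those up to a factor 2, so that no square roots appear. *)
Definition n1 a b : R := normc a + normc b.
Definition cross a b c d : R := normc (a * d - b * c).

Lemma n1_gt0 a b : (a != 0) || (b != 0) -> 0 < n1 a b.
Proof.
have := ge0_normc a; have := ge0_normc b; rewrite /n1 -!normc_gt0 => ? ? /orP[]; lra.
Qed.

Let n2 a b : R := Num.sqrt (normc a ^+ 2 + normc b ^+ 2).

Let n2_le a b : n2 a b <= n1 a b.
Proof.
have a0 := ge0_normc a; have b0 := ge0_normc b.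
rewrite /n2 /n1 -[leRHS]ger0_norm ?addr_ge0// -sqrtr_sqr ler_sqrt ?sqr_ge0//; nra.
Qed.

Let n1_le a b : n1 a b ^+ 2 <= 2 * n2 a b ^+ 2.
Proof.
rewrite /n2 sqr_sqrtr ?addr_ge0 ?sqr_ge0// /n1.
have := sqr_ge0 (normc a - normc b); lra.
Qed.

Let n2_gt0 a b : (a != 0) || (b != 0) -> 0 < n2 a b.
Proof.
move=> /n1_gt0 h1; have h2 := n1_le a b.
rewrite lt_def sqrtr_ge0 andbT; apply/eqP => e; move: h2; rewrite e expr0n mulr0 /=.
by apply/negP; rewrite -ltNge exprn_gt0.
Qed.

Let n2_scale a b : b != 0 -> Num.sqrt (1 + normc (a / b) ^+ 2) = n2 a b / normc b.
Proof.
move=> b0; have nb : 0 < normc b by rewrite normc_gt0.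
rewrite normc_div /n2 -{3}[normc b]ger0_norm ?ge0_normc// -sqrtr_sqr -sqrtrV ?sqr_ge0//.
rewrite -sqrtrM ?addr_ge0 ?sqr_ge0//; congr Num.sqrt; field; rewrite gt_eqF//.
Qed.

Let n2_0 a : n2 a 0 = normc a.
Proof. by rewrite /n2 normc0 expr0n addr0 sqrtr_sqr ger0_norm ?ge0_normc. Qed.

Lemma chordalE a b c d : (a != 0) || (b != 0) -> (c != 0) || (d != 0) ->
  chordal (hval a b) (hval c d) = cross a b c d / (n2 a b * n2 c d).
Proof.
move=> ab cd; rewrite /hval /cross.
have := n2_gt0 ab; have := n2_gt0 cd.
have [b0|b0] := eqVneq b 0; have [d0|d0] := eqVneq d 0 => /=.
- by rewrite b0 d0 mulr0 mul0r subrr normc0 mul0r.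
- rewrite b0 n2_0 n2_scale// mul0r subr0 normc_mul => h1 h2.
  have dd : 0 < normc d by rewrite normc_gt0.
  by field; rewrite !gt_eqF.
- rewrite d0 n2_0 n2_scale// mulr0 sub0r normc_opp normc_mul => h1 h2.
  have dd : 0 < normc b by rewrite normc_gt0.
  by field; rewrite !gt_eqF.
- rewrite !n2_scale// => h1 h2.
  have bb : 0 < normc b by rewrite normc_gt0.
  have dd : 0 < normc d by rewrite normc_gt0.
  have -> : a / b - c / d = (a * d - b * c) / (b * d) by field; rewrite b0 d0.
  by rewrite normc_div normc_mul; field; rewrite !gt_eqF.
Qed.

(** The sum norm [n1] exceeds the Euclidean one by at most a factor sqrt 2; two such factors give
    the 2. *)
Lemma chordal_le a b c d (s : R) : (a != 0) || (b != 0) -> (c != 0) || (d != 0) ->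
  0 < s -> s * cross a b c d <= n1 a b * n1 c d -> chordal (hval a b) (hval c d) <= 2 / s.
Proof.
move=> ab cd s0; rewrite chordalE//; have h1 := n2_gt0 ab; have h2 := n2_gt0 cd.
have sq (x y : R) : 0 <= x -> 0 < y -> x ^+ 2 <= 2 * y ^+ 2 -> x <= Num.sqrt 2 * y.
  move=> x0 y0 xy; rewrite -[x]ger0_norm// -[y]gtr0_norm// -!sqrtr_sqr -sqrtrM//.
  by rewrite ler_sqrt// mulr_ge0// sqr_ge0.
have m1 := sq _ _ (ltW (n1_gt0 ab)) h1 (n1_le a b).
have m2 := sq _ _ (ltW (n1_gt0 cd)) h2 (n1_le c d).
rewrite ler_pdivrMr ?mulr_gt0// mulrAC ler_pdivlMr// mulrC => /le_trans; apply.
apply: le_trans (ler_pM (ltW (n1_gt0 ab)) (ltW (n1_gt0 cd)) m1 m2) _.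
by rewrite mulrACA -expr2 sqr_sqrtr.
Qed.

Lemma chordal_lt a b c d (s : R) : (a != 0) || (b != 0) -> (c != 0) || (d != 0) ->
  0 < s -> chordal (hval a b) (hval c d) < s^-1 -> s * cross a b c d < n1 a b * n1 c d.
Proof.
move=> ab cd s0; rewrite chordalE//; have h1 := n2_gt0 ab; have h2 := n2_gt0 cd.
rewrite ltr_pdivrMr ?mulr_gt0// mulrC ltr_pdivlMr// mulrC => /lt_le_trans; apply.
exact: ler_pM (ltW h1) (ltW h2) (n2_le a b) (n2_le c d).
Qed.

(** The chordal triangle inequality through (c : d), free of denominators: a determinant identity,
    taken once for each coordinate of the middle point. *)
Lemma cross_triangle a b c d x y :
  cross a b x y * n1 c d <= cross c d x y * n1 a b + cross a b c d * n1 x y.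
Proof.
rewrite /n1 !mulrDr addrACA; apply: lerD; rewrite /cross -!normc_mul.
  have -> : (a * y - b * x) * c = (c * y - d * x) * a + (a * d - b * c) * x by ring.
  exact: normc_le_add.
have -> : (a * y - b * x) * d = (c * y - d * x) * b + (a * d - b * c) * y by ring.
exact: normc_le_add.
Qed.

End Chordal.

(** * Iterated derivatives of a quotient of polynomials *)

Section Quotient.
Variable R : realType.
Implicit Types (A B p : {poly C R}) (z : C R).

(** Numerator of the l-th derivative of A / B over B^(l+1), left unreduced: it is additive in [A]
    and depends continuously on both polynomials, also where [B] vanishes. *)
Fixpoint quot_num A B (l : nat) : {poly C R} :=
  if l is k.+1
  then (quot_num A B k)^`() * B - k.+1%:R *: (quot_num A B k * B^`())
  else A.

Lemma is_derive_horner p z : is_derive z 1 (horner p) p^`().[z].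
Proof.
elim/poly_ind: p => [|p c IH].
  rewrite deriv0 horner0 (_ : horner 0 = cst 0); first exact: is_derive_cst.
  by apply/funext => w; rewrite horner0.
rewrite (_ : horner (p * 'X + c%:P) = fun w => p.[w] * w + c); last first.
  by apply/funext => w; rewrite !hornerE.
have h := is_deriveD (is_derive_mulC IH (is_derive_id z (1 : C R))) (is_derive_cst c z 1).
apply: is_derive_eq h _; rewrite derivD derivM derivX derivC !hornerE; ring.
Qed.

Lemma open_nonroot B : open [set z : C R | B.[z] != 0].
Proof.
rewrite openE => z /= Bz; apply/nbhsCP.
have n0 : 0 < normc B.[z] by rewrite normc_gt0.
have /cvg_atP/(_ _ n0)[d d0 hd] := is_derive_continuous (is_derive_horner B z).
exists d => // w /hd h /=; apply: contraTneq h => ->.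
by rewrite sub0r normc_opp ltxx.
Qed.

Lemma is_derive_quot A B k z : B.[z] != 0 ->
  is_derive z 1 (fun w => (quot_num A B k).[w] / B.[w] ^+ k.+1)
    ((quot_num A B k.+1).[z] / B.[z] ^+ k.+2).
Proof.
move=> Bz; have h1 := is_derive_horner (quot_num A B k) z.
have h2 := is_derive_horner (B ^+ k.+1) z.
have b0 : (B ^+ k.+1).[z] != 0 by rewrite horner_exp expf_neq0.
have h3 := is_derive_mulC h1 (is_derive_invC h2 b0).
rewrite (_ : (fun w => _) = fun w => (quot_num A B k).[w] * ((B ^+ k.+1).[w])^-1); last first.
  by apply/funext => w; rewrite horner_exp.
apply: is_derive_eq h3 _; rewrite deriv_exp /=.
rewrite !(hornerD, hornerN, hornerM, hornerZ, hornerMn, horner_exp) !exprS.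
have t0 : B.[z] ^+ k != 0 by rewrite expf_neq0.
rewrite -mulr_natl.
move: (B.[z] ^+ k) t0 => t t0; move: B.[z] Bz => b b0'.
by field; rewrite t0 b0'.
Qed.

Lemma quot_smooth A B : smooth_on [set z : C R | B.[z] != 0] (fun w => A.[w] / B.[w]) /\
  forall l z, B.[z] != 0 ->
    derive1n l (fun w => A.[w] / B.[w]) z = (quot_num A B l).[z] / B.[z] ^+ l.+1.
Proof.
have H := @derive1n_local R (fun l w => (quot_num A B l).[w] / B.[w] ^+ l.+1)
  (fun w => A.[w] / B.[w]) [set z : C R | B.[z] != 0] (@open_nonroot B).
by split=> l z Bz; have [] := H (fun _ _ => erefl) (fun l w => @is_derive_quot A B l w) l z Bz.
Qed.

End Quotient.

(** * Pade approximants of rational functions *)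

Section JacobiFormula.
Variables (F : fieldType) (a : int -> F) (p q : nat) (S : int -> {poly F}).
Hypothesis a_neg : forall n, a (Negz n) = 0.
Hypothesis coefS : forall k v, (S k)`_v = if v%:Z <= k then a v%:Z else 0.
Variables (N D : {poly F}).
Hypothesis cop : coprimep N D.
Hypothesis sizeN : size N = p.+1.
Hypothesis sizeD : (size D <= q.+1)%N.
Let ap : {poly F} := \poly_(k < (p + q).+1) a k%:Z.
Hypothesis taylor : forall k, (k <= p + q)%N -> (D * ap)`_k = N`_k.

Let H : 'M[F]_q := \matrix_(i < q, j < q) a (p%:Z - q%:Z + i.+1%:Z + j.+1%:Z - 1).

Let jac (r : 'I_q.+1 -> {poly F}) : {poly F} :=
  \det (\matrix_(i < q.+1, j < q.+1)
    if i == ord0 then r j else (a (p%:Z - q%:Z + i%:Z + j%:Z))%:P).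

Let coefXa m k : (k <= p + q)%N -> ('X^m * ap)`_k = a (k%:Z - m%:Z).
Proof.
move=> kpq; rewrite coefXnM; case: ltnP => km.
  by have -> : k%:Z - m%:Z = Negz (m - k).-1 by lia.
rewrite coef_poly ifT; last by rewrite ltnS (leq_trans (leq_subr _ _) kpq).
by congr a; lia.
Qed.

Let coefM_ext (P Q Z : {poly F}) n : (forall k, (k < n)%N -> P`_k = Q`_k) ->
  forall k, (k < n)%N -> (Z * P)`_k = (Z * Q)`_k.
Proof.
move=> h k kn; rewrite !coefM; apply: eq_bigr => j _; rewrite h//.
by rewrite (leq_ltn_trans (leq_subr _ _) kn).
Qed.

Let eq_poly_trunc (P Q : {poly F}) n : (size P <= n)%N -> (size Q <= n)%N ->
  (forall k, (k < n)%N -> P`_k = Q`_k) -> P = Q.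
Proof.
move=> sP sQ h; apply/polyP => k; have [/h//|nk] := ltnP k n.
by rewrite !nth_default// ?(leq_trans sP) ?(leq_trans sQ).
Qed.

(* A kernel vector of the Hankel matrix is a denominator of lower degree, which
   contradicts coprimality and size N = p.+1. *)
Lemma hankel_neq0 : D`_0 != 0 -> \det H != 0.
Proof.
move=> D00; apply/negP => /det0P[v v0 vH].
pose X : {poly F} := \sum_(i < q) v 0 i *: 'X^(q.-1 - i).
have sX : (size X <= q)%N.
  apply: (leq_trans (size_sum _ _ _)); apply/bigmax_leqP => i _.
  apply: (leq_trans (size_scale_leq _ _)); rewrite size_polyXn.
  by have := ltn_ord i; lia.
have Xa k : (k <= p + q)%N -> (X * ap)`_k = \sum_(i < q) v 0 i * a (k%:Z - (q.-1 - i)%:Z).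
  move=> kpq; rewrite mulr_suml coef_sum; apply: eq_bigr => i _.
  by rewrite -scalerAl coefZ coefXa.
have X0 j : (j < q)%N -> (X * ap)`_(p + j) = 0.
  move=> jq; rewrite Xa; last by rewrite leq_add2l ltnW.
  have := congr1 (fun M : 'rV_q => M 0 (Ordinal jq)) vH; rewrite !mxE => hv; rewrite -[RHS]hv.
  apply: eq_bigr => i _; rewrite mxE /=; congr (_ * a _).
  by have := ltn_ord i; lia.
pose Y : {poly F} := \poly_(k < p) (X * ap)`_k.
have XY k : (k < p + q)%N -> (X * ap)`_k = Y`_k.
  move=> kpq; rewrite coef_poly; case: ltnP => // pk.
  by rewrite -(subnKC pk) X0// ltn_subLR.
(* Both sides agree with [X * D * ap] in the coefficients below p + q, and both have degree below p
   + q. *)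
have E : X * N = D * Y.
  apply: (@eq_poly_trunc _ _ (p + q)).
  - by apply: (leq_trans (size_polyMleq _ _)); rewrite sizeN; lia.
  - apply: (leq_trans (size_polyMleq _ _)).
    have : (size Y <= p)%N by exact: size_poly.
    by move: sizeD; lia.
  move=> k kpq; rewrite -(@coefM_ext _ _ _ _ XY)// mulrCA.
  apply: (@coefM_ext _ _ _ (p + q).+1); last exact: ltnW.
  by move=> k' k'pq; rewrite taylor.
have NY : N %| Y by rewrite -(Gauss_dvdpr _ cop) -E dvdp_mull.
have Y0 : Y = 0.
  apply/eqP; apply: contraTT NY => Y0; rewrite gtNdvdp// sizeN ltnS size_poly//.
have XN : X = 0.
  move/eqP: E; rewrite Y0 mulr0 mulf_eq0 => /orP[/eqP//|/eqP N0].
  by move: sizeN; rewrite N0 size_poly0.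
move/negP: v0; apply; apply/eqP/rowP => i; rewrite mxE.
have : X`_(q.-1 - i) = 0 by rewrite XN coef0.
rewrite coef_sum (bigD1 i)//= coefZ coefXn eqxx mulr1 big1 ?addr0// => j ji.
rewrite coefZ coefXn (_ : (_ == _) = false) ?mulr0//; apply/negbTE.
apply: contra ji => /eqP e; apply/eqP/val_inj => /=.
by have := ltn_ord i; have := ltn_ord j; lia.
Qed.

Let M (x : 'I_q.+1 -> F) : 'M[F]_q.+1 := \matrix_(i < q.+1, j < q.+1)
  if i == ord0 then x j else a (p%:Z - q%:Z + i%:Z + j%:Z).
Let c (j : 'I_q.+1) := cofactor (M (fun=> 0)) ord0 j.

Let cofM x j : cofactor (M x) ord0 j = c j.
Proof.
rewrite /c /cofactor; congr (_ * \det _); apply/matrixP => i k; rewrite !mxE.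
by rewrite eq_sym (negPf (neq_lift _ _)).
Qed.

Let jacE (r : 'I_q.+1 -> {poly F}) : jac r = \sum_j c j *: r j.
Proof.
rewrite /jac (expand_det_row _ ord0); apply: eq_bigr => j _.
rewrite mxE eqxx -mul_polyC mulrC; congr (_ * _).
rewrite /c /cofactor rmorphM rmorphXn rmorphN1 -det_map_mx; congr (_ * \det _).
apply/matrixP => i k; rewrite !mxE.
by rewrite eq_sym (negPf (neq_lift _ _)).
Qed.

(** The sum is a determinant with two equal rows; it makes the coefficients of orders p + 1 to p + q
    in the product of the Jacobi denominator with [ap] vanish. *)
Let c_alt i : (0 < i)%N -> (i <= q)%N -> \sum_j c j * a (p%:Z - q%:Z + i%:Z + (j : nat)%:Z) = 0.
Proof.
move=> i0 iq; pose x (j : 'I_q.+1) := a (p%:Z - q%:Z + i%:Z + (j : nat)%:Z).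
transitivity (\det (M x)).
  rewrite (expand_det_row _ ord0); apply: eq_bigr => j _.
  by rewrite mxE eqxx cofM mulrC.
have iq1 : (i < q.+1)%N by rewrite ltnS.
apply: (@determinant_alternate _ _ _ ord0 (Ordinal iq1)).
  by rewrite -val_eqE /= eq_sym -lt0n.
by move=> j; rewrite !mxE eqxx -val_eqE /= eqn0Ngt i0.
Qed.

Let c_max : c ord_max = (-1) ^+ q * \det H.
Proof.
rewrite /c /cofactor add0n; congr (_ * \det _); apply/matrixP => i j; rewrite !mxE.
rewrite eq_sym (negPf (neq_lift _ _)) /=; congr a.
rewrite /bump leq0n leqNgt ltn_ord /=; lia.
Qed.

(** [B * ap] and [A] agree through order p + q, and so do [D * ap] and [N]; the degrees make D A = B
    N an identity. Coprimality gives a common factor [s], of degree 0 because [N] already has degree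
    p. The constant term of [B] is the Hankel determinant up to sign, so [s] is nonzero. *)
Lemma jacobi_formula : D`_0 != 0 -> exists2 k : F, k != 0 &
  jac (fun j => 'X^(q - j) * S (p%:Z - q%:Z + (j : nat)%:Z)) = k *: N /\
  jac (fun j => 'X^(q - j)) = k *: D.
Proof.
move=> D00; have H0 := hankel_neq0 D00.
set A := jac _; set B := jac _.
have sB : (size B <= q.+1)%N.
  rewrite /B jacE; apply: (leq_trans (size_sum _ _ _)); apply/bigmax_leqP => j _.
  by apply: (leq_trans (size_scale_leq _ _)); rewrite size_polyXn ltnS leq_subr.
have coefA m : A`_m = if (m <= p)%N then \sum_j c j * a (m%:Z - (q - j)%:Z) else 0.
  rewrite /A jacE coef_sum.
  have e (j : 'I_q.+1) : (c j *: ('X^(q - j) * S (p%:Z - q%:Z + (j : nat)%:Z)))`_m =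
      c j * (if (m <= p)%N then a (m%:Z - (q - j)%:Z) else 0).
    have jq := ltn_ord j; rewrite coefZ coefXnM coefS; congr (_ * _).
    case: ltnP => mj.
      have -> : m%:Z - (q - j)%:Z = Negz (q - j - m).-1 by lia.
      by rewrite a_neg if_same.
    have -> : ((m - (q - j))%:Z <= p%:Z - q%:Z + (j : nat)%:Z) = (m <= p)%N by lia.
    by case: ifP => // _; congr a; lia.
  by rewrite (eq_bigr _ (fun j _ => e j)); case: ifP => // _; rewrite big1// => j _; rewrite mulr0.
have coefBa m : (m <= p + q)%N -> (B * ap)`_m = \sum_j c j * a (m%:Z - (q - j)%:Z).
  move=> mpq; rewrite /B jacE mulr_suml coef_sum; apply: eq_bigr => j _.
  by rewrite -scalerAl coefZ coefXa.
have BA m : (m < (p + q).+1)%N -> (B * ap)`_m = A`_m.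
  rewrite ltnS => mpq; rewrite coefA coefBa//; case: leqP => // pm.
  rewrite -[RHS](@c_alt (m - p)); [|lia|lia].
  by apply: eq_bigr => j _; congr (_ * a _); have := ltn_ord j; lia.
have sA : (size A <= p.+1)%N.
  by apply/leq_sizeP => j pj; rewrite coefA leqNgt pj.
have E : D * A = B * N.
  apply: (@eq_poly_trunc _ _ (p + q).+1).
  - by apply: (leq_trans (size_polyMleq _ _)); move: sizeD; lia.
  - by apply: (leq_trans (size_polyMleq _ _)); rewrite sizeN; move: sB; lia.
  move=> m mpq; rewrite -(@coefM_ext _ _ _ _ BA)// mulrCA.
  by apply: (@coefM_ext _ _ _ (p + q).+1) => // k kpq; rewrite taylor.
have NA : N %| A by rewrite -(Gauss_dvdpr _ cop) E dvdp_mull.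
have N0 : N != 0 by rewrite -size_poly_gt0 sizeN.
have [s sE] : exists s, A = s * N by exists (A %/ N); rewrite divpK.
have BsD : B = s * D.
  by apply: (mulIf N0); rewrite -E sE mulrCA mulrA.
have B0 : B`_0 != 0.
  rewrite /B jacE coef_sum (bigD1 ord_max)//= coefZ subnn expr0 coef1 mulr1.
  rewrite big1 ?addr0 => [|j jm]; first by rewrite c_max mulf_neq0 ?signr_eq0.
  rewrite coefZ coefXn (_ : (_ == _) = false) ?mulr0//; apply/negbTE.
  have : (j : nat) != q by apply: contra jm => /eqP e; apply/eqP/val_inj.
  by have := ltn_ord j; lia.
have s0 : s != 0 by apply: contraNneq B0 => s0; rewrite BsD s0 mul0r coef0.
have /size_poly1P[k k0 sk] : size s == 1%N.
  have := sA; rewrite sE size_mul// sizeN => sS.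
  have : (0 < size s)%N by rewrite size_poly_gt0.
  by move: sS; case: (size s) => [|[|n]] //; lia.
by exists k => //; rewrite sE BsD sk !mul_polyC.
Qed.

End JacobiFormula.

Section PadeRational.
Variable R : realType.
Implicit Types (N D A T : {poly C R}) (z zeta : C R).

Lemma quot_numD A T D l : quot_num (A + T) D l = quot_num A D l + quot_num T D l.
Proof.
elim: l => [//|l IH] /=; rewrite IH derivD mulrDl mulrDl scalerDr opprD.
by rewrite addrACA.
Qed.

Lemma quot_num_mul D T l : quot_num (D * T) D l = D ^+ l.+1 * derivn l T.
Proof.
elim: l => [|l IH]; first by rewrite expr1 derivn0.
rewrite derivnS [LHS]/= IH derivM deriv_exp -pred_Sn -mul_polyC -mulr_natl.
have -> : (l.+1%:R : C R)%:P = l.+1%:R :> {poly C R} by rewrite polyC_natr.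
by rewrite !exprS; ring.
Qed.

Lemma dvdp_quot_num n A D l : (l <= n)%N -> 'X^n %| A -> 'X^(n - l) %| quot_num A D l.
Proof.
move=> + nA; elim: l => [|l IH] ln; first by rewrite subn0.
have /dvdpP[Z e] := IH (ltnW ln).
rewrite /= e; have -> : (n - l = (n - l.+1).+1)%N by rewrite subnSK.
rewrite derivM derivXn /= dvdp_sub//.
  rewrite dvdp_mulr// dvdp_add//; first by rewrite exprS mulrA dvdp_mull.
  by rewrite -mulr_natl mulrA dvdp_mull.
by rewrite -mul_polyC dvdp_mull// dvdp_mulr// exprS mulrA dvdp_mull.
Qed.

Lemma quot_num_comp A D (c : C R) l :
  quot_num (A \Po ('X + c%:P)) (D \Po ('X + c%:P)) l = quot_num A D l \Po ('X + c%:P).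
Proof.
elim: l => [//|l IH] /=.
by rewrite IH !deriv_comp derivD derivX derivC addr0 !mulr1 comp_polyB comp_polyZ !comp_polyM.
Qed.

(** By Bezout, N = D T + X^(n+1) v N with a polynomial [T]. The derivatives of D T / D are those of
    [T], and the remainder contributes nothing at 0 through order n. *)
Lemma quot_taylor N D n : D`_0 != 0 -> forall k, (k <= n)%N ->
  (D * \poly_(l < n.+1) ((quot_num N D l).[0] / D.[0] ^+ l.+1 / l`!%:R))`_k = N`_k.
Proof.
move=> D0 k kn; have D00 : D.[0] != 0 by rewrite horner_coef0.
have cDX : coprimep D ('X^(n.+1)).
  by rewrite coprimep_expr// -['X]subr0 coprimep_XsubC.
have [[u v] /= uv] := Bezout_eq1_coprimepP _ _ cDX.
pose T := u * N.
have NE : N = D * T + 'X^(n.+1) * (v * N).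
  by rewrite /T -[LHS]mul1r -uv; ring.
have bT l : (l <= n)%N -> (quot_num N D l).[0] / D.[0] ^+ l.+1 / l`!%:R = T`_l.
  move=> ln; rewrite {1}NE quot_numD quot_num_mul hornerD hornerM horner_exp.
  have -> : (quot_num ('X^(n.+1) * (v * N)) D l).[0] = 0.
    have : 'X^(n.+1 - l) %| quot_num ('X^(n.+1) * (v * N)) D l.
      by apply: dvdp_quot_num; rewrite ?dvdp_mulr// ltnW.
    move=> /dvdpP[Z ->]; rewrite subSn// hornerM horner_exp hornerX expr0n mulr0//.
  rewrite addr0 [D.[0] ^+ _ * _]mulrC mulfK ?expf_neq0// horner_coef0 coef_derivn addn0 ffactnn.
  by rewrite -[T`_l *+ _]mulr_natr mulfK// pnatr_eq0 -lt0n fact_gt0.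
transitivity ((D * T)`_k).
  rewrite !coefM; apply: eq_bigr => j _; rewrite coef_poly ifT ?bT//.
    exact: leq_trans (leq_subr _ _) kn.
  by rewrite ltnS (leq_trans (leq_subr _ _) kn).
by rewrite [in RHS]NE coefD coefXnM ltnS kn addr0.
Qed.

Lemma jacobi_det_comp (Omega : set (C R)) f p q zeta r :
  jacobi_det Omega f p zeta r \Po ('X + zeta%:P) =
  \det (\matrix_(i < q.+1, j < q.+1) if i == ord0 then r j \Po ('X + zeta%:P)
    else (taylor_coef Omega f zeta (p%:Z - q%:Z + i%:Z + j%:Z))%:P).
Proof.
rewrite /jacobi_det -[LHS]/(comp_poly ('X + zeta%:P) _) -det_map_mx.
congr (\det _); apply/matrixP => i j; rewrite !mxE.
by case: ifP => // _; rewrite /= comp_polyC.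
Qed.

(** Composition with ['X + zeta%:P] moves the point to 0, where powers of ['X - zeta%:P] become
    monomials and [jacobi_formula] applies. *)
Lemma pade_rational (Omega : set (C R)) (f : C R -> C R) p q zeta N D :
  coprimep N D -> size N = p.+1 -> (size D <= q.+1)%N -> D.[zeta] != 0 ->
  (forall l, extD Omega f l zeta = (quot_num N D l).[zeta] / D.[zeta] ^+ l.+1) ->
  \det (hankel Omega f p q zeta) != 0 /\ exists2 c : C R, c != 0 &
    padeA Omega f p q zeta = c *: N /\ padeB Omega f p q zeta = c *: D.
Proof.
move=> cND sN sD Dz fE.
pose sh (A : {poly C R}) := A \Po ('X + zeta%:P).
have shK A : sh A \Po ('X - zeta%:P) = A.
  by rewrite /sh -comp_polyA comp_polyD comp_polyX comp_polyC subrK comp_polyXr.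
have sh_inj : injective sh by move=> A B AB; rewrite -(shK A) AB shK.
have size_sh A : size (sh A) = size A.
  rewrite /sh size_comp_poly2//; exact: size_XaddC.
pose a := taylor_coef Omega f zeta.
have cop : coprimep (sh N) (sh D).
  have [[u v] /= uv] := Bezout_eq1_coprimepP _ _ cND.
  apply/Bezout_eq1_coprimepP; exists (sh u, sh v).
  by rewrite /= -!comp_polyM -comp_polyD uv comp_polyC.
have D0 : (sh D)`_0 != 0.
  by rewrite -horner_coef0 horner_comp !hornerE ?add0r.
have tay k : (k <= p + q)%N -> (sh D * \poly_(k < (p + q).+1) a k%:Z)`_k = (sh N)`_k.
  move=> kpq; rewrite -[RHS](quot_taylor (sh N) D0 kpq).
  have -> // : \poly_(k < (p + q).+1) a k%:Z = \poly_(l < (p + q).+1)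
      ((quot_num (sh N) (sh D) l).[0] / (sh D).[0] ^+ l.+1 / l`!%:R).
  apply/polyP => l; rewrite !coef_poly; case: ifP => // _.
  by rewrite /a /= fE quot_num_comp !horner_comp !hornerE ?add0r.
pose S (k : int) : {poly C R} := sh (taylor_poly Omega f zeta k).
have coefS (k : int) (v : nat) : (S k)`_v = if v%:Z <= k then a v%:Z else 0.
  rewrite /S /sh; case: k => [m|m] /=; last by rewrite comp_poly0 coef0.
  rewrite raddf_sum coef_sum /=.
  have e (j : 'I_m.+1) : (((a j%:Z) *: ('X - zeta%:P) ^+ j) \Po ('X + zeta%:P))`_v =
      if v == j then a j%:Z else 0.
    rewrite comp_polyZ rmorphXn /= comp_polyB comp_polyX comp_polyC addrK coefZ coefXn.
    by case: eqP => _; rewrite ?mulr1 ?mulr0.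
  rewrite (eq_bigr _ (fun j _ => e j)) -big_mkcond /=.
  have [vm|mv] := leqP v m.
    have vm1 : (v < m.+1)%N by [].
    have -> : (v%:Z <= m%:Z) = true by rewrite lez_nat.
    rewrite (bigD1 (Ordinal vm1)) /= ?eqxx// big1 ?addr0// => j /andP[/eqP vj].
    by rewrite -val_eqE /= vj eqxx.
  have -> : (v%:Z <= m%:Z) = false by rewrite lez_nat leqNgt mv.
  rewrite big1// => j /eqP jv; have := ltn_ord j.
  by rewrite -jv ltnS leqNgt mv.
have aN n : a (Negz n) = 0 by [].
have sN' : size (sh N) = p.+1 by rewrite size_sh.
have sD' : (size (sh D) <= q.+1)%N by rewrite size_sh.
split; first exact: (@hankel_neq0 _ a p q aN _ _ cop sN' sD' tay D0).
have [c c0 [cA cB]] := @jacobi_formula _ a p q S aN coefS _ _ cop sN' sD' tay D0.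
have powE j : sh (('X - zeta%:P) ^+ j) = 'X^j.
  by rewrite /sh rmorphXn /= comp_polyB comp_polyX comp_polyC addrK.
exists c => //; split; apply: sh_inj; rewrite /sh comp_polyZ -/(sh N) -/(sh D).
  rewrite -cA /padeA jacobi_det_comp; congr (\det _); apply/matrixP => i j; rewrite !mxE.
  by case: ifP => // _; rewrite comp_polyM -/(sh _) powE.
rewrite -cB /padeB jacobi_det_comp; congr (\det _); apply/matrixP => i j; rewrite !mxE.
by case: ifP => // _; rewrite -/(sh _) powE.
Qed.

End PadeRational.

(** * Simultaneous approximation *)

Section Distances.
Variable R : realType.
Implicit Types (A K : set (C R)) (z w : C R) (p : {poly C R}).

Lemma compact_dist A K : compact K -> K `&` closure A = set0 ->
  exists2 r : R, 0 < r & forall z w, closure A z -> K w -> r <= normc (z - w).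
Proof.
move=> /compact_near_coveringP cK KA.
pose P (d : R) w := forall z, closure A z -> d <= normc (z - w).
have : \forall d \near 0^'+, K `<=` P d.
  apply: cK => w Kw.
  have Aw : ~ closure A w by move=> Aw; have : (K `&` closure A) w by []; rewrite KA.
  have [d d0 hd] : exists2 d : R, 0 < d & forall z, closure A z -> d <= normc (z - w).
    apply: contrapT => h; apply: Aw; apply: (@closed_closure _ A); apply/closureCP => e e0.
    apply: contrapT => h'; apply: h; exists e => // z Az; rewrite leNgt; apply/negP => ze.
    by apply: h'; exists z.
  have d2 : 0 < d / 2 by lra.
  exists ([set v | normc (v - w) < d / 2], [set x | 0 < x < d / 2]).
    split; first by apply/nbhsCP; exists (d / 2).
    near=> x; apply/andP; split; first by near: x; exact: nbhs_right_gt.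
    by near: x; exact: nbhs_right_lt.
  move=> [v x] /= [vw /andP[x0 xd]] z Az.
  by have := normc_triangle v z w; have := hd z Az; lra.
move=> hK; near (0 : R)^'+ => d; exists d; first by near: d; exact: nbhs_right_gt.
by move=> z w Az Kw; have KP : K `<=` P d; [near: d|exact: (KP w Kw)].
Unshelve. all: by end_near. Qed.

Lemma compact_boundedC K : compact K -> exists2 r : R, 0 <= r & forall z, K z -> normc z <= r.
Proof.
move=> /compact_near_coveringP cK.
pose P (n : nat) w := normc w <= n%:R.
have [N _ /(_ N (leqnn N)) hN] : \forall n \near \oo, K `<=` P n.
  apply: cK => v _.
  exists ([set w : C R | normc (w - v) < 1], [set n | (Num.truncn (normc v + 1) < n)%N]).
    by split; [apply/nbhsCP; exists 1|exists (Num.truncn (normc v + 1)).+1].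
  move=> [w n] /= [fw nn]; rewrite /P.
  have := normc_triangle v w 0; rewrite !subr0 => h.
  have : normc v + 1 <= n%:R.
    by apply: ltW; apply: lt_le_trans (truncnS_gt _) _; rewrite ler_nat.
  lra.
by exists N%:R.
Qed.

Lemma horner_cvg p z : p.[w] @[w --> z] --> p.[z].
Proof. exact: is_derive_continuous (is_derive_horner p z). Qed.

Lemma compact_n1_lb K p q : compact K ->
  (forall z, K z -> (p.[z] != 0) || (q.[z] != 0)) ->
  exists2 c : R, 0 < c & forall z, K z -> c <= n1 p.[z] q.[z].
Proof.
move=> /compact_near_coveringP cK pq0.
pose P (d : R) w := d <= n1 p.[w] q.[w].
have : \forall d \near 0^'+, K `<=` P d.
  apply: cK => w /pq0/n1_gt0 h; set c := n1 _ _ in h.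
  have c4 : 0 < c / 4 by lra.
  have /cvg_atP/(_ _ c4)[d1 d10 h1] := @horner_cvg p w.
  have /cvg_atP/(_ _ c4)[d2 d20 h2] := @horner_cvg q w.
  exists ([set v | normc (v - w) < Num.min d1 d2], [set x | 0 < x < c / 4]).
    split; first by apply/nbhsCP; exists (Num.min d1 d2) => //; rewrite lt_min d10.
    near=> x; apply/andP; split; first by near: x; exact: nbhs_right_gt.
    by near: x; exact: nbhs_right_lt.
  move=> [v x] /=; rewrite lt_min => -[/andP[vw vw'] /andP[x0 xd]].
  have := h1 v vw; have := h2 v vw'; rewrite /P /n1.
  have := normc_lb p.[w] p.[v]; have := normc_lb q.[w] q.[v].
  rewrite (normc_sub p.[w] p.[v]) (normc_sub q.[w] q.[v]).
  by move: xd; rewrite /c /n1; lra.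
move=> hK; near (0 : R)^'+ => d; exists d; first by near: d; exact: nbhs_right_gt.
by move=> z Kz; have KP : K `<=` P d; [near: d|exact: (KP z Kz)].
Unshelve. all: by end_near. Qed.

(** The exponent is free above the size, so that several polynomials can share one. *)
Lemma poly_growth p : exists2 B : R, 0 <= B & forall n z, (size p <= n)%N ->
  normc p.[z] <= B * (1 + normc z) ^+ n.
Proof.
exists (\sum_(i < size p) normc p`_i); first by apply: sumr_ge0 => i _; exact: ge0_normc.
move=> n z pn; rewrite horner_coef mulr_suml; apply: le_trans (normc_sum _ _ _) _.
apply: ler_sum => i _; rewrite normc_mul normc_exp; apply: ler_wpM2l; first exact: ge0_normc.
have z0 := ge0_normc z.
apply: (@le_trans _ _ ((1 + normc z) ^+ i)).
  by rewrite lerXn2r ?nnegrE//; lra.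
by rewrite ler_weXn2l ?(leq_trans (ltnW (ltn_ord i)))//; lra.
Qed.

(** Leaves room for the discs of the Cauchy estimates around the points of the closure. *)
Definition thicken A (d : R) : set (C R) :=
  [set z | exists2 w, closure A w & normc (z - w) <= d].

(** The closure may be unbounded; the bound comes from factoring [p], because each of its finitely
    many roots has positive distance from the closed set. *)
Lemma poly_lb_thicken A p : p != 0 -> (forall z, closure A z -> p.[z] != 0) ->
  exists d : R, exists2 c : R, 0 < d & 0 < c /\ forall z, thicken A d z -> c <= normc p.[z].
Proof.
move=> p0 pA; have [s ps] := closed_field_poly_normal p.
have {}pA x : x \in s -> ~ closure A x.
  move=> xs /pA; rewrite ps hornerZ horner_prod (big_rem x)//= hornerXsubC subrr mul0r mulr0.
  by rewrite eqxx.
have [d [c d0 [c0 h]]] : exists d : R, exists2 c : R, 0 < d & 0 < c /\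
    forall z, thicken A d z -> c <= normc (\prod_(x <- s) (z - x)).
  elim: s pA {ps} => [|x s IH] pA.
    by exists 1, 1 => //; split=> // z _; rewrite big_nil normc1.
  have [d [c d0 [c0 h]]] : exists d : R, exists2 c : R, 0 < d & 0 < c /\
      forall z, thicken A d z -> c <= normc (\prod_(x <- s) (z - x)).
    by apply: IH => y ys; apply: pA; rewrite inE ys orbT.
  have [r r0 hr] : exists2 r : R, 0 < r & forall w, closure A w -> r <= normc (w - x).
    have nx : ~ closure A x by apply: pA; rewrite inE eqxx.
    apply: contrapT => g; apply: nx; apply: (@closed_closure _ A); apply/closureCP => e e0.
    apply: contrapT => g'; apply: g; exists e => // z Az; rewrite leNgt; apply/negP => ze.
    by apply: g'; exists z.
  exists (Num.min d (r / 2)), (r / 2 * c); first by rewrite lt_min d0; lra.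
  split=> [|z [w Aw]]; first by rewrite mulr_gt0//; lra.
  rewrite le_min => /andP[zd zr]; rewrite big_cons normc_mul.
  apply: ler_pM; [lra|exact: ltW| |by apply: h; exists w].
  by have := normc_triangle z w x; have := hr w Aw; rewrite (normc_sub w z); lra.
exists d, (normc (lead_coef p) * c) => //; split=> [|z /h hz].
  by rewrite mulr_gt0// normc_gt0 lead_coef_eq0.
rewrite {2}ps hornerZ horner_prod normc_mul; apply: ler_wpM2l; first exact: ge0_normc.
by under [X in normc X]eq_bigr do rewrite !hornerE.
Qed.

Lemma thickenS A (d d' : R) : d <= d' -> thicken A d `<=` thicken A d'.
Proof. by move=> dd z [w Aw zw]; exists w => //; exact: le_trans dd. Qed.

End Distances.

Section Approximation.
Variable R : realType.
Implicit Types (A K : set (C R)) (z w : C R).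

(** [s * eta] pays for the determinant and [2 * eta] for replacing (a, b) by (c, d) in the norm. *)
Lemma cross_lt (a b c d : C R) (s eta c0 : R) : 0 <= s -> 0 <= eta ->
  normc (a - c) <= eta -> normc (b - d) <= eta -> c0 <= n1 c d -> eta * (s + 2) < c0 ->
  s * cross a b c d < n1 a b * n1 c d.
Proof.
move=> s0 eta0 ac bd cd ec; have cd0 : 0 < n1 c d by nra.
have h1 : cross a b c d <= eta * n1 c d.
  rewrite /cross (_ : a * d - b * c = (a - c) * d + - ((b - d) * c)); last by ring.
  apply: le_trans (normc_le_add _ _) _; rewrite normc_opp !normc_mul /n1.
  have := ler_wpM2r (ge0_normc d) ac; have := ler_wpM2r (ge0_normc c) bd; lra.
have h2 : n1 c d - 2 * eta <= n1 a b.
  have := normc_lb c a; have := normc_lb d b; rewrite /n1 (normc_sub c a) (normc_sub d b); lra.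
have : s * cross a b c d <= s * eta * n1 c d by rewrite -mulrA ler_wpM2l.
move/le_lt_trans; apply; rewrite ltr_pM2r//; lra.
Qed.

Lemma cross_scale (l a b c d : C R) : cross (l * a) (l * b) c d = normc l * cross a b c d.
Proof. by rewrite /cross -!mulrA -mulrBr normc_mul. Qed.

Lemma n1_scale (l a b : C R) : n1 (l * a) (l * b) = normc l * n1 a b.
Proof. by rewrite /n1 !normc_mul mulrDr. Qed.

(* With u = U/V close to 0 on the thickened closure of A and to 1 on K, the
   pair ((1 - u) P + u H : (1 - u) Q + u G) interpolates P/Q and H/G. *)
Lemma interpolate A K (P Q H G : {poly C R}) :
  closure A !=set0 -> compact K -> K `&` closure A = set0 ->
  (forall z, closure A z -> Q.[z] != 0) ->
  exists2 d : R, 0 < d <= 1 & forall e1 e2 : R, 0 < e1 -> 0 < e2 ->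
  exists N D V : {poly C R},
    (forall z, thicken A d z -> [/\ Q.[z] != 0, D.[z] != 0 &
        normc (N.[z] / D.[z] - P.[z] / Q.[z]) <= e1]) /\
    (forall z, K z -> [/\ V.[z] != 0, normc (N.[z] / V.[z] - H.[z]) <= e2 &
        normc (D.[z] / V.[z] - G.[z]) <= e2]).
Proof.
move=> [a0 Aa0] cK KA QA.
have Q0 : Q != 0 by apply: contraTneq (QA a0 Aa0) => ->; rewrite horner0 eqxx.
have [rho rho0 hrho] := compact_dist cK KA.
have [R0 R00 hR0] := compact_boundedC cK.
have [d1 [c d10 [c0 hc]]] := poly_lb_thicken Q0 QA.
pose d := Num.min (Num.min 1 d1) (rho / 2).
have d0 : 0 < d by rewrite !lt_min ltr01 d10; lra.
have dd1 : d <= d1 by rewrite !ge_min lexx orbT.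
have d1' : d <= 1 by rewrite !ge_min lexx.
have drho : d <= rho / 2 by rewrite !ge_min lexx orbT.
exists d => [|e1 e2 e10 e20]; first by rewrite d0 d1'.
have [B1 B10 hB1] := poly_growth (G - Q).
have [B2 B20 hB2] := poly_growth (H * Q - G * P).
have [B3 B30 hB3] := poly_growth (P - H).
have [B4 B40 hB4] := poly_growth (Q - G).
have [n [n1' n2' n3' n4']] : exists n, [/\ (size (G - Q)%R <= n)%N,
    (size (H * Q - G * P)%R <= n)%N, (size (P - H)%R <= n)%N & (size (Q - G)%R <= n)%N].
  exists (maxn (maxn (size (G - Q)) (size (H * Q - G * P))) (maxn (size (P - H)) (size (Q - G)))).
  by rewrite !leq_max !leqnn !orbT.
pose BK := (B3 + B4) * (1 + R0) ^+ n.
have BK0 : 0 <= BK by rewrite mulr_ge0 ?addr_ge0// exprn_ge0//; lra.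
(* The three requirements keep the denominator [E] at least c / 2 in modulus, bound the difference
   of the quotients by [e1], and the deviations on [K] by [e2]. *)
have e_ex : exists2 e : R, 0 < e & [/\ e * B1 <= c / 2, e * B2 <= e1 * (c * c / 2) & e * BK <= e2].
  have cc : 0 < c * c by rewrite mulr_gt0.
  exists (Num.min (c / 2 / (B1 + 1)) (Num.min (e1 * (c * c / 2) / (B2 + 1)) (e2 / (BK + 1)))).
    by rewrite !lt_min !divr_gt0 ?mulr_gt0 ?divr_gt0//; lra.
  have key (x B : R) (y : R) : 0 <= B -> 0 < x -> y <= x / (B + 1) -> 0 < y -> y * B <= x.
    move=> B0 x0 yx y0; rewrite ler_pdivlMr in yx; last lra.
    by lra.
  have m0 : 0 < Num.min (c / 2 / (B1 + 1)) (Num.min (e1 * (c * c / 2) / (B2 + 1)) (e2 / (BK + 1))).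
    by rewrite !lt_min !divr_gt0 ?mulr_gt0 ?divr_gt0//; lra.
  split; apply: key => //; try (by rewrite ?mulr_gt0 ?divr_gt0//; lra).
  - by rewrite ge_min lexx.
  - by rewrite !ge_min lexx orbT.
  - by rewrite !ge_min lexx !orbT.
have [e e0 [eB1 eB2 eBK]] := e_ex.
have MK z w : thicken A d z -> K w -> rho / 2 <= normc (z - w).
  move=> [v Av zv] Kw; have := hrho v w Av Kw.
  by have := normc_triangle z v w; rewrite (normc_sub v z); lra.
have rho2 : 0 < rho / 2 by lra.
have [U [V [UM UK]]] := separation rho2 hR0 MK n e0.
exists ((V - U) * P + U * H), ((V - U) * Q + U * G), V; split=> z Sz.
- have [V0 uz] := UM z Sz; have Qz := hc z (thickenS dd1 Sz).
  have Qz0 : Q.[z] != 0 by rewrite -normc_gt0; lra.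
  set u := U.[z] / V.[z] in uz.
  have UE : U.[z] = u * V.[z] by rewrite /u divfK.
  pose E := Q.[z] + u * (G - Q).[z].
  have EE : ((V - U) * Q + U * G).[z] = V.[z] * E.
    by rewrite /E !hornerE UE; ring.
  have bnd (p : {poly C R}) (B : R) : 0 <= B -> (forall n z, (size p <= n)%N ->
      normc p.[z] <= B * (1 + normc z) ^+ n) -> (size p <= n)%N -> normc (u * p.[z]) <= e * B.
    move=> B0 hB pn; rewrite normc_mul.
    apply: (@le_trans _ _ (normc u * (B * (1 + normc z) ^+ n))).
      by apply: (ler_wpM2l (ge0_normc _)); exact: hB.
    by rewrite mulrCA mulrC; apply: ler_wpM2r.
  have b1 := bnd _ _ B10 hB1 n1'; have b2 := bnd _ _ B20 hB2 n2'.
  have Ec : c / 2 <= normc E.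
    have := normc_lb Q.[z] (- (u * (G - Q).[z])); rewrite opprK normc_opp -/E; lra.
  have E0 : E != 0 by rewrite -normc_gt0; lra.
  split=> //; first by rewrite EE mulf_neq0.
  have -> : ((V - U) * P + U * H).[z] / ((V - U) * Q + U * G).[z] - P.[z] / Q.[z] =
      u * (H * Q - G * P).[z] / (E * Q.[z]).
    rewrite EE; have -> : ((V - U) * P + U * H).[z] = V.[z] * (P.[z] + u * (H - P).[z]).
      by rewrite !hornerE UE; ring.
    have -> : V.[z] * (P.[z] + u * (H - P).[z]) / (V.[z] * E) - P.[z] / Q.[z] =
      ((P.[z] + u * (H - P).[z]) * Q.[z] - P.[z] * E) / (E * Q.[z]).
      by field; rewrite V0 E0 Qz0.
    by congr (_ / _); rewrite /E !hornerE; ring.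
  have EQ : c * c / 2 <= normc (E * Q.[z]).
    rewrite normc_mul (_ : c * c / 2 = c / 2 * c); last by ring.
    by apply: ler_pM Ec Qz; lra.
  have cc : 0 < c * c by rewrite mulr_gt0.
  rewrite normc_div ler_pdivrMr; last by lra.
  apply: le_trans b2 _; apply: le_trans eB2 _; exact: (ler_wpM2l (ltW e10)).
- have [V0 uz] := UK z Sz; set u := U.[z] / V.[z] in uz.
  have UE : U.[z] = u * V.[z] by rewrite /u divfK.
  have bnd (p : {poly C R}) (B : R) : 0 <= B -> (forall n z, (size p <= n)%N ->
      normc p.[z] <= B * (1 + normc z) ^+ n) -> (size p <= n)%N -> B <= B3 + B4 ->
      normc ((1 - u) * p.[z]) <= e2.
    move=> B0 hB pn BB; rewrite normc_mul normc_sub; apply: le_trans eBK.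
    apply: ler_pM; rewrite ?ge0_normc//; apply: le_trans (hB n z pn) _.
    apply: ler_pM => //; first by rewrite exprn_ge0//; have := ge0_normc z; lra.
    by rewrite lerXn2r ?nnegrE ?lerD2l ?hR0//; have := ge0_normc z; lra.
  split=> //.
  + have -> : ((V - U) * P + U * H).[z] / V.[z] - H.[z] = (1 - u) * (P - H).[z].
      by rewrite !hornerE UE; field.
    by apply: bnd B30 hB3 n3' _; rewrite lerDl.
  + have -> : ((V - U) * Q + U * G).[z] / V.[z] - G.[z] = (1 - u) * (Q - G).[z].
      by rewrite !hornerE UE; field.
    by apply: bnd B40 hB4 n4' _; rewrite lerDr.
Qed.

Lemma approximation_step (F : set (nat * nat)) A K (P Q H G : {poly C R}) (s : R) (m : nat) (e : R) :
  (exists p q : nat -> nat, [/\ forall n, F (p n, q n), p n @[n --> \oo] --> \oo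
         & q n @[n --> \oo] --> \oo]) ->
  closure A !=set0 -> compact K -> K `&` closure A = set0 ->
  (forall z, closure A z -> Q.[z] != 0) ->
  (forall z, K z -> (H.[z] != 0) || (G.[z] != 0)) ->
  0 <= s -> 0 < e ->
  exists P' Q' : {poly C R}, exists p q : nat,
    [/\ F (p, q), coprimep P' Q', size P' = p.+1 /\ (size Q' <= q.+1)%N,
      forall z, closure A z -> Q'.[z] != 0 &
      (forall l z, (l <= m)%N -> closure A z -> normc z <= m%:R ->
        normc (derive1n l (fun w => P'.[w] / Q'.[w]) z -
               derive1n l (fun w => P.[w] / Q.[w]) z) <= e) /\
      (forall z, K z -> s * cross P'.[z] Q'.[z] H.[z] G.[z] <
                        n1 P'.[z] Q'.[z] * n1 H.[z] G.[z])].
Proof.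
move=> [pn [qn [Fpq ptop qtop]]] A0 cK KA QA HG s0 e0; have [a0 Aa0] := A0.
have [d /andP[d0 d1] hint] := @interpolate A K P Q H G A0 cK KA QA.
have [c0 c00 hc0] := compact_n1_lb cK HG.
have [R0 R00 hR0] := compact_boundedC cK.
have [BG BG0 hBG] := poly_growth G.
(* Both the interpolation and the correction of the numerator may cost [eta], so it is [2 * eta]
   that has to satisfy the condition of [cross_lt]. *)
pose eta := c0 / (4 * (s + 3)).
have eta0 : 0 < eta by rewrite divr_gt0// mulr_gt0//; lra.
have etac : 2 * eta * (s + 2) < c0.
  rewrite /eta; have -> : 2 * (c0 / (4 * (s + 3))) * (s + 2) = c0 * (s + 2) / (2 * (s + 3)).
    by field; rewrite gt_eqF//; lra.
  rewrite ltr_pdivrMr; last by rewrite mulr_gt0//; lra.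
  by rewrite ltr_pM2l//; lra.
(* A Cauchy constant for all orders up to [m] at once, 4 / d being at least 1. *)
pose Ce : R := m`!%:R * (4 / d) ^+ m.+1.
have d4 : 1 <= 4 / d by rewrite ler_pdivlMr//; lra.
have Ce0 : 0 < Ce by rewrite mulr_gt0 ?ltr0n ?fact_gt0// exprn_gt0//; lra.
have d40 : 0 <= 4 / d := le_trans ler01 d4.
pose e1 := e / Ce / 2; have e10 : 0 < e1 by rewrite !divr_gt0.
have e1Ce : e1 * Ce * 2 = e by rewrite /e1; field; rewrite gt_eqF.
have CeE : Ce = m`!%:R * (4 / d) ^+ m.+1 by [].
clearbody e1 Ce eta.
have [N [D [V [hA hK]]]] := hint e1 eta e10 eta0.
have inA z : closure A z -> thicken A d z.
  by move=> Az; exists z => //; rewrite subrr normc0 ltW.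
have D0 : D != 0.
  have [_ Da _] := hA a0 (inA a0 Aa0).
  by apply: contraNneq Da => ->; rewrite horner0.
pose g := gcdp N D; pose P1 := N %/ g; pose Q1 := D %/ g.
have g0 : g != 0 by rewrite gcdp_eq0 negb_and D0 orbT.
have NE : N = P1 * g by rewrite divpK ?dvdp_gcdl.
have DE : D = Q1 * g by rewrite divpK ?dvdp_gcdr.
have cop : coprimep P1 Q1 by rewrite coprimep_div_gcd// D0 orbT.
have Q10 : Q1 != 0 by apply: contraNneq D0 => Q10; rewrite DE Q10 mul0r.
have [n [Fn nP nQ]] : exists n, [/\ F (pn n, qn n), (size P1 + size Q1 < pn n)%N &
    (size Q1 <= qn n)%N].
  have hp : \forall n \near \oo, (size P1 + size Q1 < pn n)%N.
    by apply: (ptop [set k | (size P1 + size Q1 < k)%N]); exists (size P1 + size Q1).+1.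
  have hq : \forall n \near \oo, (size Q1 <= qn n)%N.
    by apply: (qtop [set k | (size Q1 <= k)%N]); exists (size Q1).
  near \oo => n; exists n; split => //; near: n => //.
move: (pn n) (qn n) Fn nP nQ => p q Fn nP nQ {n}.
have sQ1 : (0 < size Q1)%N by rewrite size_poly_gt0.
(* ['X^T * Q1] has degree exactly p, above that of [P1], so the corrected numerator has degree p;
   adding a multiple of [Q1] keeps it coprime to [Q1]. *)
have [T hT] : exists T, (T + size Q1 = p.+1)%N.
  exists (p.+1 - size Q1)%N.
  by rewrite subnK// leqW// (leq_trans (leq_addl _ _) (ltnW nP)).
(* Covers [K] and the discs of radius d <= 1 around points with |z| <= m; beyond it the correction t
   z^T may be large, which the seminorms up to [m] do not see. *)
pose Rm : R := m%:R + 2 + R0.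
have Rm1 : 1 <= Rm by rewrite /Rm; have : 0 <= m%:R :> R by []; lra.
have RT0 : 0 < Rm ^+ T by rewrite exprn_gt0//; lra.
pose BK := BG * (1 + R0) ^+ size G + eta.
have BK0 : 0 < BK.
  by rewrite ltr_wpDl// mulr_ge0// exprn_ge0// addr_ge0.
have BKE : BK = BG * (1 + R0) ^+ size G + eta by [].
clearbody BK.
have Rm0 : 0 <= Rm by lra.
have RmE : Rm = m%:R + 2 + R0 by [].
clearbody Rm.
(* The correction changes the quotient by t z^T, but on [K] it changes the first homogeneous
   coordinate by t z^T times the second, whence the bound [BK] on the latter. *)
pose t := Num.min (e1 / Rm ^+ T) (eta / (Rm ^+ T * BK)).
have t0 : 0 < t by rewrite lt_min !divr_gt0// mulr_gt0.
have te1 : t * Rm ^+ T <= e1 by rewrite -ler_pdivlMr// ge_min lexx.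
have teta : t * Rm ^+ T * BK <= eta.
  by rewrite -mulrA -ler_pdivlMr ?mulr_gt0// ge_min lexx orbT.
have zT z : normc z <= Rm -> normc (rc t * z ^+ T) <= t * Rm ^+ T.
  move=> zR; rewrite normc_mul normc_rc gtr0_norm// normc_exp ler_pM2l//.
  by rewrite lerXn2r ?nnegrE ?ge0_normc.
clearbody t.
pose P2 := P1 + (rc t *: 'X^T) * Q1.
have rt0 : rc t != 0 by rewrite -normc_gt0 normc_rc normr_gt0 gt_eqF.
have sP2 : size P2 = p.+1.
  have sX : size ((rc t *: 'X^T) * Q1) = p.+1.
    by rewrite -scalerAl size_scale// mulrC size_mulXn.
  by rewrite /P2 addrC size_polyDl sX// ltnS (leq_trans (leq_addr _ _) (ltnW nP)).
have Qthick z : thicken A d z -> Q1.[z] != 0.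
  move=> /hA[_ Dz _]; apply: contraNneq Dz => Q1z.
  by rewrite DE hornerM Q1z mul0r.
exists P2, Q1, p, q; split=> //.
- by rewrite coprimep_sym /P2 addrC coprimep_addl_mul coprimep_sym.
- by split => //; exact: leqW.
- by move=> z /inA; exact: Qthick.
split.
- move=> l z lm Az zm.
  pose W := [set z : C R | Q1.[z] != 0] `&` [set z : C R | Q.[z] != 0].
  have oW : open W by apply: openI; exact: open_nonroot.
  have [s1 _] := quot_smooth P2 Q1; have [s2 _] := quot_smooth P Q.
  have sW1 : smooth_on W (fun w => P2.[w] / Q1.[w]) by move=> k w [w1 _]; exact: s1.
  have sW2 : smooth_on W (fun w => P.[w] / Q.[w]) by move=> k w [_ w2]; exact: s2.
  have [sB dB] := smoothB oW sW1 sW2.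
  have zW v : normc (v - z) <= d -> W v.
    move=> vz; have tv : thicken A d v by exists z.
    by split; [exact: Qthick|have [] := hA v tv].
  rewrite -dB; last by apply: zW; rewrite subrr normc0 ltW.
  have bound v : normc (v - z) <= d ->
      normc (((fun w => P2.[w] / Q1.[w]) \- (fun w => P.[w] / Q.[w])) v) <= 2 * e1.
    move=> vz; have tv : thicken A d v by exists z.
    have [Qv Dv hv] := hA v tv; have Q1v := Qthick v tv.
    have gv : g.[v] != 0.
      by apply: contraNneq Dv => gv; rewrite DE hornerM gv mulr0.
    have -> : ((fun w => P2.[w] / Q1.[w]) \- (fun w => P.[w] / Q.[w])) v =
        (N.[v] / D.[v] - P.[v] / Q.[v]) + rc t * v ^+ T :> C R.
      rewrite /= /P2 {1}NE {1}DE !(hornerD, hornerM, hornerZ, hornerXn).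
      by field; rewrite gv Q1v Qv.
    apply: le_trans (normc_le_add _ _) _.
    have vR : normc v <= Rm.
      have := normc_triangle z v 0; rewrite !subr0 RmE.
      by clear -vz zm d1 R00; lra.
    by have := zT v vR; clear -hv te1; lra.
  apply: le_trans (cauchy_estimate l oW sB d0 zW bound) _.
  have le1 : l`!%:R * (4 / d) ^+ l.+1 <= Ce.
    rewrite CeE; apply: ler_pM; [exact: ler0n|exact: exprn_ge0| |exact: ler_weXn2l].
    by rewrite ler_nat leq_fact.
  have l0 : 0 <= l`!%:R * (4 / d) ^+ l.+1.
    by apply: mulr_ge0; [exact: ler0n|exact: exprn_ge0].
  apply: (@le_trans _ _ (2 * e1 * (l`!%:R * (4 / d) ^+ l.+1) * 1)).
    rewrite -!mulrA; apply: ler_wpM2l => //; apply: ler_wpM2l; first exact: ltW.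
    by rewrite !mulrA; apply: ler_wpM2l.
  rewrite mulr1 -e1Ce (_ : e1 * Ce * 2 = 2 * e1 * Ce); last by ring.
  by rewrite ler_pM2l// mulr_gt0.
- clear CeE hA hint; move=> z Kz; have [V0 hN hD] := hK z Kz; have c0z := hc0 z Kz.
  pose b := D.[z] / V.[z]; pose a := N.[z] / V.[z] + rc t * z ^+ T * b.
  have nb : normc b <= BK.
    rewrite BKE; have h1 := normc_le_add (b - G.[z]) G.[z]; rewrite subrK in h1.
    have h2 := hBG (size G) z (leqnn _).
    have zz : 1 + normc z <= 1 + R0 by rewrite lerD2l hR0.
    have z10 : 0 <= 1 + normc z by rewrite addr_ge0// ge0_normc.
    have h3 : BG * (1 + normc z) ^+ size G <= BG * (1 + R0) ^+ size G.
      by apply: ler_wpM2l => //; rewrite lerXn2r ?nnegrE// (le_trans z10 zz).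
    by clear -hD h1 h2 h3; rewrite -/b in hD; lra.
  have zR : normc z <= Rm.
    rewrite RmE; apply: (le_trans (hR0 z Kz)); rewrite lerDr.
    by apply: addr_ge0; exact: ler0n.
  have ha : normc (a - H.[z]) <= 2 * eta.
    have -> : a - H.[z] = (N.[z] / V.[z] - H.[z]) + rc t * z ^+ T * b by rewrite /a; ring.
    apply: le_trans (normc_le_add _ _) _; rewrite normc_mul.
    have : normc (rc t * z ^+ T) * normc b <= t * Rm ^+ T * BK.
      by apply: ler_pM; rewrite ?ge0_normc ?zT.
    by clear -hN teta; lra.
  have hb : normc (b - G.[z]) <= 2 * eta by clear -hD eta0; rewrite /b; lra.
  have eta20 : 0 <= 2 * eta by clear -eta0; lra.
  have main := cross_lt s0 eta20 ha hb c0z etac.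
  have E1 : V.[z] * a = g.[z] * P2.[z].
    rewrite /a /b /P2 NE DE !(hornerD, hornerM, hornerZ, hornerXn).
    by field.
  have E2 : V.[z] * b = g.[z] * Q1.[z].
    by rewrite /b mulrC divfK// DE hornerM mulrC.
  have Vp : 0 < normc V.[z] by rewrite normc_gt0.
  (* A zero of the cancelled factor on [K] would make both coordinates vanish, against the strict
     inequality just obtained. *)
  have gz : g.[z] != 0.
    apply/eqP => gz.
    have a00 : a = 0 by apply: (mulfI V0); rewrite mulr0 E1 gz mul0r.
    have b00 : b = 0 by apply: (mulfI V0); rewrite mulr0 E2 gz mul0r.
    move: main; rewrite /n1 a00 b00 normc0 addr0 mul0r ltNge mulr_ge0//.
    by rewrite /cross ge0_normc.
  have gp : 0 < normc g.[z] by rewrite normc_gt0.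
  rewrite -(ltr_pM2l gp) mulrCA -cross_scale mulrA -n1_scale -E1 -E2.
  by rewrite cross_scale n1_scale -mulrA mulrCA ltr_pM2l.
Unshelve. all: by end_near. Qed.

End Approximation.

(** * Openness *)

Section PolynomialLimits.
Variables (R : realType) (Y : Type) (G : set_system Y).
Context {FG : Filter G}.
Implicit Types (P Q : Y -> {poly C R}) (A B : {poly C R}).

(** The common degree bound gives sums over coefficients a fixed range, so evaluation passes to the
    limit, at moving points as well. *)
Definition pcvg P A : Prop :=
  (exists n, forall y, (size (P y) <= n)%N) /\
  (forall i, (P y)`_i @[y --> G] --> A`_i).

Lemma cvg_sumC (I : Type) (r : seq I) (f : I -> Y -> C R) (a : I -> C R) :
  (forall i, f i y @[y --> G] --> a i) ->
  \sum_(i <- r) f i y @[y --> G] --> \sum_(i <- r) a i.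
Proof.
move=> h; elim: r => [|i r IH].
  by rewrite big_nil; under eq_fun do rewrite big_nil; exact: cvg_cst.
rewrite big_cons; under eq_fun do rewrite big_cons; exact: cvgD (h i) IH.
Qed.

Lemma pcvg_cst A : pcvg (fun=> A) A.
Proof. by split=> [|i]; [exists (size A)|exact: cvg_cst]. Qed.

Lemma pcvgC (c : Y -> C R) (a : C R) : c y @[y --> G] --> a ->
  pcvg (fun y => (c y)%:P) a%:P.
Proof.
move=> ca; split=> [|i]; first by exists 1%N => y; exact: size_polyC_leq1.
rewrite coefC; under eq_fun do rewrite coefC.
by case: eqP => _; [exact: ca|exact: cvg_cst].
Qed.

Lemma pcvgD P Q A B : pcvg P A -> pcvg Q B -> pcvg (fun y => P y + Q y) (A + B).
Proof.
move=> [[n hn] PA] [[m hm] QB]; split=> [|i].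
  exists (maxn n m) => y; apply: (leq_trans (size_polyD _ _)).
  by rewrite geq_max !leq_max hn hm orbT.
by rewrite coefD; under eq_fun do rewrite coefD; exact: cvgD (PA i) (QB i).
Qed.

Lemma pcvgM P Q A B : pcvg P A -> pcvg Q B -> pcvg (fun y => P y * Q y) (A * B).
Proof.
move=> [[n hn] PA] [[m hm] QB]; split=> [|i].
  exists (n + m)%N => y; apply: (leq_trans (size_polyMleq _ _)).
  by apply: (leq_trans (leq_pred _)); rewrite leq_add.
rewrite coefM; under eq_fun do rewrite coefM.
by apply: cvg_sumC => j; exact: cvgM (PA j) (QB (i - j)%N).
Qed.

Lemma pcvgN P A : pcvg P A -> pcvg (fun y => - P y) (- A).
Proof.
move=> PA; rewrite -mulN1r; under eq_fun do rewrite -mulN1r.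
exact: pcvgM (pcvg_cst _) PA.
Qed.

Lemma pcvgX P A n : pcvg P A -> pcvg (fun y => P y ^+ n) (A ^+ n).
Proof.
move=> PA; elim: n => [|n IH]; first exact: pcvg_cst.
rewrite exprS; under eq_fun do rewrite exprS; exact: (pcvgM PA IH).
Qed.

Lemma pcvgZ (c : Y -> C R) (a : C R) P A : c y @[y --> G] --> a -> pcvg P A ->
  pcvg (fun y => c y *: P y) (a *: A).
Proof.
move=> /pcvgC ca PA; rewrite -mul_polyC; under eq_fun do rewrite -mul_polyC.
exact: (pcvgM ca PA).
Qed.

Lemma pcvg_sum (I : Type) (r : seq I) (P : I -> Y -> {poly C R}) (A : I -> {poly C R}) :
  (forall i, pcvg (P i) (A i)) -> pcvg (fun y => \sum_(i <- r) P i y) (\sum_(i <- r) A i).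
Proof.
move=> h; elim: r => [|i r IH].
  by rewrite big_nil; under eq_fun do rewrite big_nil; exact: pcvg_cst.
rewrite big_cons; under eq_fun do rewrite big_cons; exact: (pcvgD (h i) IH).
Qed.

Lemma pcvg_prod (I : Type) (r : seq I) (P : I -> Y -> {poly C R}) (A : I -> {poly C R}) :
  (forall i, pcvg (P i) (A i)) -> pcvg (fun y => \prod_(i <- r) P i y) (\prod_(i <- r) A i).
Proof.
move=> h; elim: r => [|i r IH].
  by rewrite big_nil; under eq_fun do rewrite big_nil; exact: pcvg_cst.
rewrite big_cons; under eq_fun do rewrite big_cons; exact: (pcvgM (h i) IH).
Qed.

Lemma pcvg_det n (M : Y -> 'M[{poly C R}]_n) (N : 'M[{poly C R}]_n) :
  (forall i j, pcvg (fun y => M y i j) (N i j)) -> pcvg (fun y => \det (M y)) (\det N).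
Proof.
by move=> h; apply: pcvg_sum => s; apply: pcvgM; [exact: pcvg_cst|apply: pcvg_prod => i].
Qed.

Lemma pcvg_deriv P A : pcvg P A -> pcvg (fun y => deriv (P y)) (deriv A).
Proof.
move=> [[n hn] PA]; split=> [|i].
  by exists n => y; apply: leq_trans (size_poly _ _) (leq_trans (leq_pred _) (hn y)).
rewrite coef_deriv -mulr_natl; under eq_fun do rewrite coef_deriv -mulr_natl.
by apply: cvgM; [exact: cvg_cst|exact: PA].
Qed.

Lemma pcvg_horner P A (c : Y -> C R) (a : C R) : pcvg P A -> c y @[y --> G] --> a ->
  (P y).[c y] @[y --> G] --> A.[a].
Proof.
move=> [[n hn] PA] ca.
have [m [nm Am]] : exists m, (n <= m)%N /\ (size A <= m)%N.
  by exists (maxn n (size A)); split; [exact: leq_maxl|exact: leq_maxr].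
rewrite (horner_coef_wide a Am).
have -> : (fun y => (P y).[c y]) = (fun y => \sum_(i < m) (P y)`_i * c y ^+ i).
  by apply/funext => y; apply: horner_coef_wide; exact: leq_trans (hn y) nm.
apply: cvg_sumC => i; apply: cvgM; first exact: PA.
elim: (nat_of_ord i) => [|k IH]; first exact: cvg_cst.
rewrite exprS; under eq_fun do rewrite exprS; exact: (cvgM ca IH).
Qed.

Lemma pcvg_quot_num P Q A B l : pcvg P A -> pcvg Q B ->
  pcvg (fun y => quot_num (P y) (Q y) l) (quot_num A B l).
Proof.
move=> PA QB; elim: l => [|l IH]; first exact: PA.
apply: (pcvgD (pcvgM (pcvg_deriv IH) QB)).
by apply: pcvgN; apply: pcvgZ (cvg_cst _) (pcvgM IH (pcvg_deriv QB)).
Qed.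

Lemma cvg_normc (c : Y -> C R) (a : C R) : c y @[y --> G] --> a ->
  normc (c y) @[y --> G] --> normc a.
Proof.
move=> /cvgCP h; apply/cvgrPdistC_lt => e /h; apply: filterS => y hy.
rewrite ltr_norml; have := normc_lb (c y) a; have := normc_lb a (c y).
by rewrite (normc_sub a); lra.
Qed.

Lemma cvg_lt (u v : Y -> R) (a b : R) : u y @[y --> G] --> a -> v y @[y --> G] --> b ->
  a < b -> \forall y \near G, u y < v y.
Proof.
move=> /cvgrPdistC_lt ua /cvgrPdistC_lt vb ab.
have e0 : 0 < (b - a) / 2 by lra.
apply: filterS2 (ua _ e0) (vb _ e0) => y.
by rewrite !ltr_norml => /andP[? ?] /andP[? ?]; lra.
Qed.

Variables (Omega : set (C R)) (g : Y -> C R -> C R) (f : C R -> C R).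
Variables (zt : Y -> C R) (zeta : C R) (p q : nat).
Hypothesis gf : forall l, extD Omega (g y) l (zt y) @[y --> G] --> extD Omega f l zeta.
Hypothesis ztz : zt y @[y --> G] --> zeta.

Let cvg_taylor_coef n :
  taylor_coef Omega (g y) (zt y) n @[y --> G] --> taylor_coef Omega f zeta n.
Proof.
case: n => [n|n]; last exact: (@cvg_cst _ (0 : C R) _ G FG).
by apply: cvgM; [exact: gf|exact: cvg_cst].
Qed.

Let pcvg_XsubC : pcvg (fun y => 'X - (zt y)%:P) ('X - zeta%:P).
Proof. by apply: pcvgD; [exact: pcvg_cst|apply: pcvgN; exact: pcvgC]. Qed.

Let pcvg_taylor_poly k :
  pcvg (fun y => taylor_poly Omega (g y) (zt y) k) (taylor_poly Omega f zeta k).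
Proof.
case: k => [k|k]; last exact: pcvg_cst.
apply: pcvg_sum => i; apply: pcvgZ; last by apply: pcvgX; exact: pcvg_XsubC.
exact: (@cvg_taylor_coef (Posz i)).
Qed.

Let pcvg_jacobi (r : Y -> 'I_q.+1 -> {poly C R}) (r0 : 'I_q.+1 -> {poly C R}) :
  (forall j, pcvg (fun y => r y j) (r0 j)) ->
  pcvg (fun y => jacobi_det Omega (g y) p (zt y) (r y)) (jacobi_det Omega f p zeta r0).
Proof.
move=> rr; apply: pcvg_det => i j; rewrite mxE; under eq_fun do rewrite mxE.
case: ifP => _; first exact: (rr j).
by apply: pcvgC; exact: (@cvg_taylor_coef (_ : int)).
Qed.

Lemma pcvg_padeA :
  pcvg (fun y => padeA Omega (g y) p q (zt y)) (padeA Omega f p q zeta).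
Proof.
by apply: pcvg_jacobi => j; apply: (pcvgM (pcvgX _ pcvg_XsubC)); exact: pcvg_taylor_poly.
Qed.

Lemma pcvg_padeB :
  pcvg (fun y => padeB Omega (g y) p q (zt y)) (padeB Omega f p q zeta).
Proof. by apply: pcvg_jacobi => j; exact: (pcvgX _ pcvg_XsubC). Qed.

Lemma cvg_hankel_det :
  \det (hankel Omega (g y) p q (zt y)) @[y --> G] --> \det (hankel Omega f p q zeta).
Proof.
(* The matrix is lifted to constant polynomials to reuse [pcvg_det]; the coefficient of order 0
   brings the limit back. *)
have [_ /(_ 0%N)] : pcvg (fun y => \det (map_mx polyC (hankel Omega (g y) p q (zt y))))
    (\det (map_mx polyC (hankel Omega f p q zeta))).
  apply: pcvg_det => i j; rewrite !mxE; under eq_fun do rewrite !mxE.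
  by apply: pcvgC; exact: (@cvg_taylor_coef (_ : int)).
rewrite det_map_mx coefC eqxx; under eq_fun do rewrite det_map_mx coefC eqxx.
exact.
Qed.

End PolynomialLimits.

(** * Stability of the approximation inequalities *)

Section Stage.
Variables (R : realType) (Omega L Delta K : set (C R)).
Hypothesis oO : open Omega.
Hypothesis LO : L `<=` closure Omega.
Hypothesis DO : Delta `<=` closure Omega.
Hypothesis cL : compact L.
Hypothesis cD : compact Delta.
Hypothesis cK : compact K.
Implicit Types (f g : Ainf Omega) (z w zeta : C R).

Lemma nbhs_ball (f : Ainf Omega) m (e : R) : 0 < e -> nbhs f [set g : Ainf Omega | within_ball Omega m e f g].
Proof.
(* The ball is given by weak inequalities; the union of the smaller balls about [f] is open and
   contains [f]. *)
move=> e0; pose U : set (Ainf Omega) := [set g : Ainf Omega | exists2 d, d < e & within_ball Omega m d f g].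
have oU : open U.
  apply: ball_Aopen => // g [d de gd]; exists m, ((e - d) / 2); first by lra.
  move=> h gh; exists (d + (e - d) / 2); first by lra.
  move=> l z lm cz zm; have := gh l z lm cz zm; have := gd l z lm cz zm.
  have := normc_triangle (extD Omega g l z) (extD Omega h l z) (extD Omega f l z); lra.
have Uf : U f by exists 0 => // l z _ _ _; rewrite subrr normc0.
apply: filterS (open_nbhs_nbhs (conj oU Uf)) => g [d de gd] l z lm cz zm.
by apply: le_trans (gd l z lm cz zm) _; exact: ltW.
Qed.

(** Joint continuity in the function and the point: [m] is so large that the moving point eventually
    lies in the disc where [within_ball] controls order [l]. *)
Lemma extD_cvg (Y : Type) (G : set_system Y) (FG : Filter G) (g : Y -> Ainf Omega)
    (zt : Y -> C R) (f : Ainf Omega) zeta l :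
  g y @[y --> G] --> f -> zt y @[y --> G] --> zeta -> closure Omega zeta ->
  (\forall y \near G, closure Omega (zt y)) ->
  extD Omega (g y) l (zt y) @[y --> G] --> extD Omega f l zeta.
Proof.
move=> gf zz cz czt; apply/cvgCP => e e0; have e2 : 0 < e / 2 by lra.
have [d d0 hd] := extD_within f l cz e2.
pose m := maxn l (Num.truncn (normc zeta + 1)).+1.
have B := gf _ (nbhs_ball f m e2).
have lm : (l <= m)%N by rewrite leq_max leqnn.
have zm : normc zeta + 1 <= m%:R.
  by apply: ltW; apply: lt_le_trans (truncnS_gt _) _; rewrite ler_nat leq_max leqnn orbT.
have m0 : 0 < Num.min d 1 by rewrite lt_min d0 ltr01.
move/cvgCP : zz => /(_ _ m0) zz.
near=> y.
have By : within_ball Omega m (e / 2) f (g y) by near: y.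
have cy : closure Omega (zt y) by near: y.
have : normc (zt y - zeta) < Num.min d 1 by near: y.
rewrite lt_min => /andP[zd z1].
have ym : normc (zt y) <= m%:R.
  by have := normc_triangle zeta (zt y) 0; rewrite !subr0; lra.
have := By l (zt y) lm cy ym; have := hd (zt y) cy zd.
have := normc_triangle (extD Omega f l (zt y)) (extD Omega (g y) l (zt y)) (extD Omega f l zeta).
lra.
Unshelve. all: by end_near. Qed.

Section Conditions.
Variables (H G : {poly C R}) (s p q : nat).

(* Both error bounds are cleared of denominators: these strict inequalities make
   sense, and are open in (g, zeta, z), also where B vanishes. *)
Definition good_D (g : C R -> C R) zeta : Prop := \det (hankel Omega g p q zeta) != 0.

Definition good_Delta (g : C R -> C R) (x : C R * C R) : Prop :=
  forall l, (l <= s)%N ->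
    let A := padeA Omega g p q x.1 in let B := padeB Omega g p q x.1 in
    s%:R * normc ((quot_num A B l).[x.2] - B.[x.2] ^+ l.+1 * extD Omega g l x.2)
      < normc (B.[x.2] ^+ l.+1).

Definition good_K (g : C R -> C R) (x : C R * C R) : Prop :=
  let A := padeA Omega g p q x.1 in let B := padeB Omega g p q x.1 in
  s%:R * cross A.[x.2] B.[x.2] H.[x.2] G.[x.2] < n1 A.[x.2] B.[x.2] * n1 H.[x.2] G.[x.2].

Definition good (g : C R -> C R) : Prop :=
  [/\ forall zeta, L zeta -> good_D g zeta,
      forall x, (L `*` Delta) x -> good_Delta g x
    & forall x, (L `*` K) x -> good_K g x].

(** Tube lemma. Nearby points are restricted to [X], because the extended derivatives mean nothing
    off the closure. *)
Let near_compact (T : topologicalType) (X : set T) (f : Ainf Omega)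
    (P : Ainf Omega -> T -> Prop) : compact X ->
  (forall x, X x -> \forall y \near within [set y | X y.1] (filter_prod (nbhs x) (nbhs f)), P y.2 y.1) ->
  \forall g \near nbhs f, forall x, X x -> P g x.
Proof.
move=> /compact_near_coveringP/near_covering_withinP cX h.
have := cX _ (nbhs f) P _ => /(_ _).
apply => x Xx; have := h x Xx; rewrite near_withinE.
exact.
Qed.

Lemma open_good : open [set g : Ainf Omega | good g].
Proof.
rewrite openE => f [fD fDelta fK].
have near1 : nbhs f [set g : Ainf Omega | forall zeta, L zeta -> good_D g zeta].
  apply: (near_compact (P := fun g => good_D g)) cL _ => zeta Lz.
  set GG := within _ _; have FG : Filter GG by exact: within_filter.
  have cg : y.2 @[y --> GG] --> f by apply: cvg_within_filter; exact: cvg_snd.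
  have cz : y.1 @[y --> GG] --> zeta by apply: cvg_within_filter; exact: cvg_fst.
  have ce l : extD Omega (Afun y.2) l y.1 @[y --> GG] --> extD Omega f l zeta.
    have N : \forall y \near GG, closure Omega y.1 by rewrite near_withinE; apply: nearW => y; exact: LO.
    exact: (@extD_cvg _ GG FG (fun y => y.2) (fun y => y.1) f zeta l cg cz (LO Lz) N).
  have := cvg_lt (FG := FG) (@cvg_cst _ (0 : R) _ GG FG) (cvg_normc (FG := FG) (cvg_hankel_det (FG := FG) (p := p) (q := q) ce)).
  rewrite normc_gt0 => /(_ (fD zeta Lz)); apply: filterS => y.
  by rewrite normc_gt0.
have two (X : set (C R)) (x : C R * C R) : (L `*` X) x ->
  let GG := within [set y | (L `*` X) y.1] (filter_prod (nbhs x) (nbhs f)) in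
  [/\ pcvg GG (fun y => padeA Omega (Afun y.2) p q y.1.1) (padeA Omega f p q x.1),
     pcvg GG (fun y => padeB Omega (Afun y.2) p q y.1.1) (padeB Omega f p q x.1),
     y.1.2 @[y --> GG] --> x.2 & y.2 @[y --> GG] --> f].
  move=> [Lx Xx] GG; have FG : Filter GG by exact: within_filter.
  have cg : y.2 @[y --> GG] --> f by apply: cvg_within_filter; exact: cvg_snd.
  have cx : y.1 @[y --> GG] --> x by apply: cvg_within_filter; exact: cvg_fst.
  have c1 : y.1.1 @[y --> GG] --> x.1 by apply: cvg_comp cx _; exact: cvg_fst.
  have c2 : y.1.2 @[y --> GG] --> x.2 by apply: cvg_comp cx _; exact: cvg_snd.
  have ce l : extD Omega (Afun y.2) l y.1.1 @[y --> GG] --> extD Omega f l x.1.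
    have N : \forall y \near GG, closure Omega y.1.1 by rewrite near_withinE; apply: nearW => y [/LO].
    exact: (@extD_cvg _ GG FG (fun y => y.2) (fun y => y.1.1) f x.1 l cg c1 (LO Lx) N).
  split.
  - exact: (@pcvg_padeA _ _ GG FG Omega (fun y => Afun y.2) f (fun y => y.1.1) x.1 p q ce c1).
  - exact: (@pcvg_padeB _ _ GG FG Omega (fun y => Afun y.2) f (fun y => y.1.1) x.1 p q ce c1).
  - exact: c2.
  - exact: cg.
have near2 : nbhs f [set g : Ainf Omega | forall x, (L `*` Delta) x -> good_Delta g x].
  apply: (near_compact (P := fun g => good_Delta g)) (compact_setX cL cD) _ => x LDx.
  have := two Delta x LDx; set GG := within _ _ => -[cA cB cz cg].
  have FG : Filter GG by exact: within_filter.
  have [_ Dx2] := LDx.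
  have cl l : \forall y \near GG, (l <= s)%N ->
    s%:R * normc ((quot_num (padeA Omega (Afun y.2) p q y.1.1) (padeB Omega (Afun y.2) p q y.1.1) l).[y.1.2] -
        (padeB Omega (Afun y.2) p q y.1.1).[y.1.2] ^+ l.+1 * extD Omega (Afun y.2) l y.1.2)
      < normc ((padeB Omega (Afun y.2) p q y.1.1).[y.1.2] ^+ l.+1).
    have [ls|sl] := leqP l s; last by apply: nearW.
    have ce : extD Omega (Afun y.2) l y.1.2 @[y --> GG] --> extD Omega f l x.2.
      have N : \forall y \near GG, closure Omega y.1.2 by rewrite near_withinE; apply: nearW => y [_ /DO].
      exact: (@extD_cvg _ GG FG (fun y => y.2) (fun y => y.1.2) f x.2 l cg cz (DO Dx2) N).
    have cBz := pcvg_horner (FG := FG) (pcvgX (FG := FG) l.+1 cB) cz.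
    have cQ := pcvg_horner (FG := FG) (pcvg_quot_num (FG := FG) l cA cB) cz.
    have cN := cvg_normc (FG := FG) cBz.
    have cM := cvg_normc (FG := FG) (cvgB (FF := FG) cQ (cvgM (FF := FG) cBz ce)).
    have := cvg_lt (FG := FG) (cvgM (FF := FG) (@cvg_cst _ (s%:R : R) _ GG FG) cM) cN.
    rewrite !horner_exp => /(_ (fDelta x LDx l ls)); apply: filterS => y.
    by rewrite !fctE /= !horner_exp.
  have : \forall y \near GG, forall l : 'I_s.+1, (l <= s)%N ->
    s%:R * normc ((quot_num (padeA Omega (Afun y.2) p q y.1.1) (padeB Omega (Afun y.2) p q y.1.1) l).[y.1.2] -
        (padeB Omega (Afun y.2) p q y.1.1).[y.1.2] ^+ l.+1 * extD Omega (Afun y.2) l y.1.2)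
      < normc ((padeB Omega (Afun y.2) p q y.1.1).[y.1.2] ^+ l.+1).
    by apply: filter_forall => l; exact: cl.
  by apply: filterS => y h l ls; apply: (h (Ordinal (ls : (l < s.+1)%N))).
have near3 : nbhs f [set g : Ainf Omega | forall x, (L `*` K) x -> good_K g x].
  apply: (near_compact (P := fun g => good_K g)) (compact_setX cL cK) _ => x LKx.
  have := two K x LKx; set GG := within _ _ => -[cA cB cz cg].
  have FG : Filter GG by exact: within_filter.
  have hA := pcvg_horner (FG := FG) cA cz; have hB := pcvg_horner (FG := FG) cB cz.
  have hH := pcvg_horner (FG := FG) (pcvg_cst (FG := FG) H) cz; have hG := pcvg_horner (FG := FG) (pcvg_cst (FG := FG) G) cz.
  have c1 := cvgM (FF := FG) (cvgD (FF := FG) (cvg_normc (FG := FG) hA) (cvg_normc (FG := FG) hB)) (cvgD (FF := FG) (cvg_normc (FG := FG) hH) (cvg_normc (FG := FG) hG)).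
  have c2 := cvg_normc (FG := FG) (cvgB (FF := FG) (cvgM (FF := FG) hA hG) (cvgM (FF := FG) hB hH)).
  have := cvg_lt (FG := FG) (cvgM (FF := FG) (@cvg_cst _ (s%:R : R) _ GG FG) c2) c1.
  by move=> /(_ (fK x LKx)).
apply: filterS (filterI near1 (filterI near2 near3)) => g [h1 [h2 h3]].
by split.
Qed.

End Conditions.
End Stage.

(** * Reduction to countably many conditions *)

Section StageEquivalence.
Variables (R : realType) (Omega L Delta K : set (C R)).

(** At [zeta] the first row of the Jacobi determinant reduces to its last entry 1, so the
    denominator takes there the value of the Hankel determinant up to sign. *)
Lemma padeB_neq0 (f : C R -> C R) p q zeta :
  \det (hankel Omega f p q zeta) != 0 -> padeB Omega f p q zeta != 0.
Proof.
apply: contraNneq => B0.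
have : (padeB Omega f p q zeta).[zeta] = 0 by rewrite B0 horner0.
rewrite -horner_evalE /padeB /jacobi_det -det_map_mx (expand_det_row _ ord0).
rewrite (bigD1 ord_max) //= big1 ?addr0 => [|j jm]; last first.
  rewrite !mxE /= rmorphXn /= horner_evalE !hornerE subrr expr0n subn_eq0 leqNgt.
  have : (j < q)%N by rewrite ltn_neqAle -ltnS ltn_ord andbT; apply: contraNneq jm => jq; apply/eqP/val_inj.
  by move=> ->; rewrite /= !mul0r.
rewrite !mxE /= subnn expr0 rmorph1 mul1r /cofactor => /eqP.
rewrite mulf_eq0 signr_eq0 /= => /eqP D0; apply/eqP; rewrite -[RHS]D0; congr (\det _).
apply/matrixP => i j; rewrite !mxE eq_sym (negPf (neq_lift _ _)) /= horner_evalE hornerC.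
congr taylor_coef; rewrite /bump leq0n leqNgt ltn_ord /=; lia.
Qed.

Lemma supremum_lt (T : Type) (A : set T) (g : T -> \bar R) (e : \bar R) : (Defs.supremum A g < e)%E -> forall x, A x -> (g x < e)%E.
Proof.
move=> h x Ax; apply: le_lt_trans h; apply: ereal_sup_ubound; right.
by exists x.
Qed.

Lemma supremum_le (T : Type) (A : set T) (g : T -> \bar R) (e : \bar R) : (0 <= e)%E ->
  (forall x, A x -> (g x <= e)%E) -> (Defs.supremum A g <= e)%E.
Proof.
move=> e0 h; apply: ge_ereal_sup => _ [->//|[x Ax <-]]; exact: h.
Qed.

Lemma supremum_ge0 (T : Type) (A : set T) (g : T -> \bar R) : (0 <= Defs.supremum A g)%E.
Proof. by apply: ereal_sup_ubound; left. Qed.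

Lemma supremum_cvg0 (T : Type) (A : set T) (g : nat -> T -> \bar R) (N : nat) (c : R) : 0 <= c ->
  (forall n, (N <= n)%N -> forall x, A x -> (g n x <= (c / n.+1%:R)%:E)%E) ->
  Defs.supremum A (g n) @[n --> \oo] --> 0%E.
Proof.
move=> c0 h.
apply: (@squeeze_cvge _ _ _ _ (fun=> 0%E) _ (fun n => (c / n.+1%:R)%:E)).
- exists N => // n /= Nn; rewrite supremum_ge0 /=; apply: supremum_le; last exact: h.
  by rewrite lee_fin divr_ge0.
- exact: cvg_cst.
- apply: cvg_EFin; first by apply: nearW.
  rewrite -(mulr0 c); apply: cvgM; first exact: cvg_cst.
  exact: cvg_harmonic.
Qed.

Lemma supremum_near (T : Type) (A : set T) (g : nat -> T -> \bar R) (e : R) : 0 < e ->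
  Defs.supremum A (g n) @[n --> \oo] --> 0%E ->
  \forall n \near \oo, forall x, A x -> (g n x < e%:E)%E.
Proof.
move=> e0 h.
have N : nbhs (0%E : \bar R) [set x | (x < e%:E)%E].
  have e00 : (0%:E < e%:E)%E by rewrite lte_fin.
  exact: (open_nbhs_nbhs (conj (@open_ereal_lt_ereal R e%:E) e00)).
have hN : \forall n \near \oo, (Defs.supremum A (g n) < e%:E)%E := h _ N.
by apply: filterS hN => n hn x Ax; exact: supremum_lt hn _ Ax.
Qed.

Lemma rat_derive_quot (A B : {poly C R}) l z : B.[z] != 0 ->
  rat_derive (tofrac A / tofrac B) l z = (quot_num A B l).[z] / B.[z] ^+ l.+1.
Proof.
move=> Bz; have [sm dE] := quot_smooth A B; rewrite -dE //.
have BE w : B.[w] != 0 -> odflt 0 (rat_value (tofrac A / tofrac B) w) = A.[w] / B.[w].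
  move=> Bw; rewrite rat_value_tofrac ?Bw ?orbT //; first by rewrite /hval (negPf Bw).
  by apply: contraNneq Bw => ->; rewrite horner0.
have [_ h] := smooth_eq (@open_nonroot R B) sm BE.
exact: h.
Qed.

(** Being an implication, it is the whole space for pairs with G = 0 or with a common zero on [K];
    the index can thus range over all coded pairs. *)
Definition stage (F : set (nat * nat)) (H G : {poly C R}) (s : nat) : set (Ainf Omega) :=
  [set g | G != 0 -> (forall z, K z -> (H.[z] != 0) || (G.[z] != 0)) ->
     exists p q, F (p, q) /\ good Omega L Delta K H G s p q g].

Lemma normc_quot_sub (a b d : C R) : b != 0 -> normc (a - b * d) = normc b * normc (a / b - d).
Proof. by move=> b0; rewrite -normc_mul mulrBr mulrCA divff // mulr1. Qed.

Lemma universal_stage F (f : Ainf Omega) H G s :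
  pade_universal F Omega L Delta K f -> stage F H G s f.
Proof.
move=> U G0 HG; have [p [q [Fpq DE cvD cvK]]] := U (tofrac H / tofrac G).
(* [s.+1] rather than [s] allows s = 0 and yields the strict inequality s / (s + 1) < 1. *)
have s0 : 0 < (s.+1%:R : R)^-1 by rewrite invr_gt0 ltr0Sn.
have nD : \forall n \near \oo, forall l : 'I_s.+1, forall zeta, L zeta -> forall z, Delta z ->
    (pade_error Omega f (p n) (q n) zeta l z < (s.+1%:R^-1)%:E)%E.
  apply: filter_forall => l; have := supremum_near s0 (cvD l).
  by apply: filterS => n h zeta Lz z Dz; exact: (supremum_lt (h zeta Lz)).
have nK : \forall n \near \oo, forall zeta, L zeta -> forall z, K z ->
    chordal (rat_value (pade Omega f (p n) (q n) zeta) z) (rat_value (tofrac H / tofrac G) z) < s.+1%:R^-1.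
  have := supremum_near s0 cvK.
  by apply: filterS => n h zeta Lz z Kz; have := supremum_lt (h zeta Lz) Kz; rewrite lte_fin.
have [n [hD hK]] := filter_ex (filterI nD nK).
(* For q = 0 the Hankel determinant is the empty one, equal to 1; thus [good_D] covers both cases of
   [in_D]. *)
have det0 m (M : 'M[C R]_m) : m = 0%N -> \det M != 0.
  by move=> m0; move: M; rewrite m0 => M; rewrite det_mx00 oner_eq0.
have gD zeta : L zeta -> good_D Omega (p n) (q n) f zeta.
  by move=> Lz; have [[/det0 d0|[_ //]] _] := DE n zeta Lz; exact: d0.
have AB zeta z : L zeta -> (K `|` Delta) z ->
    ((padeA Omega f (p n) (q n) zeta).[z] != 0) || ((padeB Omega f (p n) (q n) zeta).[z] != 0).
  move=> Lz Kz; have [_ /(_ z Kz)] := DE n zeta Lz; rewrite /root => E.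
  by apply/negP => /negP; rewrite negb_or !negbK => /andP.
have vE zeta z : L zeta -> (K `|` Delta) z ->
    rat_value (pade Omega f (p n) (q n) zeta) z =
    hval (padeA Omega f (p n) (q n) zeta).[z] (padeB Omega f (p n) (q n) zeta).[z].
  by move=> Lz Kz; apply: rat_value_tofrac; [exact: padeB_neq0 (gD _ Lz)|exact: AB].
exists (p n), (q n); split; first exact: Fpq.
split => [//|[zeta z] [/= Lz Dz] l ls /=|[zeta z] [/= Lz Kz]]; last first.
  rewrite /good_K /=; set A := padeA _ _ _ _ _; set B := padeB _ _ _ _ _.
  have HGz := HG z Kz; have ABz := AB zeta z Lz (or_introl Kz).
  have := hK zeta Lz z Kz; rewrite vE //; last by left.
  rewrite rat_value_tofrac // => /(chordal_lt ABz HGz (ltr0Sn _ _)).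
  apply: le_lt_trans; apply: ler_wpM2r; first exact: ge0_normc.
  by rewrite ler_nat.
have /= := hD (Ordinal (ls : (l < s.+1)%N)) zeta Lz z Dz; rewrite /pade_error /=.
rewrite vE //; last by right.
rewrite /hval; case: eqVneq => // Bz; rewrite lte_fin rat_derive_quot // => h.
have Bl : (padeB Omega f (p n) (q n) zeta).[z] ^+ l.+1 != 0 by rewrite expf_neq0.
rewrite normc_quot_sub // mulrCA gtr_pMr ?normc_gt0 //.
apply: (@le_lt_trans _ _ (s%:R / s.+1%:R)); first by apply: ler_wpM2l; [exact: ler0n|exact: ltW].
by rewrite ltr_pdivrMr ?ltr0Sn // mul1r ltr_nat.
Qed.

(** Polynomials with Gaussian rational coefficients, coded by lists so that [pickle] enumerates
    them. *)
Fixpoint rpoly (s : seq (rat * rat)) : {poly C R} :=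
  if s is x :: t then rpoly t * 'X + ((ratr x.1 : R) +i* (ratr x.2 : R))%C%:P else 0.

Lemma rat_near (x d : R) : 0 < d -> exists r : rat, `|ratr r - x| < d.
Proof.
move=> d0; have : x - d < x + d by lra.
move=> /rat_in_itvoo[r]; rewrite in_itv /= => /andP[h1 h2]; exists r.
by rewrite ltr_norml; apply/andP; split; lra.
Qed.

Lemma rpoly_dense (A : {poly C R}) (M : R) : 0 <= M -> forall d : R, 0 < d ->
  exists s, (A != 0 -> rpoly s != 0) /\
    forall z, normc z <= M -> normc ((rpoly s).[z] - A.[z]) <= d.
Proof.
move=> M0; elim/poly_ind : A => [|A c IH] d d0.
  by exists [::]; split; [rewrite eqxx|move=> z _; rewrite subrr normc0; exact: ltW].
have d1 : 0 < d / 2 / (M + 1) by rewrite !divr_gt0 //; lra.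
have [t [tA ht]] := IH _ d1.
(* Closer than |c| to a nonzero [c], the rational coefficient is nonzero too; this keeps the
   approximant of a nonzero polynomial nonzero. *)
pose e := if c == 0 then d / 2 else Num.min (d / 2) (normc c).
have e0 : 0 < e.
  by rewrite /e; case: eqVneq => c0; rewrite ?lt_min ?normc_gt0 ?c0 ?andbT; lra.
have ed : e <= d / 2 by rewrite /e; case: eqVneq => _ //; rewrite ge_min lexx.
have e2 : 0 < e / 2 by lra.
have [r1 h1] := rat_near (complex.Re c) e2; have [r2 h2] := rat_near (complex.Im c) e2.
pose x : C R := ((ratr r1 : R) +i* (ratr r2 : R))%C.
have xc : normc (x - c) < e.
  by apply: le_lt_trans (normReIm _) _; rewrite ReB ImB /=; lra.
exists ((r1, r2) :: t); split => /= [|z zM]; rewrite -/x.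
  rewrite -!size_poly_eq0 !size_MXaddC; case: (eqVneq A 0) => [A0|/tA t0]; last by rewrite (negPf t0).
  case: (eqVneq c 0) => // c0 _; suff -> : x == 0 = false by rewrite andbF.
  apply/negP => /eqP x0; move: xc; rewrite /e (negPf c0) lt_min x0 sub0r normc_opp ltxx andbF.
  by [].
rewrite !hornerE.
have -> : (rpoly t).[z] * z + x - (A.[z] * z + c) = ((rpoly t).[z] - A.[z]) * z + (x - c) by ring.
apply: le_trans (normc_le_add _ _) _; rewrite normc_mul.
have h : normc ((rpoly t).[z] - A.[z]) * normc z <= d / 2 / (M + 1) * (M + 1).
  by apply: ler_pM; rewrite ?ge0_normc //; [exact: ht|lra].
move: h; rewrite divfK ?gt_eqF //; last by lra.
by lra.
Qed.

(** Approximating both coordinates on [K] works also at zeros of [B], and the strict inequality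
    itself excludes common zeros of the new pair. *)
Lemma pair_dense (A B : {poly C R}) (n : nat) : compact K -> B != 0 ->
  (forall z, K z -> (A.[z] != 0) || (B.[z] != 0)) ->
  exists s t, [/\ rpoly t != 0, forall z, K z -> ((rpoly s).[z] != 0) || ((rpoly t).[z] != 0) &
    forall z, K z -> n%:R * cross (rpoly s).[z] (rpoly t).[z] A.[z] B.[z] <
      n1 (rpoly s).[z] (rpoly t).[z] * n1 A.[z] B.[z]].
Proof.
move=> cK B0 AB; have [c c0 hc] := compact_n1_lb cK AB.
have [M M0 KM] := compact_boundedC cK.
have n0 : 0 <= n%:R :> R by exact: ler0n.
pose eta : R := c / 2 / (n%:R + 2).
have e0 : 0 < eta by rewrite /eta !divr_gt0 //; clear -n0; lra.
have e1 : eta * (n%:R + 2) < c by rewrite /eta divfK ?gt_eqF //; clear -n0 c0; lra.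
have [s [_ hs]] := rpoly_dense A M0 e0; have [t [tB ht]] := rpoly_dense B M0 e0.
have h z : K z -> n%:R * cross (rpoly s).[z] (rpoly t).[z] A.[z] B.[z] <
      n1 (rpoly s).[z] (rpoly t).[z] * n1 A.[z] B.[z].
  by move=> Kz; apply: (@cross_lt R _ _ _ _ n%:R eta c n0 (ltW e0) (hs z (KM z Kz)) (ht z (KM z Kz)) (hc z Kz) e1).
exists s, t; split => [|z Kz|//]; first exact: tB.
apply/negP => /negP; rewrite negb_or !negbK => /andP[/eqP s0 /eqP t0].
have := h z Kz; rewrite s0 t0 /n1 normc0 addr0 mul0r ltNge mulr_ge0 //.
exact: ge0_normc.
Qed.

Lemma stage_universal F (f : Ainf Omega) : compact K ->
  (forall s t n, stage F (rpoly s) (rpoly t) n f) -> pade_universal F Omega L Delta K f.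
Proof.
move=> cK st h; have [A [B [B0 cAB hE]]] := rat_value_coprime h.
have AB z : (A.[z] != 0) || (B.[z] != 0).
  have := coprimep_root cAB; case: eqVneq => //= A0 /(_ z); rewrite /root A0 eqxx.
  exact.
have : forall n, exists pq : nat * nat, F pq /\ exists H G : {poly C R},
   [/\ forall z, K z -> (H.[z] != 0) || (G.[z] != 0),
    forall z, K z -> n.+1%:R * cross H.[z] G.[z] A.[z] B.[z] <= n1 H.[z] G.[z] * n1 A.[z] B.[z] &
    good Omega L Delta K H G n.+1 pq.1 pq.2 f].
  move=> n; have [s [t [t0 HG cr]]] := pair_dense n.+1 cK B0 (fun z _ => AB z).
  have [p [q [Fpq g]]] := st s t n.+1 t0 HG.
  exists (p, q); split => //; exists (rpoly s), (rpoly t); split => // z Kz.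
  by apply: ltW; exact: cr.
move=> /choice[pq hpq]; exists (fun n => (pq n).1), (fun n => (pq n).2).
pose Ap n zeta := padeA Omega f (pq n).1 (pq n).2 zeta.
pose Bp n zeta := padeB Omega f (pq n).1 (pq n).2 zeta.
have B1 n zeta : L zeta -> Bp n zeta != 0.
  by move=> Lz; have [_ [H [G [_ _ [gD _ _]]]]] := hpq n; exact: padeB_neq0 (gD zeta Lz).
have BD n zeta z : L zeta -> Delta z -> (Bp n zeta).[z] != 0.
  move=> Lz Dz; have [_ [H [G [_ _ [_ gD _]]]]] := hpq n.
  have /= h0 := gD (zeta, z) (conj Lz Dz) 0%N (leq0n _).
  rewrite -normc_gt0 -[X in normc X]expr1; apply: le_lt_trans h0.
  by rewrite mulr_ge0 ?ge0_normc.
have ABK n zeta z : L zeta -> K z -> ((Ap n zeta).[z] != 0) || ((Bp n zeta).[z] != 0).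
  move=> Lz Kz; have [_ [H [G [_ _ [_ _ gK]]]]] := hpq n.
  have := gK (zeta, z) (conj Lz Kz); rewrite /good_K /= -/(Ap n zeta) -/(Bp n zeta) => hh.
  apply/negP => /negP; rewrite negb_or !negbK => /andP[/eqP s0 /eqP t0].
  have z0 : n1 (0 : C R) 0 = 0 by rewrite /n1 normc0 addr0.
  by move: hh; rewrite s0 t0 z0 mul0r ltNge mulr_ge0 ?ge0_normc.
split.
- by move=> n; have [Fn _] := hpq n; rewrite -surjective_pairing.
- move=> n zeta Lz; split.
    have [_ [H [G [_ _ [/(_ zeta Lz) gD _ _]]]]] := hpq n.
    by have [->|q0] := posnP (pq n).2; [left|right].
  move=> z [Kz|Dz] [/eqP Az /eqP Bz].
    by have := ABK n zeta z Lz Kz; rewrite Az Bz eqxx.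
  by have := BD n zeta z Lz Dz; rewrite Bz eqxx.
(* The n-th choice controls all orders up to n + 1, hence order l from n = l on. *)
- move=> l; apply: (@supremum_cvg0 _ _ _ l 1) => [//|n ln zeta Lz].
  apply: supremum_le => [|z Dz]; first by rewrite lee_fin divr_ge0.
  have Bz := BD n zeta z Lz Dz.
  rewrite /pade_error rat_value_tofrac ?Bz ?orbT //; last exact: B1.
  rewrite /hval (negPf Bz) lee_fin rat_derive_quot //.
  have [_ [H [G [_ _ [_ gD _]]]]] := hpq n.
  have := gD (zeta, z) (conj Lz Dz) l (leqW ln) => /=.
  have Bl : (Bp n zeta).[z] ^+ l.+1 != 0 by rewrite expf_neq0.
  rewrite normc_quot_sub // mulrCA gtr_pMr ?normc_gt0 // => /ltW hl.
  by rewrite ler_pdivlMr ?ltr0Sn // mulrC.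
(* From the approximant to H/G and from H/G to h, each distance contributes 1 / (n + 1);
   [chordal_le] doubles the sum. *)
- apply: (@supremum_cvg0 _ _ _ 0 4) => [//|n _ zeta Lz].
  apply: supremum_le => [|z Kz]; first by rewrite lee_fin divr_ge0.
  rewrite lee_fin hE rat_value_tofrac; [|exact: B1|exact: ABK].
  have [_ [H [G [HG /(_ z Kz) cr [_ _ gK]]]]] := hpq n.
  have := gK (zeta, z) (conj Lz Kz); rewrite /good_K /= -/(Ap n zeta) -/(Bp n zeta) => /ltW gKz.
  have n20 : 0 < (n.+1%:R / 2 : R) by rewrite divr_gt0.
  have -> : (4 / n.+1%:R : R) = 2 / (n.+1%:R / 2) by field; rewrite addrC natr1 pnatr_eq0.
  apply: chordal_le => //; first exact: ABK.
  have t := cross_triangle (Ap n zeta).[z] (Bp n zeta).[z] H.[z] G.[z] A.[z] B.[z].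
  have hg := n1_gt0 (HG z Kz).
  rewrite -(ler_pM2r hg).
  have a0 : 0 <= n1 (Ap n zeta).[z] (Bp n zeta).[z] by rewrite addr_ge0 ?ge0_normc.
  have b0 : 0 <= n1 A.[z] B.[z] by rewrite addr_ge0 ?ge0_normc.
  have := ler_wpM2r a0 cr; have := ler_wpM2r b0 gKz; have := ler_wpM2l (ltW n20) t.
  move: (n1 (Ap n zeta).[z] _) (n1 A.[z] _) (n1 H.[z] _) => u v w.
  move: (cross (Ap n zeta).[z] _ _ _) (cross _ _ _ _) (cross _ _ _ _) => x y k.
  move: (n.+1%:R : R) => nn; clear; nra.
Qed.

End StageEquivalence.

(** * Completeness and the Baire argument *)

Section Limits.
Variables (R : realType) (Omega : set (C R)).
Hypothesis oO : open Omega.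
Implicit Types (f g r : Ainf Omega) (z w a : C R).

Lemma Ainf_of_derivatives (G : nat -> C R -> C R) :
  (forall l z, Omega z -> is_derive z 1 (G l) (G l.+1 z)) ->
  (forall l, {within closure Omega, continuous (G l)}) ->
  exists g : Ainf Omega, (forall z, Omega z -> g z = G 0%N z) /\
    forall l z, closure Omega z -> extD Omega g l z = G l z.
Proof.
move=> dG cG; pose f z := if `[< Omega z >] then G 0%N z else 0.
have fE z : Omega z -> G 0%N z = f z by move=> Oz; rewrite /f; case: asboolP.
have h := derive1n_local oO fE dG.
have ext l : is_extension Omega (derive1n l f) (G l).
  by split=> [|z Oz]; [exact: cG|have [-> _] := h l z Oz].
have hol z : Omega z -> derivable f z 1 by move=> Oz; have [_] := h 0%N z Oz.
have out z : ~ Omega z -> f z = 0 by rewrite /f; case: asboolP.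
exists (MkAinf hol (fun l => ex_intro _ _ (ext l)) out); split=> [z /fE //|l z cz].
exact: extD_eq (ext l) z cz.
Qed.

Lemma cvgC_unique (u : nat -> C R) (a b : C R) :
  u n @[n --> \oo] --> a -> u n @[n --> \oo] --> b -> a = b.
Proof.
move=> /cvgCP_seq ua /cvgCP_seq ub; apply/eqP; rewrite -subr_eq0 -normc_eq0.
rewrite eq_le ge0_normc andbT leNgt; apply/negP => p.
have p2 : 0 < normc (a - b) / 2 by lra.
have [N hN] := ua _ p2; have [M hM] := ub _ p2.
have := hN (N + M)%N (leq_addr _ _); have := hM (N + M)%N (leq_addl _ _).
have := normc_triangle (u (N + M)%N) a b; rewrite (normc_sub a (u _)); lra.
Qed.

Lemma is_derive_eq_ball (f g : C R -> C R) a d (rho : R) : 0 < rho ->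
  (forall w, normc (w - a) < rho -> f w = g w) -> is_derive a 1 f d -> is_derive a 1 g d.
Proof.
move=> r0 fg /deriveCP h; apply/deriveCP => e e0; have [r1 r10 hr] := h e e0.
exists (Num.min rho r1); first by rewrite lt_min r0.
move=> w; rewrite lt_min => /andP[w1 w2]; rewrite -!fg //; first exact: hr.
by rewrite subrr normc0.
Qed.

Variables (r : nat -> Ainf Omega) (m : nat -> nat) (e : nat -> R).
Hypothesis e0 : forall k, 0 < e k.
Hypothesis e_half : forall k, e k.+1 <= e k / 2.
Hypothesis m_le : forall k, (m k <= m k.+1)%N.
Hypothesis m_ge : forall k, (k <= m k.+1)%N.
Hypothesis close : forall k, within_ball Omega (m k) (e k / 2) (r k) (r k.+1).

(** One step costs at most [e k / 2], and all later ones together at most [e k.+1], which is again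
    at most [e k / 2]. *)
Let nested d k : within_ball Omega (m k) (e k) (r k) (r (k + d)%N).
Proof.
elim: d k => [|d IH] k l z lm cz zm.
  by rewrite addn0 subrr normc0; exact: ltW.
have zm' : normc z <= (m k.+1)%:R by apply: le_trans zm _; rewrite ler_nat.
have := IH k.+1 l z (leq_trans lm (m_le k)) cz zm'; have := close lm cz zm.
have := normc_triangle (extD Omega (r k.+1) l z) (extD Omega (r (k.+1 + d)%N) l z) (extD Omega (r k) l z).
rewrite -addSnnS; have := e_half k; lra.
Qed.

Lemma small_radius (N : nat) (d : R) : 0 < d -> exists k, (N <= m k)%N /\ e k < d.
Proof.
move=> d0; have ek k : e k * k.+1%:R <= e 0%N.
  elim: k => [|k IH]; first by rewrite mulr1.
  have k0 : 0 <= k%:R :> R by exact: ler0n.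
  apply: le_trans IH; have k2 : 0 <= k.+2%:R :> R by exact: ler0n.
  apply: le_trans (ler_wpM2r k2 (e_half k)) _; rewrite -(natr1 k.+1) -(natr1 k).
  have := mulr_ge0 (ltW (e0 k)) k0; lra.
pose n := (Num.truncn (e 0%N / d)).+1.
have hn : e 0%N / d < n%:R by exact: truncnS_gt.
exists (N + n).+1; split; first exact: leq_trans (leq_addr _ _) (m_ge _).
have n0 : 0 < (N + n).+2%:R :> R by rewrite ltr0Sn.
rewrite -(ltr_pM2r n0); apply: le_lt_trans (ek _) _.
rewrite mulrC -ltr_pdivrMr //; apply: lt_le_trans hn _; rewrite ler_nat.
by rewrite -addSn -addSn leq_addl.
Qed.

(** Limits exist pointwise for every order; uniform closeness makes them continuous on the closure,
    and inside [Omega] [smooth_limit] identifies them as successive derivatives. *)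
Lemma Ainf_limit : exists f : Ainf Omega, forall k, within_ball Omega (m k) (e k) (r k) f.
Proof.
have : forall x : nat * C R, exists a : C R, closure Omega x.2 ->
    extD Omega (r n) x.1 x.2 @[n --> \oo] --> a.
  move=> [l z] /=; have [cz|ncz] := pselect (closure Omega z); last by exists 0 => /ncz.
  have [d d0|a ha] := @cauchyC R (fun n => extD Omega (r n) l z); last (exists a => _; exact: ha).
  have [k [Nk ek]] := small_radius (maxn l (Num.truncn (normc z)).+1) d0.
  exists k => n kn; apply: le_lt_trans ek; rewrite -(subnKC kn); apply: nested => //.
    by apply: leq_trans Nk; exact: leq_maxl.
  apply: ltW; apply: lt_le_trans (truncnS_gt _) _; rewrite ler_nat.
  by apply: leq_trans Nk; exact: leq_maxr.
move=> /choice[F' hF']; pose F l z := F' (l, z).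
have hF l z : closure Omega z -> extD Omega (r n) l z @[n --> \oo] --> F l z by exact: (hF' (l, z)).
have Fr k l z : (l <= m k)%N -> closure Omega z -> normc z <= (m k)%:R ->
    normc (F l z - extD Omega (r k) l z) <= e k.
  move=> lm cz zm; apply: (@normc_lim R (fun n => extD Omega (r (k + n)%N) l z)).
    have /cvgCP_seq h := hF l z cz; apply/cvgCP_seq => d /h[N hN].
    by exists N => n Nn; apply: hN; exact: leq_trans Nn (leq_addl _ _).
  by move=> n; exact: nested.
have cF l : {within closure Omega, continuous (F l)}.
  apply/withinP => z cz d d0; have d3 : 0 < d / 3 by lra.
  have [k [Nk ek]] := small_radius (maxn l (Num.truncn (normc z + 1)).+1) d3.
  have [rho rho0 hr] := extD_within (r k) l cz d3.
  have lk : (l <= m k)%N by apply: leq_trans Nk; exact: leq_maxl.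
  have zk : normc z + 1 <= (m k)%:R.
    apply: ltW; apply: lt_le_trans (truncnS_gt _) _; rewrite ler_nat.
    by apply: leq_trans Nk; exact: leq_maxr.
  exists (Num.min rho 1); first by rewrite lt_min rho0 ltr01.
  move=> w cw; rewrite lt_min => /andP[w1 w2].
  have zk' : normc z <= (m k)%:R by lra.
  have wk : normc w <= (m k)%:R.
    by have := normc_triangle z w 0; rewrite !subr0; lra.
  have := Fr k l z lk cz zk'; have := Fr k l w lk cw wk; have := hr w cw w1.
  have := normc_triangle (extD Omega (r k) l w) (F l w) (F l z).
  have := normc_triangle (extD Omega (r k) l z) (extD Omega (r k) l w) (F l z).
  rewrite (normc_sub (extD Omega (r k) l z) (F l z)); lra.
have OC z : Omega z -> closure Omega z by exact: subset_closure.
have hFd l z : Omega z -> derive1n l (r n) z @[n --> \oo] --> F l z.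
  move=> Oz; have /cvgCP_seq h := hF l z (OC z Oz); apply/cvgCP_seq => d /h[N hN].
  by exists N => n /hN; rewrite extD_in.
have dF l z : Omega z -> is_derive z 1 (F l) (F l.+1 z).
  move=> Oz; have [rho rho0 hrho] := openCP oO Oz.
  pose t := rho / 2; have t0 : 0 < t by rewrite /t; lra.
  have Ot w : normc (w - z) <= t -> Omega w by move=> h; apply: hrho; rewrite /t in h; lra.
  have bnd n i : exists S, forall v, normc (v - z) <= t -> normc (derive1n i (r n) v) <= S.
    apply: continuous_disc_bound => v /Ot Ov.
    exact: (@smooth_continuous R Omega (r n) i v (@within_smooth R Omega oO (r n)) Ov).
  have bnds k i : exists S, forall n v, (n < k)%N -> normc (v - z) <= t -> normc (derive1n i (r n) v) <= S.
    elim: k => [|k [S hS]]; first by exists 0.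
    have [S' hS'] := bnd k i; exists (Num.max S S') => n v; rewrite ltnS leq_eqVlt le_max.
    by move=> /predU1P[-> /hS'->|nk /hS->]; rewrite ?orbT.
  (* The bound is uniform in n: members up to index [k] are bounded on the compact disc, and later
     ones are within 1 of the k-th. *)
  have bndM i : exists S, forall n v, normc (v - z) < t -> normc (derive1n i (r n) v) <= S.
    have [k [Nk ek]] := small_radius (maxn i (Num.truncn (normc z + t)).+1) ltr01.
    have ik : (i <= m k)%N by apply: leq_trans Nk; exact: leq_maxl.
    have zk : normc z + t <= (m k)%:R.
      apply: ltW; apply: lt_le_trans (truncnS_gt _) _; rewrite ler_nat.
      by apply: leq_trans Nk; exact: leq_maxr.
    have [S hS] := bnds k.+1 i; exists (S + 1) => n v vt.
    have S1 n' : (n' < k.+1)%N -> normc (derive1n i (r n') v) <= S.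
      by move=> h; apply: hS => //; exact: ltW.
    have [/S1 h|kn] := ltnP n k.+1; first by lra.
    have Ov := Ot v (ltW vt).
    have vk : normc v <= (m k)%:R.
      by have := normc_triangle z v 0; rewrite !subr0; lra.
    have := @nested (n - k) k i v ik (OC v Ov) vk; rewrite (subnKC (ltnW kn)) !extD_in //.
    have := S1 k (ltnSn k); have := normc_triangle (derive1n i (r k) v) (derive1n i (r n) v) 0.
    by rewrite !subr0; lra.
  move=> /choice in bndM; have [M hM] := bndM.
  have [G [G0 dG cG]] := @smooth_limit R (fun n i => derive1n i (r n)) (F 0%N) z t M
    (fun n i w wt => smooth_is_derive i (@within_smooth R Omega oO (r n)) (Ot w (ltW wt)))
    (fun n i w wt => hM i n w wt)
    (fun w wt => hFd 0%N w (Ot w (ltW wt))).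
  have GF i w : normc (w - z) < t -> G i w = F i w.
    move=> wt; have Ow := Ot w (ltW wt); apply: cvgC_unique (cG i w wt) _.
    exact: hFd.
  have zz : normc (z - z) < t by rewrite subrr normc0.
  rewrite -(GF l.+1 z zz); exact: is_derive_eq_ball t0 (GF l) (dG l z zz).
have [f [_ fF]] := Ainf_of_derivatives dF cF.
by exists f => k l z lm cz zm; rewrite fF //; exact: Fr.
Qed.

End Limits.

Section Rationals.
Variables (R : realType) (Omega : set (C R)).
Hypothesis oO : open Omega.
Implicit Types (f g r : Ainf Omega) (P Q : {poly C R}).

Lemma rationals_off_quot r : rationals_off r -> exists P Q,
  (forall z, closure Omega z -> Q.[z] != 0) /\ forall z, Omega z -> r z = P.[z] / Q.[z].
Proof.
move=> [h [hc hO]]; have [P [Q [_ _ hE]]] := rat_value_coprime h.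
have Qz z : closure Omega z -> Q.[z] != 0.
  by move=> /hc; rewrite hE /hval; case: eqVneq.
exists P, Q; split=> [//|z Oz]; have := hO z Oz.
by rewrite hE /hval (negPf (Qz z (@subset_closure _ _ z Oz))) => -[].
Qed.

Lemma rational_extD r P Q l z : (forall z, closure Omega z -> Q.[z] != 0) ->
  (forall z, Omega z -> r z = P.[z] / Q.[z]) -> closure Omega z ->
  extD Omega r l z = (quot_num P Q l).[z] / Q.[z] ^+ l.+1.
Proof.
move=> Q0 rE cz; have [sm dE] := quot_smooth P Q; rewrite -dE; last exact: Q0.
exact: (extD_eq (extD_smooth oO l (@open_nonroot R Q) Q0 sm rE)).
Qed.

Lemma quot_rationals_off P Q : (forall z, closure Omega z -> Q.[z] != 0) ->
  exists r, rationals_off r /\ forall z, Omega z -> r z = P.[z] / Q.[z].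
Proof.
move=> Q0; have [sm dE] := quot_smooth P Q.
have [r [rE _]] : exists r : Ainf Omega, (forall z, Omega z -> r z = P.[z] / Q.[z]) /\
    forall l z, closure Omega z -> extD Omega r l z = derive1n l (fun w => P.[w] / Q.[w]) z.
  apply: (@Ainf_of_derivatives R Omega oO (fun l => derive1n l (fun w => P.[w] / Q.[w]))) => [l z Oz|l].
    by apply: smooth_is_derive sm _; apply: Q0; exact: subset_closure.
  by have [] := extD_smooth oO l (@open_nonroot R Q) Q0 sm (fun z _ => erefl (P.[z] / Q.[z])).
exists r; split; last exact: rE.
have vE z : closure Omega z -> rat_value (tofrac P / tofrac Q) z = Some (P.[z] / Q.[z]).
  move=> cz; have Qz := Q0 z cz; rewrite rat_value_tofrac ?Qz ?orbT //; first by rewrite /hval (negPf Qz).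
  by apply: contraNneq Qz => ->; rewrite horner0.
exists (tofrac P / tofrac Q); split=> z; first by move=> /vE ->.
by move=> Oz; rewrite rE // vE //; exact: subset_closure.
Qed.

Lemma within_ballS m1 m2 (e1 e2 : R) (f g : C R -> C R) : (m1 <= m2)%N -> e2 <= e1 ->
  within_ball Omega m2 e2 f g -> within_ball Omega m1 e1 f g.
Proof.
move=> m12 e21 fg l z lm cz zm; apply: le_trans e21; apply: fg => //; first exact: leq_trans m12.
by apply: le_trans zm _; rewrite ler_nat.
Qed.

Lemma within_ball_refl m (e : R) (f : C R -> C R) : 0 <= e -> within_ball Omega m e f f.
Proof. by move=> e0 l z _ _ _; rewrite subrr normc0. Qed.

Lemma within_ball_sym m (e : R) (f g : C R -> C R) :
  within_ball Omega m e f g -> within_ball Omega m e g f.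
Proof. by move=> h l z lm cz zm; rewrite normc_sub; exact: h. Qed.

(** All centres of the nested balls are rational functions, so the limit lies in their closure
    [Xinf]; completeness of the larger space A^oo is then enough. *)
Lemma baire_rationals (S : nat -> set (Ainf Omega)) (V : set (Ainf Omega)) r0 :
  (forall j, open (S j)) ->
  (forall j r m (e : R), rationals_off r -> 0 < e ->
     exists r', [/\ rationals_off r', within_ball Omega m e r r' & S j r']) ->
  open V -> V r0 -> rationals_off r0 ->
  exists f, [/\ Xinf Omega f, V f & forall j, S j f].
Proof.
move=> oS dS oV Vr0 rat0; have [m0 [e0 e00 hV]] := Aopen_ball oO oV Vr0.
pose T : Type := (Ainf Omega * nat * R)%type.
pose ok (x : T) := rationals_off x.1.1 /\ 0 < x.2.
pose step j (x y : T) := [/\ ok y, y.2 <= x.2 / 2, (x.1.2 <= y.1.2)%N, (j <= y.1.2)%N &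
  within_ball Omega x.1.2 (x.2 / 2) x.1.1 y.1.1 /\
  forall g : Ainf Omega, within_ball Omega y.1.2 y.2 y.1.1 g -> S j g].
have : forall jx : nat * T, exists y : T, ok jx.2 -> step jx.1 jx.2 y.
  move=> [j [[r m] e]]; have [[/= rr e1]|no] := pselect (ok (r, m, e)); last by exists (r, m, e) => /no.
  have e2 : 0 < e / 2 by lra.
  have [r' [rr' rr'b Sr']] := dS j r m (e / 2) rr e2.
  have [m1 [e3 e30 hS]] := Aopen_ball oO (oS j) Sr'.
  exists (r', maxn m (maxn j m1), Num.min (e / 2) e3) => _; split => /=.
  - by split => //=; rewrite lt_min e2.
  - by rewrite ge_min lexx.
  - exact: leq_maxl.
  - by rewrite leq_max leq_maxl orbT.
  - split => // g gb; apply: hS; apply: within_ballS gb.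
      by rewrite leq_max leq_maxr orbT.
    by rewrite ge_min lexx orbT.
move=> /choice[nxt hn].
pose x := fix x k : T := if k is j.+1 then nxt (j, x j) else (r0, m0, e0).
have okx k : ok (x k).
  by elim: k => [|k IH]; [split|have [] := hn (k, x k) IH].
have st k : step k (x k) (x k.+1) := hn (k, x k) (okx k).
have e_pos k : 0 < (x k).2 by have [] := okx k.
have e_half k : (x k.+1).2 <= (x k).2 / 2 by have [] := st k.
have m_le k : ((x k).1.2 <= (x k.+1).1.2)%N by have [] := st k.
have m_ge k : (k <= (x k.+1).1.2)%N by have [] := st k.
have near k : within_ball Omega (x k).1.2 ((x k).2 / 2) (x k).1.1 (x k.+1).1.1 by have [_ _ _ _ []] := st k.
have [f hf] := @Ainf_limit R Omega oO (fun k => (x k).1.1) (fun k => (x k).1.2) (fun k => (x k).2)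
  e_pos e_half m_le m_ge near.
exists f; split.
- move=> U; rewrite nbhsE => -[B [oB Bf] BU].
  have [m [e e1 hB]] := Aopen_ball oO oB Bf.
  have [k [mk ek]] := @small_radius R (fun k => (x k).1.2) (fun k => (x k).2) e_pos e_half m_ge m e e1.
  exists (x k).1.1; split; first exact: (okx k).1.
  apply: BU; apply: hB; apply: within_ball_sym; apply: within_ballS mk (ltW ek) (hf k).
- by apply: hV; exact: (hf 0%N).
- by move=> j; have [_ _ _ _ [_]] := st j; apply; exact: (hf j.+1).
Qed.

End Rationals.

(** * Density and the G-delta property *)

Section Universal.
Variables (R : realType) (F : set (nat * nat)) (Omega L Delta K : set (C R)).
Hypothesis hF : exists p q : nat -> nat,
       [/\ forall n, F (p n, q n), p n @[n --> \oo] --> \oo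
         & q n @[n --> \oo] --> \oo].
Hypothesis oO : open Omega.
Hypothesis cL : compact L.
Hypothesis LO : L `<=` closure Omega.
Hypothesis cD : compact Delta.
Hypothesis DO : Delta `<=` closure Omega.
Hypothesis cK : compact K.
Hypothesis KO : K `&` closure Omega = set0.

Lemma stage_open H G s : open (stage L Delta K F H G s : set (Ainf Omega)).
Proof.
(* Openness passes through the union over (p, q); the hypothesis on (H, G) is put in front of both
   conditions, since it depends on neither g nor (p, q). *)
have -> : (stage L Delta K F H G s : set (Ainf Omega)) =
    \bigcup_(pq in [set pq | (G != 0 /\ forall z, K z -> (H.[z] != 0) || (G.[z] != 0)) -> F pq])
      [set g : Ainf Omega | (G != 0 /\ forall z, K z -> (H.[z] != 0) || (G.[z] != 0)) ->
        good Omega L Delta K H G s pq.1 pq.2 g].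
  apply/seteqP; split=> g.
    move=> st; have [[G0 HG]|no] := pselect (G != 0 /\ forall z, K z -> (H.[z] != 0) || (G.[z] != 0)).
      by have [p [q [Fpq gd]]] := st G0 HG; exists (p, q).
    by exists (0, 0)%N => [/no|/no].
  by move=> [[p q] /= hp hg] G0 HG; exists p, q; split; [exact: hp|exact: hg].
apply: bigcup_open => -[p q] _ /=.
have [y|no] := pselect (G != 0 /\ forall z, K z -> (H.[z] != 0) || (G.[z] != 0)).
  have -> : [set g : Ainf Omega | (G != 0 /\ forall z, K z -> (H.[z] != 0) || (G.[z] != 0)) ->
        good Omega L Delta K H G s p q g] = [set g : Ainf Omega | good Omega L Delta K H G s p q g].
    by apply/seteqP; split=> g /=; [exact|move=> h _].
  exact: (@open_good R Omega L Delta K oO LO DO cL cD cK H G s p q).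
have -> : [set g : Ainf Omega | (G != 0 /\ forall z, K z -> (H.[z] != 0) || (G.[z] != 0)) ->
        good Omega L Delta K H G s p q g] = setT.
  by apply/seteqP; split=> g //= _ /no.
exact: openT.
Qed.

Lemma stage_step H G s (r : Ainf Omega) m (e : R) : rationals_off r -> 0 < e -> exists r' : Ainf Omega,
  [/\ rationals_off r', within_ball Omega m e r r' & stage L Delta K F H G s r'].
Proof.
move=> rr e0; have rfl := @within_ball_refl R Omega m e r (ltW e0).
have [[G0 HG]|no] := pselect (G != 0 /\ forall z, K z -> (H.[z] != 0) || (G.[z] != 0)); last first.
  by exists r; split=> // G0 HG; case: no.
(* The approximation needs a point of the closure, which [L] provides; for empty [L] the conditions
   are void and any member of [F] serves. *)
have [[z0 z0L]|L0] := pselect (L !=set0); last first.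
  have nL z : ~ L z by move=> Lz; apply: L0; exists z.
  have [p [q [Fpq _ _]]] := hF; exists r; split=> // _ _; exists (p 0%N), (q 0%N); split=> //.
  by split=> [z /nL|[z w] [/nL]|[z w] [/nL]].
have [P [Q [Q0 rE]]] := rationals_off_quot rr.
have s0 : 0 <= s%:R :> R by exact: ler0n.
have [P' [Q' [p [q [Fpq cop [sP sQ] Q'0 [hd hK]]]]]] :=
  approximation_step P m hF (ex_intro _ z0 (LO z0L)) cK KO Q0 HG s0 e0.
have [r' [rr' r'E]] := quot_rationals_off oO P' Q'0.
exists r'; split=> //.
  move=> l z lm cz zm; have := hd l z lm cz zm.
  have [_ dE] := quot_smooth P Q; have [_ dE'] := quot_smooth P' Q'.
  by rewrite (rational_extD oO l Q0 rE cz) (rational_extD oO l Q'0 r'E cz) dE ?Q0 // dE' ?Q'0.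
move=> _ _; exists p, q; split=> //.
have pr zeta : L zeta -> \det (hankel Omega r' p q zeta) != 0 /\ exists2 c : C R,
    c != 0 & padeA Omega r' p q zeta = c *: P' /\ padeB Omega r' p q zeta = c *: Q'.
  move=> /LO cz; apply: pade_rational => //; first exact: Q'0.
  by move=> l; exact: (rational_extD oO l Q'0 r'E cz).
split=> [zeta /pr [] //|[zeta z] [/= Lz Dz] l ls|[zeta z] [/= Lz Kz]].
  have [_ [c c0 [AE BE]]] := pr zeta Lz; rewrite AE BE /=.
  have cQ0 w : closure Omega w -> (c *: Q').[w] != 0.
    by move=> cw; rewrite hornerZ mulf_neq0 ?Q'0.
  have r'E' w : Omega w -> r' w = (c *: P').[w] / (c *: Q').[w].
    by move=> Ow; rewrite r'E // !hornerZ -mulf_div divff // mul1r.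
  have cz := DO Dz; have B0 : (c *: Q').[z] ^+ l.+1 != 0 by rewrite expf_neq0 ?cQ0.
  (* The approximant is [r'] itself, written with the scaled pair that the Jacobi formula returns,
     so the left side is 0. *)
  rewrite (rational_extD oO l cQ0 r'E' cz) mulrCA divff // mulr1 subrr normc0 mulr0 normc_gt0.
  exact: B0.
have [_ [c c0 [AE BE]]] := pr zeta Lz; rewrite /good_K /= AE BE !hornerZ.
rewrite cross_scale n1_scale mulrCA -mulrA ltr_pM2l ?normc_gt0 //; exact: hK.
Qed.

(** Enumerates triples of numerator, denominator and precision; numbers that code nothing impose no
    condition. *)
Let stages (j : nat) : set (Ainf Omega) :=
  if unpickle j is Some x then stage L Delta K F (rpoly R x.1.1) (rpoly R x.1.2) x.2 else setT.

Let stages_open j : open (stages j).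
Proof. by rewrite /stages; case: unpickle => [x|]; [exact: stage_open|exact: openT]. Qed.

Let universalE (f : Xinf Omega) : universal F Omega L Delta K f <->
  forall j, stages j (set_val f).
Proof.
split=> [U j|h].
  by rewrite /stages; case: unpickle => // x; exact: universal_stage.
apply: stage_universal => // s t n; have := h (pickle (s, t, n)).
by rewrite /stages pickleK.
Qed.

Lemma dense_universal : dense (universal F Omega L Delta K).
Proof.
move=> O [[f Xf] Of] [V oV VE]; have Vf : V f by have : (set_val @^-1` V) (exist _ f Xf) by rewrite VE.
(* [f] lies in the closure of the rational functions, so [V] contains one of them to start from. *)
have [r [rr Vr]] := set_mem Xf V (open_nbhs_nbhs (conj oV Vf)).
have dS j (r' : Ainf Omega) m (e : R) : rationals_off r' -> 0 < e -> exists r'' : Ainf Omega,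
    [/\ rationals_off r'', within_ball Omega m e r' r'' & stages j r''].
  rewrite /stages; case: unpickle => [x|] rr' e0; first exact: stage_step.
  by exists r'; split=> //; exact: within_ball_refl (ltW e0).
have [g [Xg Vg Sg]] := @baire_rationals R Omega oO stages V r stages_open dS oV Vr rr.
exists (exist _ g (mem_set Xg)); split; first by rewrite -VE.
by apply/universalE.
Qed.

Lemma Gdelta_universal : Gdelta (universal F Omega L Delta K).
Proof.
exists (fun j => set_val @^-1` stages j).
  by move=> j; exists (stages j).
apply/seteqP; split=> f.
  by move=> /universalE h j _; exact: h.
by move=> h; apply/universalE => j; exact: h.
Qed.

Lemma Xinf_nonempty : exists f : Xinf Omega, True.
Proof.
have Q0 z : closure Omega z -> (1 : {poly C R}).[z] != 0 by rewrite hornerC oner_eq0.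
have [r [rr _]] := quot_rationals_off oO 0 Q0.
by exists (exist _ r (mem_set (@subset_closure _ _ r rr))).
Qed.

End Universal.

Theorem theorem3p1 (R : realType) (F : set (nat * nat))
    (Omega L Delta K : set (C R))
    (hF : exists p q : nat -> nat,
       [/\ forall n, F (p n, q n), p n @[n --> \oo] --> \oo
         & q n @[n --> \oo] --> \oo])
    (hOmega : open Omega)
    (hL : compact L) (hLOmega : L `<=` closure Omega)
    (hDelta : compact Delta) (hDeltaOmega : Delta `<=` closure Omega)
    (hK : compact K) (hKOmega : K `&` closure Omega = set0) :
  (exists f : Xinf Omega, universal F Omega L Delta K f) /\
  (dense (universal F Omega L Delta K) /\
   Gdelta (universal F Omega L Delta K)).
Proof.
have dU := dense_universal hF hOmega hL hLOmega hDelta hDeltaOmega hK hKOmega.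
split; last by split=> //; exact: Gdelta_universal.
have [g _] := Xinf_nonempty hOmega.
by have [f [_ Uf]] := dU setT (ex_intro _ g I) openT; exists f.
Qed.
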